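(* A graph $G$ belongs to $\mathcal{U}_4$ if and only if $G$ is isomorphic to an extended prism with extension pattern $(3,1)$ or with extension pattern $(3,3,\dots,3)$ ($k$ entries) for some $k\ge 2$.
   Context: In a bridgeless cubic graph, an edge is lonely if it belongs to exactly one perfect matching; $l(G)$ is the number of lonely edges. $\mathcal{U}$ is the class of 3-connected cubic graphs having at least one lonely edge, and $\mathcal{U}_k=\{G\in\mathcal{U}: l(G)=k\}$. Replacing a vertex $x$ of a cubic graph by a triangle means deleting $x$, adding three new mutually adjacent vertices, and joining each of them to a distinct neighbour of $x$. The prism $Pr$ is the 6-vertex cubic graph consisting of two vertex-disjoint triangles $T_u$ and $T_v$ together with a perfect matching of three edges between them. Label the vertices of $T_v$ as $x_1,x_2,x_3$. For $s\in\{1,2,3\}$, a $T_v$-extension of index $s$ replaces $x_s$ by a new triangle $y_1y_2y_3$ in which, for each $j\ne s$, $y_j$ is joined to $x_j$, and $y_s$ is joined to the neighbour of $x_s$ outside $T_v$; afterwards the new triangle becomes $T_v$ and its vertices are renamed $x_i:=y_i$. An extended prism with extension pattern $(s_1,\dots,s_m)$, $s_i\in\{1,2,3\}$, is the graph obtained from $Pr$ by applying successively $T_v$-extensions of indices $s_1,\dots,s_m$. (The isomorphism type depends only on the pattern up to a permutation of the labels $\{1,2,3\}$ and up to reversal of the pattern.) *)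

(* Defs.v *)
From mathcomp Require Import all_boot.
Set Implicit Arguments. Unset Strict Implicit. Unset Printing Implicit Defensive.

Section Graphs.
Variable T : finType.
Variable e : rel T.

Definition cubic : Prop := forall x : T, #|[set y | e x y]| = 3.

Definition connected_without (X : {set T}) : Prop :=
  forall x y : T, x \notin X -> y \notin X ->
    connect (fun a b => [&& e a b, a \notin X & b \notin X]) x y.

Definition three_connected : Prop :=
  3 < #|T| /\ forall X : {set T}, #|X| < 3 -> connected_without X.

Definition edge_set : {set {set T}} :=
  [set [set p.1; p.2] | p in [set p : T * T | e p.1 p.2]].

Definition perfect_matching (M : {set {set T}}) : bool :=
  (M \subset edge_set) && [forall x : T, #|[set f in M | x \in f]| == 1].

Definition lonely (f : {set T}) : bool :=
  (f \in edge_set) && (#|[set M | perfect_matching M & f \in M]| == 1).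

Definition num_lonely : nat := #|[set f in edge_set | lonely f]|.

Definition in_U4 : Prop :=
  [/\ cubic, three_connected, (exists f, lonely f) & num_lonely = 4].

End Graphs.

(** * Extended prisms, built on vertex set {0, ..., pn - 1}. *)
Record pgraph := PGraph {
  pn : nat;
  padj : nat -> nat -> bool;
  ptv : nat -> nat            (* labels x_1, x_2, x_3 of the triangle T_v *)
}.

Definition eqp (a b c d : nat) : bool := ((a == c) && (b == d)) || ((a == d) && (b == c)).

(** The prism: T_u = {0,1,2} (u_1,u_2,u_3), T_v = {3,4,5} (x_1,x_2,x_3),
    matching u_i -- x_i. *)
Definition prism : pgraph :=
  PGraph 6
    (fun a b => [|| eqp a b 0 1, eqp a b 1 2, eqp a b 0 2,
                    eqp a b 3 4, eqp a b 4 5, eqp a b 3 5,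
                    eqp a b 0 3, eqp a b 1 4 | eqp a b 2 5])
    (fun i => i + 2).

Definition idx3 : seq nat := [:: 1; 2; 3].

(** T_v-extension of index s.  The old vertex x_s is reused as y_s (it keeps
    its edge to its neighbour outside T_v); the two new vertices y_j (j <> s)
    get the labels n, n+1.  Edges x_s x_j (j <> s) are deleted; edges
    y_j x_j (j <> s) and the triangle y_1 y_2 y_3 are added. *)
Definition ext (g : pgraph) (s : nat) : pgraph :=
  let n := pn g in
  let x := ptv g in
  let y := fun j => if j == s then x s else n + (j.-1 - (s < j)) in
  PGraph n.+2
    (fun a b =>
       (padj g a b && ~~ has (fun j => (j != s) && eqp a b (x s) (x j)) idx3)
       || has (fun j => (j != s) && eqp a b (y j) (x j)) idx3
       || has (fun i => has (fun j => (i != j) && eqp a b (y i) (y j)) idx3) idx3)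
    y.

Definition ext_prism (pat : seq nat) : pgraph := foldl ext prism pat.

Definition iso_to (T : finType) (e : rel T) (g : pgraph) : Prop :=
  exists f : T -> 'I_(pn g), bijective f /\
    forall x y : T, e x y = padj g (f x) (f y).

(* Main.v *)
Require Import Defs.
From mathcomp Require Import all_boot zify.
Set Implicit Arguments. Unset Strict Implicit. Unset Printing Implicit Defensive.

(* If f is a lonely edge with ends v and a, then G - {v, a} has a unique perfect matching, so by
   Kotzig's theorem one of its matching edges g is a bridge.  Since G is 3-edge-connected, G - v
   consists of a and of two pieces joined by g, each of which has a cut of three edges and again
   a unique perfect matching once the end of g is removed.  Iterating, G is described by a binary
   tree, which determines it up to isomorphism.  The number of perfect matchings through an edge
   is computed along the tree by a transfer rule, and only a few configurations of the tree yield
   the value 1.  Up to the symmetries of the construction, four lonely edges occur for two sporadic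
   trees, both giving the pattern (3,1), and for a family of combs, giving (3,...,3). *)

(** * Edges, cuts and blobs *)

(** A blob has an odd number of vertices, so a matching uses one or three of its cut edges, and it
    can use [f] alone in one way only. Three numbers per tree remain. They obey recursions such as x
    = z' + x' x'', where x is never zero and z is zero only for a leaf. A count equal to 1 therefore
    forces leaves, which is why so few trees survive. The obstacle is that one graph has many trees:
    they depend on the lonely edge, on which of its ends is left out and on the order of the
    children. The classification is therefore carried out for an arbitrary property of trees closed
    under these symmetries, and the two trees of (3,1) come from different lonely edges. No
    isomorphism with an extended prism is built by hand: a labelled decomposition of each pattern
    serves both implications, because a graph with such a tree is automatically cubic and
    3-connected. In the decomposition, connectivity enters only as the lower bound 3 on edge cuts,
    which divides the cut edges evenly between the two pieces. *)

Section Cuts.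
Variables (T : finType) (e : rel T).
Hypothesis e_sym : symmetric e.
Hypothesis e_irr : irreflexive e.
Implicit Types (x y z : T) (E f : {set T}) (A B C N X Y S : {set T}).

Definition star x := [set f in edge_set e | x \in f].
Definition cut S := [set f in edge_set e | (f :&: S != set0) && ~~ (f \subset S)].
Definition inner S := [set f in edge_set e | f \subset S].

Lemma edgeP f : reflect (exists x y, e x y /\ f = [set x; y]) (f \in edge_set e).
Proof.
apply: (iffP imsetP) => [[[x y]]|[x [y [xy ->]]]].
  by rewrite inE /= => xy ->; exists x, y.
by exists (x, y) => //; rewrite inE.
Qed.

Lemma edge_neq x y : e x y -> x != y.
Proof. by move=> xy; apply/eqP => eq; rewrite eq e_irr in xy. Qed.

Lemma set2_edge x y : ([set x; y] \in edge_set e) = e x y.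
Proof.
apply/edgeP/idP => [[u [v [uv eq]]]|xy]; last by exists x, y.
have nuv := edge_neq uv.
have : u \in [set x; y] by rewrite eq !inE eqxx.
have : v \in [set x; y] by rewrite eq !inE eqxx orbT.
rewrite !inE => /orP[]/eqP vx /orP[]/eqP ux; subst => //; rewrite ?eqxx // in nuv *.
by rewrite e_sym.
Qed.

Lemma edge_ex f : f \in edge_set e -> exists x y, [/\ e x y, x != y & f = [set x; y]].
Proof. by case/edgeP=> x [y [xy ->]]; exists x, y; rewrite edge_neq. Qed.

Lemma edge_eq2 f x y : f \in edge_set e -> x \in f -> y \in f -> x != y -> f = [set x; y].
Proof.
case/edge_ex=> u [v [uv nuv ->]]; rewrite !inE.
move=> /orP[]/eqP-> /orP[]/eqP->; rewrite ?eqxx // => _.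
by rewrite setUC.
Qed.

Lemma starP x f : reflect (exists2 y, e x y & f = [set x; y]) (f \in star x).
Proof.
rewrite inE; apply: (iffP andP) => [[/edge_ex[u [v [uv _ ->]]]]|[y xy ->]].
  rewrite !inE => /orP[]/eqP ->; first by exists v.
  by exists u; [rewrite e_sym | rewrite setUC].
by rewrite set2_edge xy !inE eqxx.
Qed.

Lemma set2_cut x y S : ([set x; y] \in cut S) = e x y && ((x \in S) (+) (y \in S)).
Proof.
rewrite inE set2_edge; case: (e x y) => //=.
rewrite subUset !sub1set.
have -> : ([set x; y] :&: S != set0) = (x \in S) || (y \in S).
  apply/set0Pn/orP => [[z]|].
    by rewrite !inE => /andP[/orP[]/eqP-> ->]; [left|right].
  by case=> h; [exists x|exists y]; rewrite !inE h eqxx ?orbT.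
by case: (x \in S); case: (y \in S).
Qed.

Lemma set2_inner x y S : ([set x; y] \in inner S) = [&& e x y, x \in S & y \in S].
Proof. by rewrite inE set2_edge subUset !sub1set. Qed.

Lemma set2_star x y z : ([set x; y] \in star z) = e x y && ((z == x) || (z == y)).
Proof. by rewrite inE set2_edge !inE. Qed.

Lemma cut_edge S f : f \in cut S -> f \in edge_set e.
Proof. by rewrite inE => /andP[]. Qed.

Lemma inner_edge S f : f \in inner S -> f \in edge_set e.
Proof. by rewrite inE => /andP[]. Qed.

Lemma star_edge x f : f \in star x -> f \in edge_set e.
Proof. by rewrite inE => /andP[]. Qed.

Lemma in_cutC S f : (f \in cut (~: S)) = (f \in cut S).
Proof.
apply/idP/idP => h; case/edge_ex: (cut_edge h) => x [y [_ _ eq]]; move: h;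
  by rewrite eq !set2_cut !inE; case: (x \in S); case: (y \in S).
Qed.

Lemma cutC S : cut (~: S) = cut S.
Proof. apply/setP=> f; exact: in_cutC. Qed.

Lemma cut1 x : cut [set x] = star x.
Proof.
apply/setP=> f; case: (boolP (f \in edge_set e)) => [/edge_ex[y [z [yz nyz ->]]]|nf]; last first.
  by rewrite !inE (negPf nf).
rewrite set2_cut set2_star yz !inE /= !(eq_sym x).
case: eqP => [yx|]; case: eqP => [zx|] //.
by rewrite yx zx eqxx in nyz.
Qed.

Lemma disjoint_and A B x : [disjoint A & B] -> (x \in A) && (x \in B) = false.
Proof. by move=> dAB; apply/andP => -[xA]; rewrite (disjointFr dAB xA). Qed.

(** An edge between [A] and [B] lies in both cuts and cancels, so cuts add modulo 2. *)
Lemma in_cutU A B f : [disjoint A & B] ->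
  (f \in cut (A :|: B)) = (f \in cut A) (+) (f \in cut B).
Proof.
move=> dAB; case: (boolP (f \in edge_set e)) => [/edge_ex[x [y [xy _ ->]]]|nf]; last first.
  by rewrite !inE (negPf nf).
rewrite !set2_cut xy !inE.
have := disjoint_and x dAB; have := disjoint_and y dAB.
by case: (x \in A); case: (y \in A); case: (x \in B); case: (y \in B).
Qed.

Lemma in_innerU A B f : [disjoint A & B] ->
  (f \in inner (A :|: B)) = [|| f \in inner A, f \in inner B | f \in cut A :&: cut B].
Proof.
move=> dAB; case: (boolP (f \in edge_set e)) => [/edge_ex[x [y [xy _ ->]]]|nf]; last first.
  by rewrite !inE (negPf nf).
rewrite in_setI !set2_cut !set2_inner xy !inE.
have := disjoint_and x dAB; have := disjoint_and y dAB.
by case: (x \in A); case: (y \in A); case: (x \in B); case: (y \in B).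
Qed.

Lemma inner_cut A f : f \in inner A -> f \in cut A = false.
Proof. by rewrite !inE => /andP[_ ->]; rewrite !andbF. Qed.

Lemma inner_disj A B f : [disjoint A & B] -> f \in inner A ->
  (f \in inner B = false) * (f \in cut B = false).
Proof.
move=> dAB h; case/edge_ex: (inner_edge h) => x [y [xy _ eq]]; move: h.
rewrite eq set2_cut !set2_inner => /and3P[_ xA yA].
by rewrite !(disjointFr dAB) // !andbF.
Qed.

Lemma inner1 x : inner [set x] = set0.
Proof.
apply/setP=> f; rewrite in_set0; case: (boolP (f \in edge_set e)) => [|nf]; last first.
  by rewrite !inE (negPf nf).
case/edge_ex=> y [z [yz nyz ->]]; apply/negP.
rewrite set2_inner !inE => /and3P[_ /eqP yx /eqP zx].
by rewrite yx zx eqxx in nyz.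
Qed.

Lemma sum_setU (I : finType) (P Q : {set I}) (F : I -> nat) : [disjoint P & Q] ->
  \sum_(i in P :|: Q) F i = \sum_(i in P) F i + \sum_(i in Q) F i.
Proof.
move=> dPQ; rewrite -bigU //=; apply: eq_bigl => i.
by rewrite in_setU.
Qed.

Lemma sum_innerU A B (F : {set T} -> nat) : [disjoint A & B] ->
  \sum_(f in inner (A :|: B)) F f =
  \sum_(f in inner A) F f + \sum_(f in inner B) F f + \sum_(f in cut A :&: cut B) F f.
Proof.
move=> dAB.
have -> : inner (A :|: B) = (inner A :|: inner B) :|: (cut A :&: cut B).
  by apply/setP=> f; rewrite in_innerU // in_setU in_setU orbA.
have d1 : [disjoint inner A & inner B].
  apply/pred0P => f; apply/negbTE/negP => /andP[h].
  by rewrite /= (inner_disj dAB h).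
have d2 : [disjoint inner A :|: inner B & cut A :&: cut B].
  apply/pred0P => f; apply/negbTE/negP => /andP[] /=; rewrite in_setU in_setI.
  by case/orP => /inner_cut ->; rewrite ?andbF.
by rewrite (sum_setU _ d2) (sum_setU _ d1).
Qed.

(** An edge outside [cut X] with an end in [X] lies inside [X], and then it cannot reach [Y]. *)
Lemma mem_cut_out x X Y f : f \in cut Y -> f \notin cut X -> [disjoint X & Y] ->
  x \in X -> x \notin f.
Proof.
move=> fY fX dXY xX; apply/negP => xf.
have fs : f \in star x by rewrite inE xf (cut_edge fY).
case/starP: fs => y xy eqf; move: fY fX; rewrite eqf !set2_cut xy xX.
rewrite (disjointFr dXY xX) /=; case: (boolP (y \in X)) => //= yX.
by rewrite (disjointFr dXY yX).
Qed.

End Cuts.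

(** * Trees and the vertex sets they describe *)

Inductive tree := Leaf | Node of tree & tree.

Section Blobs.
Variables (T : finType) (e : rel T).

(* A blob is a vertex set X whose cut consists of f, l and r and such that, once f is
   chosen, the perfect matching of the rest of X is forced.  In a node, [a] is the end of f
   in X, and the bridge [g] of X - a joins the two smaller blobs. *)
Fixpoint blob (t : tree) (X : {set T}) (f l r : {set T}) : Prop :=
  match t with
  | Leaf => exists x, [/\ X = [set x], star e x = [set f; l; r] & uniq [:: f; l; r]]
  | Node tl tr => exists a XL XR g p q,
      [/\ X = a |: (XL :|: XR), a \notin XL :|: XR & [disjoint XL & XR]] /\
      [/\ star e a = [set f; p; q], uniq [:: f; l; r; g; p; q],
          blob tl XL g l p & blob tr XR g q r]
  end.

(** The whole graph as a blob and one more vertex. The cut of the complement of [v] is the star of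
    [v], so [f], [l], [r] are the three edges at [v]. *)
Definition closed_blob t := exists v f l r, blob t (~: [set v]) f l r.

End Blobs.

(** * Counting perfect matchings *)

Section Matchings.
Variables (T : finType) (e : rel T).
Hypothesis e_sym : symmetric e.
Hypothesis e_irr : irreflexive e.
Implicit Types (x y z : T) (E f : {set T}) (X Y S : {set T}) (A B C N : {set {set T}}).

Notation star := (star e).
Notation cut := (cut e).
Notation inner := (inner e).

Definition covers Y N := [forall y in Y, #|star y :&: N| == 1].

(* [A] records the edges forced into the matching, [B] the edges chosen across the boundary
   of [Y]. *)
Definition locs Y A B :=
  [set N : {set {set T}} | [&& N \subset inner Y, A :&: inner Y \subset N & covers Y (N :|: B)]].

Lemma star_inner y Y f : f \in star y -> f \in inner Y -> y \in Y.
Proof. by rewrite !inE => /andP[_ yf] /andP[_ /subsetP]; apply. Qed.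

Lemma covers_eq Y N N' : (forall y f, y \in Y -> f \in star y -> (f \in N) = (f \in N')) ->
  covers Y N = covers Y N'.
Proof.
move=> h; apply: eq_forallb => y; case: (boolP (y \in Y)) => //= yY.
congr (#|pred_of_set _| == 1); apply/setP=> f; rewrite !in_setI.
by case: (boolP (f \in star y)) => //= fy; exact: h yY fy.
Qed.

Lemma coversU Y Y' N : covers (Y :|: Y') N = covers Y N && covers Y' N.
Proof.
apply/forall_inP/andP => [h|[/forall_inP h /forall_inP h'] y].
  by split; apply/forall_inP => y yY; apply: h; rewrite in_setU yY ?orbT.
by rewrite in_setU => /orP[/h|/h'].
Qed.

Lemma locs_eqA Y A A' B : (forall f, f \in inner Y -> (f \in A) = (f \in A')) ->
  locs Y A B = locs Y A' B.
Proof.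
move=> h; have eqA : A :&: inner Y = A' :&: inner Y.
  apply/setP => f; rewrite !in_setI; case: (boolP (f \in inner Y)) => [/h->|_] //.
  by rewrite !andbF.
by apply/setP=> N; rewrite !in_set eqA.
Qed.

(** Sort the edge sets by their trace [C] on the edges between the two parts. For a fixed [C] each
    part sees it as a choice on its boundary and the parts become independent, hence the product. *)
Lemma card_locsU Y1 Y2 A B : [disjoint Y1 & Y2] ->
  let D := cut Y1 :&: cut Y2 in
  #|locs (Y1 :|: Y2) A B| =
  \sum_(C : {set {set T}} | (C \subset D) && (A :&: D \subset C))
     #|locs Y1 A (B :|: C)| * #|locs Y2 A (B :|: C)|.
Proof.
move=> dY D.
have inD f : (f \in D) = (f \in cut Y1) && (f \in cut Y2) by rewrite in_setI.
clearbody D.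
have D_in f : f \in D -> f \in inner (Y1 :|: Y2).
  by move=> fD; rewrite in_innerU // in_setI -inD fD !orbT.
rewrite -sum1_card (partition_big (fun N => N :&: D)
  (fun C => (C \subset D) && (A :&: D \subset C))); last first.
  move=> N; rewrite in_set => /and3P[_ /subsetP h _]; rewrite subsetIr /=.
  apply/subsetP => f; rewrite !in_setI => /andP[fA fD]; rewrite fD andbT.
  by apply: h; rewrite in_setI fA D_in.
apply: eq_bigr => C /andP[/subsetP CD /subsetP AC].
have d12 f : f \in inner Y1 -> (f \in inner Y2 = false) * (f \in D = false).
  by move=> h; split; rewrite ?inD ?(inner_disj e_sym e_irr dY h) ?andbF.
have d2 f : f \in inner Y2 -> f \in D = false.
  by move=> h; rewrite inD (inner_cut h) andbF.
(* An inner edge of one part meets no vertex of the other, so the covering condition splits. *)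
have cov N1 N2 : N1 \subset inner Y1 -> N2 \subset inner Y2 ->
   covers (Y1 :|: Y2) (N1 :|: N2 :|: C :|: B) =
   covers Y1 (N1 :|: (B :|: C)) && covers Y2 (N2 :|: (B :|: C)).
  move=> /subsetP s1 /subsetP s2; rewrite coversU; congr (_ && _);
    apply: covers_eq => y f yY fy; rewrite !in_setU.
    have -> : f \in N2 = false.
      apply/negP => /s2 /(star_inner fy) yY2.
      by have := disjoint_and y dY; rewrite yY yY2.
    by rewrite orbF -orbA (orbC (f \in C)).
  have -> : f \in N1 = false.
    apply/negP => /s1 /(star_inner fy) yY1.
    by have := disjoint_and y dY; rewrite yY yY1.
  by rewrite /= -orbA (orbC (f \in C)).
rewrite -cardsX sum1dep_card.
(* Gluing is undone by intersecting with [inner Y1], [inner Y2] and [D]; this gives both injectivity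
   and the trace. *)
pose g (p : {set {set T}} * {set {set T}}) := p.1 :|: p.2 :|: C.
have gI N1 N2 : N1 \subset inner Y1 -> N2 \subset inner Y2 ->
   (g (N1, N2) :&: inner Y1 = N1) * (g (N1, N2) :&: inner Y2 = N2) * (g (N1, N2) :&: D = C).
  move=> /subsetP s1 /subsetP s2; rewrite /g /=; split; first split; apply/setP=> f;
    rewrite in_setI !in_setU.
  - apply/andP/idP => [[/orP[/orP[]|] // h f1]|h]; last by rewrite h s1.
      by have := s2 _ h; rewrite d12.
    by have := CD _ h; rewrite d12.
  - apply/andP/idP => [[/orP[/orP[]|] // h f1]|h]; last by rewrite h s2 ?orbT.
      by move: f1; rewrite d12 // s1.
    by have := CD _ h; rewrite d2.
  apply/andP/idP => [[/orP[/orP[]|] // h f1]|h]; last by rewrite h CD ?orbT.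
    by move: f1; rewrite d12 // s1.
  by move: f1; rewrite d2 // s2.
have g_inj : {in setX (locs Y1 A (B :|: C)) (locs Y2 A (B :|: C)) &, injective g}.
  move=> [N1 N2] [N1' N2']; rewrite !in_setX !in_set /=.
  move=> /andP[/andP[s1 _] /andP[s2 _]] /andP[/andP[s1' _] /andP[s2' _]] eq.
  have := gI _ _ s1 s2; rewrite eq; have := gI _ _ s1' s2'.
  by move=> [[-> ->] _] [[-> ->] _].
rewrite -(card_in_imset g_inj); congr #|pred_of_set _|; apply/setP=> N.
rewrite in_set; apply/andP/imsetP => [[]|[[N1 N2]]].
  rewrite in_set => /and3P[/subsetP sN /subsetP AN covN] /eqP NC.
  have eqN : N = N :&: inner Y1 :|: N :&: inner Y2 :|: C.
    apply/setP=> f; rewrite -NC !in_setU !in_setI -!andb_orr.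
    case: (boolP (f \in N)) => //= /sN; rewrite in_innerU // in_setI => h.
    by rewrite inD -orbA h.
  exists (N :&: inner Y1, N :&: inner Y2); last by rewrite /g.
  move: covN; rewrite {1}eqN cov ?subsetIr // => /andP[c1 c2].
  rewrite in_setX !in_set !subsetIr c1 c2 /= !andbT.
  apply/andP; split; apply/subsetP => f; rewrite !in_setI => /andP[fA fY];
    by rewrite fY andbT; apply: AN; rewrite in_setI fA in_innerU // fY ?orbT.
rewrite in_setX !in_set /= => /andP[/and3P[s1 a1 c1] /and3P[s2 a2 c2]] ->.
split; last by rewrite (gI _ _ s1 s2).
rewrite cov // c1 c2 !andbT; apply/andP; split.
  apply/subsetP => f; rewrite !in_setU => /orP[/orP[/(subsetP s1) h|/(subsetP s2) h]|/CD/D_in //];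
  by rewrite in_innerU // h ?orbT.
apply/subsetP => f; rewrite in_setI in_innerU // => /andP[fA /or3P[] h].
- by rewrite !in_setU (subsetP a1) // in_setI fA h.
- by rewrite !in_setU (subsetP a2) ?orbT // in_setI fA h.
by rewrite !in_setU AC ?orbT // in_setI fA inD -in_setI.
Qed.

End Matchings.

(** * Sums over subsets as sums over Booleans *)

Section Subsets.
Variable U : finType.
Implicit Types (p q r x : U) (C D : {set U}) (G : {set U} -> nat).

Definition oset (b : bool) p : {set U} := if b then [set p] else set0.

Lemma in_oset b p x : (x \in oset b p) = b && (x == p).
Proof. by case: b; rewrite !inE. Qed.

Lemma sum_subsetU1 p D G : p \notin D ->
  \sum_(C : {set U} | C \subset p |: D) G C =
  \sum_(b : bool) \sum_(C : {set U} | C \subset D) G (oset b p :|: C).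
Proof.
move=> pD; rewrite big_bool /= (bigID (fun C : {set U} => p \in C)) /=; congr (_ + _).
  rewrite (reindex_onto (fun C => p |: C) (fun C => C :\ p)) /=; last first.
    by move=> C /andP[_ pC]; rewrite setD1K.
  apply: eq_bigl => C; rewrite setU11 andbT; apply/andP/idP => [[CD /eqP eq]|CD].
    apply/subsetP => x xC; have := subsetP CD x; rewrite !inE xC orbT => /(_ isT).
    case/orP => // /eqP xp; move: xC; rewrite -eq xp !inE eqxx; by [].
  split; first by rewrite setUS.
  by rewrite setU1K //; apply: contra pD => /(subsetP CD).
apply: congr_big => // C; last by rewrite set0U.
apply/andP/idP => [[CD pC]|CD].
  apply/subsetP => x xC; have := subsetP CD x xC; rewrite !inE.
  by case/orP => // /eqP xp; rewrite -xp xC in pC.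
split; first by rewrite (subset_trans CD) ?subsetUr.
by apply: contra pD => /(subsetP CD).
Qed.

Lemma sum_subset0 G : \sum_(C : {set U} | C \subset set0) G C = G set0.
Proof. by rewrite (big_pred1 set0) // => C; rewrite subset0. Qed.

Lemma sum_subset1 p G :
  \sum_(C : {set U} | C \subset [set p]) G C = \sum_(b : bool) G (oset b p).
Proof.
rewrite -[[set p]]setU0 sum_subsetU1 ?inE //.
by apply: eq_bigr => b _; rewrite sum_subset0 setU0.
Qed.

Lemma sum_subset2 p q G : p != q ->
  \sum_(C : {set U} | C \subset [set p; q]) G C =
  \sum_(b : bool) \sum_(b' : bool) G (oset b p :|: oset b' q).
Proof.
move=> pq; rewrite sum_subsetU1 ?inE //.
by apply: eq_bigr => b _; rewrite sum_subset1.
Qed.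

Lemma sum_subset3 p q r G : uniq [:: p; q; r] ->
  \sum_(C : {set U} | C \subset [set p; q; r]) G C =
  \sum_(b : bool) \sum_(b' : bool) \sum_(b'' : bool)
    G (oset b p :|: (oset b' q :|: oset b'' r)).
Proof.
rewrite /= !inE negb_or => /andP[/andP[pq pr] /andP[qr _]].
rewrite -setUA sum_subsetU1 ?inE ?negb_or ?pq //.
by apply: eq_bigr => b _; rewrite sum_subset2.
Qed.

Lemma uniq_count_le1 (s : seq U) x : uniq s -> count_mem x s <= 1.
Proof. by move/count_uniq_mem->; case: (x \in s). Qed.

End Subsets.

(* The number of matchings of a blob using exactly the prescribed edges of its cut. *)
Fixpoint traces (t : tree) (bf bl br : bool) : nat :=
  match t with
  | Leaf => bf + bl + br == 1
  | Node tl tr =>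
      \sum_(bp : bool) \sum_(bq : bool) (bf + bp + bq == 1) *
        \sum_(bg : bool) traces tl bg bl bp * traces tr bg bq br
  end.

(** Outside the left child lie the outside of the node, weighted by [w], the vertex [a], which must
    use exactly one of [f], [p], [q], and the right sibling, counted by its traces. *)
Definition lweight tr (w : bool -> bool -> bool -> nat) (bg bl bp : bool) : nat :=
  \sum_(bf : bool) \sum_(br : bool) w bf bl br *
    \sum_(bq : bool) (bf + bp + bq == 1) * traces tr bg bq br.

Definition rweight tl (w : bool -> bool -> bool -> nat) (bg bq br : bool) : nat :=
  \sum_(bf : bool) \sum_(bl : bool) w bf bl br *
    \sum_(bp : bool) (bf + bp + bq == 1) * traces tl bg bl bp.

(** Traces inside times weights outside, with one cut edge forced: when [w] is the outside weight,
    this is the number of perfect matchings of the whole graph through that edge. *)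
Definition fcount t (w : bool -> bool -> bool -> nat) : nat :=
  \sum_(bl : bool) \sum_(br : bool) traces t true bl br * w true bl br.
Definition lcount t (w : bool -> bool -> bool -> nat) : nat :=
  \sum_(bf : bool) \sum_(br : bool) traces t bf true br * w bf true br.
Definition rcount t (w : bool -> bool -> bool -> nat) : nat :=
  \sum_(bf : bool) \sum_(bl : bool) traces t bf bl true * w bf bl true.

(* [w] gives the number of matchings outside the blob for each trace on its cut. *)
Fixpoint lonelies (t : tree) (w : bool -> bool -> bool -> nat) : nat :=
  match t with
  | Leaf => 0
  | Node tl tr =>
      let wl := lweight tr w in
      let wr := rweight tl w in
      (fcount tl wl == 1) + (rcount tl wl == 1) + (lcount tr wr == 1)
      + lonelies tl wl + lonelies tr wr
  end.

(** Outside a closed blob there is only the vertex [v], which must use exactly one of its three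
    edges. *)
Definition top_weight (bf bl br : bool) : nat := (bf + bl + br == 1).

Definition lonely_total t :=
  (fcount t top_weight == 1) + (lcount t top_weight == 1) + (rcount t top_weight == 1)
  + lonelies t top_weight.

(** * Matchings inside a blob *)

Section BlobCounts.
Variables (T : finType) (e : rel T).
Hypothesis e_sym : symmetric e.
Hypothesis e_irr : irreflexive e.
Implicit Types (x y z : T) (f : {set T}) (X Y S : {set T}) (A B C N : {set {set T}}).

Notation star := (star e).
Notation cut := (cut e).
Notation inner := (inner e).
Notation locs := (locs e).

(** Since the six edges are distinct, at most one of the equations [E == f], ..., [E == q] holds. As
    cuts add modulo 2, each identity is a check of 64 Boolean cases. *)
Lemma node_cut a XL XR f l r g p q :
  a \notin XL :|: XR -> [disjoint XL & XR] ->
  star a = [set f; p; q] -> uniq [:: f; l; r; g; p; q] ->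
  cut XL = [set g; l; p] -> cut XR = [set g; q; r] ->
  [/\ cut (a |: (XL :|: XR)) = [set f; l; r], cut (XL :|: XR) = [set l; r; p; q],
      cut (a |: XR) = [set f; p; r; g] & cut (a |: XL) = [set f; q; l; g]].
Proof.
move=> aX dLR sa u cL cR.
have da : [disjoint [set a] & XL :|: XR] by rewrite disjoints1.
have daR : [disjoint [set a] & XR] by rewrite disjoints1; apply: contra aX => h; rewrite inE h orbT.
have daL : [disjoint [set a] & XL] by rewrite disjoints1; apply: contra aX => h; rewrite inE h.
split; apply/setP => E; have := uniq_count_le1 E u.
- rewrite (in_cutU e_sym e_irr _ da) (in_cutU e_sym e_irr _ dLR) cut1 // sa cL cR.
  rewrite !in_setU !in_set1 /= !(eq_sym _ E).
  move: (E == f) (E == l) (E == r) (E == g) (E == p) (E == q); do 6!case; by [].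
- rewrite (in_cutU e_sym e_irr _ dLR) cL cR.
  rewrite !in_setU !in_set1 /= !(eq_sym _ E).
  move: (E == f) (E == l) (E == r) (E == g) (E == p) (E == q); do 6!case; by [].
- rewrite (in_cutU e_sym e_irr _ daR) cut1 // sa cR.
  rewrite !in_setU !in_set1 /= !(eq_sym _ E).
  move: (E == f) (E == l) (E == r) (E == g) (E == p) (E == q); do 6!case; by [].
rewrite (in_cutU e_sym e_irr _ daL) cut1 // sa cL.
rewrite !in_setU !in_set1 /= !(eq_sym _ E).
move: (E == f) (E == l) (E == r) (E == g) (E == p) (E == q); do 6!case; by [].
Qed.

Lemma blob_cut t X f l r : blob e t X f l r ->
  [/\ cut X = [set f; l; r], uniq [:: f; l; r] & X != set0].
Proof.
elim: t X f l r => [|tl IHl tr IHr] X f l r /=.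
  case=> x [-> sx u]; rewrite cut1 //; split=> //.
  by apply/set0Pn; exists x; rewrite !inE.
case=> a [XL [XR [g [p [q [[eX aX dLR] [sa u bL bR]]]]]]].
have [cL _ _] := IHl _ _ _ _ bL; have [cR _ _] := IHr _ _ _ _ bR.
have [c _ _ _] := node_cut aX dLR sa u cL cR; rewrite eX c.
split=> //; last by apply/set0Pn; exists a; rewrite !inE eqxx.
exact: subseq_uniq (prefix_subseq [:: f; l; r] [:: g; p; q]) u.
Qed.

Lemma card_locs1 a B : #|locs [set a] set0 B| = (#|star a :&: B| == 1).
Proof.
have -> : locs [set a] set0 B = if #|star a :&: B| == 1 then [set set0] else set0.
  apply/setP=> N; rewrite in_set inner1 // set0I sub0set subset0 /=.
  have -> : covers e [set a] (N :|: B) = (#|star a :&: (N :|: B)| == 1).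
    apply/forall_inP/idP => [h|h y]; first by apply: h; rewrite inE.
    by rewrite inE => /eqP ->.
  case: eqP => [->|ne]; first by rewrite set0U; case: ifP; rewrite !inE ?eqxx.
  by case: ifP; rewrite !inE //; move/eqP: ne => /negPf ->.
by case: ifP => _; rewrite ?cards1 ?cards0.
Qed.

Lemma card_star_trace a f p q B : star a = [set f; p; q] -> uniq [:: f; p; q] ->
  #|star a :&: B| = (f \in B) + (p \in B) + (q \in B).
Proof.
move=> ->; rewrite /= !inE negb_or => /andP[/andP[fp fq] /andP[pq _]].
rewrite setIUl cardsU setIUl cardsU.
have I1 E : #|[set E] :&: B| = (E \in B).
  case: (boolP (E \in B)) => h; first by rewrite (setIidPl _) ?cards1 ?sub1set.
  by apply/eqP; rewrite cards_eq0 setI_eq0 disjoints1.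
have d E E' (nE : E != E') : ([set E] :&: B) :&: ([set E'] :&: B) = set0.
  apply/setP=> x; rewrite !inE; case: eqP => [->|] //=.
  by rewrite (negPf nE) !andbF.
rewrite !I1 (d _ _ fp) setIUl (d _ _ fq) (d _ _ pq) setU0 cards0 !subn0.
by [].
Qed.

Lemma card_locsU0 Y1 Y2 B : [disjoint Y1 & Y2] ->
  #|locs (Y1 :|: Y2) set0 B| =
  \sum_(C : {set {set T}} | C \subset cut Y1 :&: cut Y2)
     #|locs Y1 set0 (B :|: C)| * #|locs Y2 set0 (B :|: C)|.
Proof.
move=> dY; rewrite (card_locsU e_sym e_irr _ _ dY) /=.
by apply: eq_bigl => C; rewrite set0I sub0set andbT.
Qed.

Lemma node_meet a XL XR f l r g p q :
  a \notin XL :|: XR -> [disjoint XL & XR] ->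
  star a = [set f; p; q] -> uniq [:: f; l; r; g; p; q] ->
  cut XL = [set g; l; p] -> cut XR = [set g; q; r] ->
  [/\ cut [set a] :&: cut (XL :|: XR) = [set p; q], cut XL :&: cut XR = [set g],
      cut [set a] :&: cut XR = [set q] & cut [set a] :&: cut XL = [set p]] /\
  [/\ [set f; l; r] :&: cut (a |: XR) = [set f; r] &
      [set f; l; r] :&: cut (a |: XL) = [set f; l]].
Proof.
move=> aX dLR sa u cL cR.
have [c1 c2 c3 c4] := node_cut aX dLR sa u cL cR.
rewrite c2 c3 c4 cut1 // sa cL cR.
split; split; apply/setP => E; have := uniq_count_le1 E u;
  rewrite !in_setI !in_setU !in_set1 /= !(eq_sym _ E);
  move: (E == f) (E == l) (E == r) (E == g) (E == p) (E == q); do 6!case; by [].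
Qed.

(** The recursion of [traces] is the product formula used twice: the vertex [a] is split off along
    [p] and [q], then the two pieces are separated along [g]. *)
Lemma card_locs_blob t X f l r B : blob e t X f l r ->
  (forall E, E \in inner X -> E \notin B) ->
  #|locs X set0 B| = traces t (f \in B) (l \in B) (r \in B).
Proof.
elim: t X f l r B => [|tl IHl tr IHr] X f l r B /=.
  by case=> x [-> sx u] _; rewrite card_locs1 (card_star_trace _ sx u).
case=> a [XL [XR [g [p [q [[-> aX dLR] [sa u bL bR]]]]]]] hB.
have [cL uL _] := blob_cut bL; have [cR uR _] := blob_cut bR.
have [[m1 m2 m3 m4] _] := node_meet aX dLR sa u cL cR.
have da : [disjoint [set a] & XL :|: XR] by rewrite disjoints1.
have inL E : E \in inner XL -> [/\ E \notin B, E == p = false, E == q = false & E == g = false].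
  move=> h; split.
  - by apply: hB; rewrite (in_innerU e_sym e_irr _ da) (in_innerU e_sym e_irr _ dLR) h !orbT.
  - apply/eqP => eq; have := inner_cut h; by rewrite cL eq !inE eqxx !orbT.
  - apply/eqP => eq; have := (inner_disj e_sym e_irr dLR h).2; by rewrite cR eq !inE eqxx !orbT.
  apply/eqP => eq; have := inner_cut h; by rewrite cL eq !inE eqxx.
have dRL : [disjoint XR & XL] by rewrite disjoint_sym.
have inR E : E \in inner XR -> [/\ E \notin B, E == p = false, E == q = false & E == g = false].
  move=> h; split.
  - by apply: hB; rewrite (in_innerU e_sym e_irr _ da) (in_innerU e_sym e_irr _ dLR) h !orbT.
  - apply/eqP => eq; have := (inner_disj e_sym e_irr dRL h).2; by rewrite cL eq !inE eqxx !orbT.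
  - apply/eqP => eq; have := inner_cut h; by rewrite cR eq !inE eqxx !orbT.
  apply/eqP => eq; have := inner_cut h; by rewrite cR eq !inE eqxx.
have nB E : E \in [set p; q; g] -> E \notin B.
  move=> h; apply: hB; rewrite (in_innerU e_sym e_irr _ da) m1 (in_innerU e_sym e_irr _ dLR) m2.
  move: h; rewrite !in_setU !in_set1 => /orP[/orP[]|] ->; by rewrite ?orbT.
have [nBp nBq nBg] : [/\ p \notin B, q \notin B & g \notin B].
  by split; apply: nB; rewrite !inE eqxx ?orbT.
have upq : p != q by case/and5P: u => _ _ _ _; rewrite !inE andbT.
rewrite card_locsU0 // m1 sum_subset2 //.
apply: eq_bigr => bp _; apply: eq_bigr => bq _.
have ua : uniq [:: f; p; q].
  by case/and5P: u => u1 _ _ _ u2; move: u1 u2; rewrite /= !inE !negb_or => /and5P[_ _ _ -> ->].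
rewrite card_locs1 (card_star_trace _ sa ua) card_locsU0 // m2 sum_subset1.
move: u; rewrite /= !inE !negb_or => /and5P[/and5P[fl fr fg fp fq] /and4P[lr lg lp lq]
  /and3P[rg rp rq] /andP[gp gq] _].
congr (nat_of_bool (_ == 1) * _).
  rewrite !in_oset (negPf nBp) (negPf nBq) !eqxx !andbT /=.
  by rewrite (negPf fp) (negPf fq) (eq_sym q) (negPf upq) !andbF !orbF.
apply: eq_bigr => bg _; congr (_ * _).
  rewrite (IHl _ _ _ _ _ bL); last first.
    by move=> E /inL[hE h1 h2 h3]; rewrite !in_setU !in_oset (negPf hE) h1 h2 h3 !andbF.
  congr traces; rewrite !in_setU !in_oset ?(negPf nBp) ?(negPf nBq) ?(negPf nBg) ?eqxx ?andbT.
  - by rewrite (negPf gp) (negPf gq) !andbF.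
  - by rewrite (negPf lp) (negPf lq) (negPf lg) !andbF !orbF.
  by rewrite (negPf upq) (eq_sym p) (negPf gp) !andbF !orbF.
rewrite (IHr _ _ _ _ _ bR); last first.
  by move=> E /inR[hE h1 h2 h3]; rewrite !in_setU !in_oset (negPf hE) h1 h2 h3 !andbF.
congr traces; rewrite !in_setU !in_oset ?(negPf nBp) ?(negPf nBq) ?(negPf nBg) ?eqxx ?andbT.
- by rewrite (negPf gp) (negPf gq) !andbF.
- by rewrite (eq_sym q) (negPf upq) (eq_sym q g) (negPf gq) !andbF !orbF.
by rewrite (negPf rp) (negPf rq) (negPf rg) !andbF !orbF.
Qed.

End BlobCounts.

Lemma uniq6_neq (U : eqType) (f l r g p q : U) : uniq [:: f; l; r; g; p; q] ->
  ((f == l = false) * (f == r = false) * (f == g = false) * (f == p = false) * (f == q = false)) *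
   ((l == f = false) * (l == r = false) * (l == g = false) * (l == p = false) * (l == q = false)) *
   ((r == f = false) * (r == l = false) * (r == g = false) * (r == p = false) * (r == q = false)) *
   ((g == f = false) * (g == l = false) * (g == r = false) * (g == p = false) * (g == q = false)) *
   ((p == f = false) * (p == l = false) * (p == r = false) * (p == g = false) * (p == q = false)) *
   ((q == f = false) * (q == l = false) * (q == r = false) * (q == g = false) * (q == p = false)).
Proof.
rewrite /= !inE !negb_or => /and5P[/and5P[fl fr fg fp fq] /and4P[lr lg lp lq]
  /and3P[rg rp rq] /andP[gp gq] /andP[pq _]].
by do ?split; apply/negbTE; rewrite // eq_sym.
Qed.

(** * Matchings outside a blob and the number of lonely edges *)

Section LonelyCounts.
Variables (T : finType) (e : rel T).
Hypothesis e_sym : symmetric e.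
Hypothesis e_irr : irreflexive e.
Implicit Types (x y z : T) (f : {set T}) (X Y S : {set T}) (A B C N : {set {set T}}).

Notation star := (star e).
Notation cut := (cut e).
Notation inner := (inner e).
Notation locs := (locs e).

Definition out_weight X f l r (w : bool -> bool -> bool -> nat) :=
  forall B, (forall E, E \in inner (~: X) -> E \notin B) ->
    #|locs (~: X) set0 B| = w (f \in B) (l \in B) (r \in B).

(** The complement of [XL] is the complement of the node together with [a] and [XR]. The first meets
    the rest along [f] and [r], and [a] meets [XR] along [q]; these are the edges summed over in
    [lweight]. *)
Lemma out_weight_left t a XL XR f l r g p q w :
  a \notin XL :|: XR -> [disjoint XL & XR] ->
  star a = [set f; p; q] -> uniq [:: f; l; r; g; p; q] ->
  cut XL = [set g; l; p] -> blob e t XR g q r ->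
  out_weight (a |: (XL :|: XR)) f l r w -> out_weight XL g l p (lweight t w).
Proof.
move=> aX dLR sa u cL bR hw B hB.
have [cR _ _] := blob_cut e_sym e_irr bR.
have [cX cLR caR _] := node_cut e_sym e_irr aX dLR sa u cL cR.
have [[_ _ maR _] [mX _]] := node_meet e_sym e_irr aX dLR sa u cL cR.
set X := a |: (XL :|: XR) in hw cX *.
have eU : ~: XL = ~: X :|: (a |: XR).
  have /norP[aL _] : ~~ ((a \in XL) || (a \in XR)) by rewrite -in_setU.
  apply/setP=> x; rewrite !inE; case: (eqVneq x a) => [->|_]; first by rewrite aL.
  case: (boolP (x \in XR)) => [xR|_]; last by rewrite !orbF.
  by rewrite (disjointFl dLR xR) orbT.
have dX : [disjoint ~: X & a |: XR].
  rewrite -setI_eq0; apply/eqP/setP => x; rewrite !inE.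
  by case: (x == a); case: (x \in XL); case: (x \in XR).
have daR : [disjoint [set a] & XR] by rewrite disjoints1; apply: contra aX => h; rewrite inE h orbT.
have meetX : cut (~: X) :&: cut (a |: XR) = [set f; r].
  by rewrite -mX; apply/setP=> E; rewrite !in_setI in_cutC // cX.
have hBX E : E \in inner (~: X) -> E \notin B.
  by move=> h; apply: hB; rewrite eU (in_innerU e_sym e_irr _ dX) h.
have hBm E : E \in [set f; r; q] -> E \notin B.
  move=> h; apply: hB; rewrite eU (in_innerU e_sym e_irr _ dX) meetX
    (in_innerU e_sym e_irr _ daR) maR.
  by move: h; rewrite !in_setU !in_set1 => /orP[/orP[]|] ->; rewrite ?orbT.
have hBR E : E \in inner XR -> E \notin B.
  move=> h; apply: hB.
  by rewrite eU (in_innerU e_sym e_irr _ dX) (in_innerU e_sym e_irr _ daR) h !orbT.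
have [nBf nBr nBq] : [/\ f \notin B, r \notin B & q \notin B].
  by split; apply: hBm; rewrite !inE eqxx ?orbT.
have [nXf nXr] : (f \notin inner (~: X)) /\ (r \notin inner (~: X)).
  by split; apply/negP => /inner_cut; rewrite in_cutC // cX !inE eqxx ?orbT.
have inR E : E \in inner XR -> [/\ E == f = false, E == r = false & E == q = false].
  move=> h; have dRa : [disjoint XR & [set a]] by rewrite disjoint_sym.
  split; apply/eqP => eq.
  - by have := (inner_disj e_sym e_irr dRa h).2; rewrite cut1 // sa eq !inE eqxx.
  - by have := inner_cut h; rewrite cR eq !inE eqxx ?orbT.
  by have := inner_cut h; rewrite cR eq !inE eqxx ?orbT.
have ua : uniq [:: f; p; q].
  by case/and5P: u => u1 _ _ _ u2; move: u1 u2; rewrite /= !inE !negb_or => /and5P[_ _ _ -> ->].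
have u6 := uniq6_neq u; have fr : f != r by rewrite u6.
rewrite eU card_locsU0 // meetX sum_subset2 // /lweight.
apply: eq_bigr => bf _; apply: eq_bigr => br _; congr (_ * _).
  rewrite hw; last first.
    move=> E h; rewrite !in_setU !in_oset (negPf (hBX _ h)) /=.
    case: (eqVneq E f) => [eq|_]; first by rewrite -eq h in nXf.
    case: (eqVneq E r) => [eq|_]; first by rewrite -eq h in nXr.
    by rewrite !andbF.
  by rewrite !in_setU !in_oset (negPf nBf) (negPf nBr) ?eqxx ?u6 ?andbT ?andbF ?orbF.
rewrite card_locsU0 // maR sum_subset1; apply: eq_bigr => bq _; congr (_ * _).
  rewrite card_locs1 // (card_star_trace _ sa ua); congr (nat_of_bool (_ == 1)).
  by rewrite !in_setU !in_oset (negPf nBf) (negPf nBq) ?eqxx ?u6 ?andbT ?andbF ?orbF.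
rewrite (card_locs_blob e_sym e_irr bR); last first.
  by move=> E h; case: (inR E h) => h1 h2 h3;
     rewrite !in_setU !in_oset (negPf (hBR _ h)) h1 h2 h3 !andbF.
by congr traces; rewrite !in_setU !in_oset ?(negPf nBr) ?(negPf nBq) ?eqxx ?u6 ?andbT ?andbF ?orbF.
Qed.

Fixpoint mirror t := match t with Leaf => Leaf | Node tl tr => Node (mirror tr) (mirror tl) end.

Lemma mirrorK : involutive mirror.
Proof. by elim=> //= tl -> tr ->. Qed.

Lemma set3_rot (U : finType) (x y z : U) : [set x; y; z] = [set x; z; y].
Proof. by rewrite -!setUA (setUC [set y]). Qed.

Lemma blob_mirror t X f l r : blob e t X f l r -> blob e (mirror t) X f r l.
Proof.
elim: t X f l r => [|tl IHl tr IHr] X f l r /=.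
  case=> x [eX sx u]; exists x; split=> //; first by rewrite sx set3_rot.
  by move: u; rewrite /= !inE !negb_or andbT (eq_sym l) => /andP[/andP[-> ->] ->].
case=> a [XL [XR [g [p [q [[-> aX dLR] [sa u bL bR]]]]]]].
exists a, XR, XL, g, q, p; rewrite setUC [XR :|: _]setUC disjoint_sym; split=> //.
  by rewrite setUC.
split; [by rewrite sa set3_rot | | exact: IHr | exact: IHl].
suff: uniq [:: f; r; l; g; q; p] by [].
rewrite -(@eq_uniq _ [:: f; l; r; g; p; q]) // => E; rewrite !inE.
by move: (E == f) (E == l) (E == r) (E == g) (E == p) (E == q); do 6!case.
Qed.

Lemma traces_mirror t bf bl br : traces (mirror t) bf br bl = traces t bf bl br.
Proof.
elim: t bf bl br => [|tl IHl tr IHr] bf bl br /=; first by rewrite addnAC.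
rewrite exchange_big; apply: eq_bigr => bp _; apply: eq_bigr => bq _.
rewrite addnAC; congr (_ * _); apply: eq_bigr => bg _.
by rewrite IHl IHr mulnC.
Qed.

(** The left version applied to the mirrored node. *)
Lemma out_weight_right t a XL XR f l r g p q w :
  a \notin XL :|: XR -> [disjoint XL & XR] ->
  star a = [set f; p; q] -> uniq [:: f; l; r; g; p; q] ->
  cut XR = [set g; q; r] -> blob e t XL g l p ->
  out_weight (a |: (XL :|: XR)) f l r w -> out_weight XR g q r (rweight t w).
Proof.
move=> aX dLR sa u cR bL hw.
have : out_weight XR g r q (lweight (mirror t) (fun bf br bl => w bf bl br)).
  apply: (@out_weight_left _ a XR XL f r l g q p).
  - by rewrite setUC.
  - by rewrite disjoint_sym.
  - by rewrite sa set3_rot.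
  - rewrite -(@eq_uniq _ [:: f; l; r; g; p; q]) // => E; rewrite !inE.
    by move: (E == f) (E == l) (E == r) (E == g) (E == p) (E == q); do 6!case.
  - by rewrite cR set3_rot.
  - exact: blob_mirror.
  by move=> B hB; rewrite setUC [XR :|: _]setUC -setUC in hB *; exact: hw.
move=> h B hB; rewrite h //; apply: eq_bigr => bf _; apply: eq_bigr => bl _.
congr (_ * _); apply: eq_bigr => bp _; rewrite traces_mirror addnAC.
by [].
Qed.

(** This puts loneliness into the form to which the product formula applies: [f] is forced and there
    is no boundary. *)
Lemma lonelyE f : f \in edge_set e -> lonely e f = (#|locs setT [set f] set0| == 1).
Proof.
move=> fE; rewrite /lonely fE /=; congr (#|pred_of_set _| == 1).
have innT : inner setT = edge_set e.
  by apply/setP=> E; rewrite inE subsetT andbT.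
apply/setP=> M; rewrite !in_set innT setU0 /perfect_matching.
have -> : ([set f] :&: edge_set e \subset M) = (f \in M).
  by rewrite (setIidPl _) sub1set.
rewrite -andbA; case: (boolP (M \subset _)) => //= sM.
rewrite andbC; congr (_ && _); apply/forallP/forall_inP => h x; last first.
  have /= := h x (in_setT x); congr (#|pred_of_set _| == 1); apply/setP=> E.
  rewrite in_setI !in_set andbC; case: (boolP (E \in M)) => //= /(subsetP sM) ->.
  by [].
move=> _; have /= := h x; congr (#|pred_of_set _| == 1); apply/setP=> E.
rewrite in_setI !in_set andbC; case: (boolP (E \in M)) => [/(subsetP sM) ->|]; by rewrite ?andbT ?andbF.
Qed.

(** Split along the cut of [X]. A cut edge is inner to neither side, so forcing [E] only restricts
    the traces. *)
Lemma card_locs_cut t X f l r w E : blob e t X f l r -> out_weight X f l r w ->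
  E \in cut X ->
  #|locs setT [set E] set0| =
  \sum_(bf : bool) \sum_(bl : bool) \sum_(br : bool)
    (E \in oset bf f :|: (oset bl l :|: oset br r)) * (traces t bf bl br * w bf bl br).
Proof.
move=> b hw EX; have [cX uX _] := blob_cut e_sym e_irr b.
have dX : [disjoint X & ~: X] by rewrite -setI_eq0 setICr.
have meet : cut X :&: cut (~: X) = [set f; l; r].
  by rewrite cutC // setIid cX.
rewrite -(setUCr X) card_locsU // meet big_mkcondr /= sum_subset3 //.
move: (uX); rewrite /= !inE negb_or => /andP[/andP[fl fr] /andP[lr _]].
apply: eq_bigr => bf _; apply: eq_bigr => bl _; apply: eq_bigr => br _.
set C := oset bf f :|: _; rewrite set0U.
have -> : ([set E] :&: [set f; l; r] \subset C) = (E \in C).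
  by rewrite -cX (setIidPl _) sub1set.
case: (boolP (E \in C)) => EC; rewrite ?mul0n // mul1n.
have CX F : F \in C -> F \in cut X.
  by rewrite cX !inE !in_oset => /or3P[] /andP[_ ->]; rewrite ?orbT.
have noX F (S : {set T}) : cut S = cut X -> F \in inner S -> F \notin C.
  by move=> eS FS; apply/negP => /CX; rewrite -eS inner_cut.
have cC : cut (~: X) = cut X by exact: cutC.
have A0 S : cut S = cut X -> locs S [set E] C = locs S set0 C.
  move=> eS; apply: locs_eqA => F FS; rewrite !inE; apply/eqP => eqF.
  by have := inner_cut FS; rewrite eS eqF EX.
rewrite !A0 // (card_locs_blob e_sym e_irr b); last by move=> F; apply: noX.
rewrite hw; last by move=> F; apply: noX.
rewrite !in_setU !in_oset !eqxx (negPf fl) (negPf fr) (negPf lr).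
by rewrite !(eq_sym l f) !(eq_sym r) (negPf fl) (negPf fr) (negPf lr) !andbT !andbF !orbF.
Qed.

Lemma card_locs_f t X f l r w : blob e t X f l r -> out_weight X f l r w ->
  #|locs setT [set f] set0| = fcount t w.
Proof.
move=> b hw; have [cX uX _] := blob_cut e_sym e_irr b.
rewrite (card_locs_cut b hw) ?cX ?inE ?eqxx // /fcount !big_bool /=.
move: uX; rewrite /= !inE negb_or => /andP[/andP[fl fr] /andP[lr _]].
by rewrite (negPf fl) (negPf fr) ?eqxx /= !mul1n !mul0n !addn0.
Qed.

Lemma card_locs_l t X f l r w : blob e t X f l r -> out_weight X f l r w ->
  #|locs setT [set l] set0| = lcount t w.
Proof.
move=> b hw; have [cX uX _] := blob_cut e_sym e_irr b.
rewrite (card_locs_cut b hw) ?cX ?inE ?eqxx ?orbT // /lcount !big_bool /=.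
move: uX; rewrite /= !inE negb_or => /andP[/andP[fl fr] /andP[lr _]].
by rewrite (eq_sym l f) (negPf fl) (negPf lr) ?eqxx /= ?orbT !mul1n !mul0n !addn0.
Qed.

Lemma card_locs_r t X f l r w : blob e t X f l r -> out_weight X f l r w ->
  #|locs setT [set r] set0| = rcount t w.
Proof.
move=> b hw; have [cX uX _] := blob_cut e_sym e_irr b.
rewrite (card_locs_cut b hw) ?cX ?inE ?eqxx ?orbT // /rcount !big_bool /=.
move: uX; rewrite /= !inE negb_or => /andP[/andP[fl fr] /andP[lr _]].
by rewrite !(eq_sym r) (negPf fr) (negPf lr) ?eqxx /= ?orbT !mul1n !mul0n !addn0.
Qed.

(** The edges inside a node are [p], [q], [g] and those inside the children. Each of [p], [q], [g]
    is a cut edge of some child, so its count follows from the traces and the outside weight of that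
    child. *)
Lemma sum_lonely_inner t X f l r w : blob e t X f l r -> out_weight X f l r w ->
  \sum_(E in inner X) (lonely e E : nat) = lonelies t w.
Proof.
elim: t X f l r w => [|tl IHl tr IHr] X f l r w /=.
  by case=> x [-> _ _] _; rewrite inner1 // big_set0.
case=> a [XL [XR [g [p [q [[-> aX dLR] [sa u bL bR]]]]]]] hw.
have [cL uL _] := blob_cut e_sym e_irr bL; have [cR uR _] := blob_cut e_sym e_irr bR.
have [[m1 m2 m3 m4] _] := node_meet e_sym e_irr aX dLR sa u cL cR.
have da : [disjoint [set a] & XL :|: XR] by rewrite disjoints1.
have wL := out_weight_left aX dLR sa u cL bR hw.
have wR := out_weight_right aX dLR sa u cR bL hw.
have pq : p != q by rewrite (uniq6_neq u).
rewrite sum_innerU // inner1 // big_set0 add0n sum_innerU // m1 m2.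
rewrite big_set1 big_setU1 ?inE //= big_set1.
rewrite (IHl _ _ _ _ _ bL wL) (IHr _ _ _ _ _ bR wR).
rewrite !lonelyE; try by apply: (@cut_edge _ _ XL); rewrite cL !inE eqxx ?orbT.
  by rewrite (card_locs_f bL wL) (card_locs_r bL wL) (card_locs_l bR wR);
     clear; lia.
by apply: (@cut_edge _ _ XR); rewrite cR !inE eqxx ?orbT.
Qed.

Lemma num_lonely_closed t v f l r : blob e t (~: [set v]) f l r ->
  num_lonely e = lonely_total t /\ lonely e f = (fcount t top_weight == 1).
Proof.
move=> b; have [cX uX _] := blob_cut e_sym e_irr b.
have sv : star v = [set f; l; r].
  by rewrite -cX cutC // cut1.
have hw : out_weight (~: [set v]) f l r top_weight.
  move=> B _; rewrite setCK card_locs1 // (card_star_trace _ sv uX).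
  by [].
have fE E : E \in [set f; l; r] -> E \in edge_set e by rewrite -sv; apply: star_edge.
have [fE1 fE2 fE3] : [/\ f \in edge_set e, l \in edge_set e & r \in edge_set e].
  by split; apply: fE; rewrite !inE eqxx ?orbT.
split; last by rewrite lonelyE // (card_locs_f b hw).
have -> : num_lonely e = \sum_(E in inner ([set v] :|: ~: [set v])) (lonely e E : nat).
  rewrite setUCr /num_lonely -sum1_card big_mkcond [RHS]big_mkcond; apply: eq_bigr => E _.
  by rewrite !inE subsetT andbT; case: (E \in edge_set e) => //=; case: (lonely e E).
have dX : [disjoint [set v] & ~: [set v]] by rewrite -setI_eq0 setICr.
rewrite sum_innerU // inner1 // big_set0 add0n cut1 // cX sv setIid.
rewrite (sum_lonely_inner b hw) /lonely_total addnC; congr (_ + _).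
move: uX; rewrite /= !inE negb_or => /andP[/andP[fl fr] /andP[lr _]].
rewrite -setUA big_setU1 ?inE ?negb_or ?fl //= big_setU1 ?inE //= big_set1 !lonelyE // addnA.
by rewrite (card_locs_f b hw) (card_locs_l b hw) (card_locs_r b hw).
Qed.

End LonelyCounts.

(** * Trees with four lonely edges *)

(** A blob has an odd number of vertices, so it cannot use an even number of cut edges, and choosing
    [f] alone forces the matching all the way down. Three unknown traces remain. *)
Lemma traces_even t :
  [/\ traces t false false false = 0, traces t true true false = 0,
      traces t true false true = 0 & traces t false true true = 0]
  /\ traces t true false false = 1.
Proof.
elim: t => [|tl [[l1 l2 l3 l4] l5] tr [[r1 r2 r3 r4] r5]] //=.
by rewrite !big_bool /= ?l1 ?l2 ?l3 ?l4 ?l5 ?r1 ?r2 ?r3 ?r4 ?r5 ?muln0 ?mul0n ?addn0.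
Qed.

Notation xtr t := (traces t false true false).
Notation ytr t := (traces t false false true).
Notation ztr t := (traces t true true true).

Lemma traces_node tl tr :
  [/\ xtr (Node tl tr) = ztr tl + xtr tl * xtr tr,
      ytr (Node tl tr) = ztr tr + ytr tl * ytr tr &
      ztr (Node tl tr) = xtr tl * ytr tr].
Proof.
case: (traces_even tl) => -[l1 l2 l3 l4] l5; case: (traces_even tr) => -[r1 r2 r3 r4] r5.
by split; rewrite /= !big_bool /= ?l1 ?l2 ?l3 ?l4 ?l5 ?r1 ?r2 ?r3 ?r4 ?r5
   ?muln0 ?mul0n ?muln1 ?mul1n ?addn0 ?add0n // addnC.
Qed.

Definition leafb t := if t is Leaf then true else false.

Fixpoint rcomb t := if t is Node tl tr then leafb tl && rcomb tr else true.
Fixpoint lcomb t := if t is Node tl tr then leafb tr && lcomb tl else true.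

(** Positivity is the source of the rigidity below; [ztr] vanishes for a leaf because one vertex
    cannot use three edges. *)
Lemma traces_gt0 t : (0 < xtr t) && (0 < ytr t) /\ (ztr t == 0) = leafb t.
Proof.
elim: t => [|tl [/andP[xl yl] zl] tr [/andP[xr yr] zr]] //.
case: (traces_node tl tr) => -> -> ->; rewrite !addn_gt0 !muln_gt0 xl xr yl yr !orbT.
by split=> //=; rewrite muln_eq0 !eqn0Ngt xl yr.
Qed.

(** In [ztr tl + xtr tl * xtr tr] the product is positive. The value 1 thus needs [ztr tl = 0], so
    the left child is a leaf and the condition passes to the right child. *)
Lemma xtr_eq1 t : (xtr t == 1) = rcomb t.
Proof.
elim: t => [|tl IHl tr IHr] //; case: (traces_node tl tr) => -> _ _; rewrite [RHS]/= -IHr.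
case: (traces_gt0 tl) => /andP[xl _]; case: (traces_gt0 tr) => /andP[xr _] _.
case: tl xl {IHl} => [|a b] xl; first by rewrite mul1n.
rewrite [leafb _]/= => h; have zp : 0 < ztr (Node a b) by rewrite lt0n h.
have xp : 0 < xtr (Node a b) * xtr tr by rewrite muln_gt0 xl xr.
by apply/eqP => eq; clear -eq zp xp; lia.
Qed.

Lemma traces_mirror_xy t : xtr (mirror t) = ytr t.
Proof. exact: traces_mirror. Qed.

Lemma rcomb_mirror t : rcomb (mirror t) = lcomb t.
Proof. by elim: t => //= tl IHl tr IHr; rewrite IHl; case: tr {IHr}. Qed.

Lemma ytr_eq1 t : (ytr t == 1) = lcomb t.
Proof. by rewrite -traces_mirror_xy xtr_eq1 rcomb_mirror. Qed.

(* The three ways in which a factor 1 of the outside weight can reach a lonely edge inside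
   a blob: along [f], along the right spine, and along the left spine. *)
Fixpoint caterpillar t :=
  if t is Node tl tr then
    [|| leafb tl && leafb tr, leafb tr && caterpillar tl | leafb tl && caterpillar tr]
  else false.
Fixpoint rspine t :=
  if t is Node tl tr then rcomb tl && (leafb tr || rspine tr) else false.
Fixpoint lspine t :=
  if t is Node tl tr then lcomb tr && (leafb tl || lspine tl) else false.

Section Weights.
Variable w : bool -> bool -> bool -> nat.

(** Only arguments of odd parity are computed, since all other traces vanish. *)
Lemma lweightE t :
  [/\ lweight t w true false false = w true false false + w false false true * ztr t,
      lweight t w false true false = w false true false * xtr t + w true true true * ytr t,
      lweight t w false false true = w false false true * ytr t &
      lweight t w true true true = w false true false].
Proof.
case: (traces_even t) => -[r1 r2 r3 r4] r5.
by rewrite /lweight !big_bool /= ?r1 ?r2 ?r3 ?r4 ?r5 ?muln0 ?mul0n ?muln1 ?mul1n ?addn0 ?add0n;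
   split=> //; rewrite addnC.
Qed.

Lemma rweightE t :
  [/\ rweight t w true false false = w true false false + w false true false * ztr t,
      rweight t w false false true = w false false true * ytr t + w true true true * xtr t,
      rweight t w false true false = w false true false * xtr t &
      rweight t w true true true = w false false true].
Proof.
case: (traces_even t) => -[r1 r2 r3 r4] r5.
by rewrite /rweight !big_bool /= ?r1 ?r2 ?r3 ?r4 ?r5 ?muln0 ?mul0n ?muln1 ?mul1n ?addn0 ?add0n;
   split=> //; rewrite addnC.
Qed.

Lemma countE t :
  [/\ fcount t w = w true false false + ztr t * w true true true,
      lcount t w = xtr t * w false true false + ztr t * w true true true &
      rcount t w = ytr t * w false false true + ztr t * w true true true].
Proof.
case: (traces_even t) => -[r1 r2 r3 r4] r5.
by rewrite /fcount /lcount /rcount !big_bool /= ?r1 ?r2 ?r3 ?r4 ?r5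
   ?muln0 ?mul0n ?muln1 ?mul1n ?addn0 ?add0n; split=> //; rewrite addnC.
Qed.

End Weights.

Lemma addn_mul_eq1 a b c : 0 < a -> 0 < b -> (a + b * c == 1) = (a == 1) && (c == 0).
Proof. by move=> a0 b0; case: c => [|c]; rewrite ?muln0 ?addn0 ?andbT ?andbF //; nia. Qed.

(** The counts of [g], [p] and [q]. Each is a positive term plus terms containing the [ztr] of a
    child, so the value 1 makes that child a leaf. *)
Lemma node_counts tl tr w :
  0 < w true false false -> 0 < w false true false -> 0 < w false false true ->
  [/\ (fcount tl (lweight tr w) == 1) = [&& w true false false == 1, leafb tl & leafb tr],
      (rcount tl (lweight tr w) == 1) = [&& leafb tl, w false false true == 1 & lcomb tr] &
      (lcount tr (rweight tl w) == 1) = [&& leafb tr, w false true false == 1 & rcomb tl]].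
Proof.
move=> w1 w2 w3.
case: (traces_gt0 tl) => /andP[xl yl] zl; case: (traces_gt0 tr) => /andP[xr yr] zr.
case: (lweightE w tr) => a1 a2 a3 a4; case: (rweightE w tl) => b1 b2 b3 b4.
case: (countE (lweight tr w) tl) => -> _ ->; case: (countE (rweight tl w) tr) => _ -> _.
rewrite a1 a3 a4 b3 b4; split.
- rewrite [ztr tl * _]mulnC addn_mul_eq1 ?addn_gt0 ?w1 // addn_mul_eq1 //.
  by rewrite zl zr -andbA (andbC (leafb tr)).
- rewrite [ztr tl * _]mulnC addn_mul_eq1 ?muln_gt0 ?yl ?w3 ?yr // zl.
  case: (boolP (leafb tl)) => lf; rewrite ?andbF // andbT.
  have -> : ytr tl = 1 by case: (tl) lf.
  by rewrite mul1n muln_eq1 ytr_eq1.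
rewrite [ztr tr * _]mulnC addn_mul_eq1 ?muln_gt0 ?xl ?w2 ?xr // zr.
case: (boolP (leafb tr)) => lf; rewrite ?andbF // andbT.
have -> : xtr tr = 1 by case: (tr) lf.
by rewrite mul1n muln_eq1 xtr_eq1.
Qed.

(** With all four weights positive, the [l] weight of a left child and the [r] weight of a right
    child are sums of two positive terms, hence at least 2. The value 1 survives only along the
    three routes on the right-hand side. *)
Lemma lonelies_inner t w :
  0 < w true false false -> 0 < w false true false -> 0 < w false false true ->
  0 < w true true true ->
  lonelies t w = ((w true false false == 1) && caterpillar t) +
    ((w false true false == 1) && rspine t) + ((w false false true == 1) && lspine t).
Proof.
elim: t w => [|tl IHl tr IHr] w w1 w2 w3 w4 /=; first by rewrite !andbF.
case: (node_counts tl tr w1 w2 w3) => -> -> ->.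
case: (traces_gt0 tl) => /andP[xl yl] zl; case: (traces_gt0 tr) => /andP[xr yr] zr.
case: (lweightE w tr) => a1 a2 a3 a4; case: (rweightE w tl) => b1 b2 b3 b4.
rewrite IHl ?a1 ?a2 ?a3 ?a4 ?addn_gt0 ?muln_gt0 ?w1 ?w2 ?w3 ?xr ?yr //.
rewrite IHr ?b1 ?b2 ?b3 ?b4 ?addn_gt0 ?muln_gt0 ?w1 ?w2 ?w3 ?xl ?yl //.
have -> : (w false true false * xtr tr + w true true true * ytr tr == 1) = false.
  have h1 : 0 < w false true false * xtr tr by rewrite muln_gt0 w2.
  have h2 : 0 < w true true true * ytr tr by rewrite muln_gt0 w4.
  by apply/eqP; clear -h1 h2; lia.
have -> : (w false false true * ytr tl + w true true true * xtr tl == 1) = false.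
  have h1 : 0 < w false false true * ytr tl by rewrite muln_gt0 w3.
  have h2 : 0 < w true true true * xtr tl by rewrite muln_gt0 w4.
  by apply/eqP; clear -h1 h2; lia.
rewrite (addn_mul_eq1 _ w1 w3) (addn_mul_eq1 _ w1 w2) zl zr !muln_eq1 ytr_eq1 xtr_eq1.
case: (w true false false == 1); case: (w false true false == 1);
case: (w false false true == 1) => /=; rewrite ?andbF ?andbT /=;
case: tl {IHl xl yl zl a1 a2 a3 a4 b1 b2 b3 b4} => [|a b];
case: tr {IHr xr yr zr} => [|c d] //=; rewrite ?andbF ?andbT ?orbF ?addn0 ?add0n //=.
all: clear; lia.
Qed.

(** The root is treated apart because [top_weight] vanishes on three chosen edges, so the positivity
    required by [lonelies_inner] begins at its children. The summands are [f], [l], [r], [g], [p],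
    [q] and the interiors of the two children. *)
Lemma lonely_total_node tl tr : let t := Node tl tr in
  lonely_total t = 1 + rcomb t + lcomb t + (leafb tl && leafb tr)
    + (leafb tl && lcomb tr) + (leafb tr && rcomb tl)
    + ((leafb tr && caterpillar tl) + (rcomb tr && rspine tl) + (lcomb tr && lspine tl))
    + ((leafb tl && caterpillar tr) + (rcomb tl && rspine tr) + (lcomb tl && lspine tr)).
Proof.
move=> t; rewrite /lonely_total.
have -> : lonelies t top_weight = (leafb tl && leafb tr)
    + (leafb tl && lcomb tr) + (leafb tr && rcomb tl)
    + ((leafb tr && caterpillar tl) + (rcomb tr && rspine tl) + (lcomb tr && lspine tl))
    + ((leafb tl && caterpillar tr) + (rcomb tl && rspine tr) + (lcomb tl && lspine tr)).
  rewrite /t [lonelies _ _]/=.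
  case: (traces_gt0 tl) => /andP[xl yl] zl; case: (traces_gt0 tr) => /andP[xr yr] zr.
  have [-> -> ->] := @node_counts tl tr top_weight isT isT isT.
  case: (lweightE top_weight tr) => a1 a2 a3 a4; case: (rweightE top_weight tl) => b1 b2 b3 b4.
  rewrite lonelies_inner ?a1 ?a2 ?a3 ?a4 ?addn_gt0 ?muln_gt0 ?xr ?yr //.
  rewrite lonelies_inner ?b1 ?b2 ?b3 ?b4 ?addn_gt0 ?muln_gt0 ?xl ?yl //.
  rewrite /top_weight !mul1n !mul0n !addn0 -[1 + ztr tr]/(1 + ztr tr) !add1n !eqSS zl zr.
  by rewrite !ytr_eq1 !xtr_eq1.
case: (countE top_weight t) => -> -> ->.
rewrite /top_weight !muln0 !muln1 !addn0 xtr_eq1 ytr_eq1.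
by rewrite !addnA.
Qed.

(** * Combs and the classification of trees with total four *)

Definition comb n := iter n (Node Leaf) Leaf.

Lemma mirror_spines t :
  [/\ leafb (mirror t) = leafb t, lcomb (mirror t) = rcomb t,
      caterpillar (mirror t) = caterpillar t, rspine (mirror t) = lspine t &
      lspine (mirror t) = rspine t].
Proof.
have lf s : leafb (mirror s) = leafb s by case: s.
have lc s : lcomb (mirror s) = rcomb s by rewrite -{2}(mirrorK s) rcomb_mirror.
split=> //; elim: t => //= tl IHl tr IHr; rewrite ?lf ?lc ?rcomb_mirror ?IHl ?IHr //.
by rewrite andbC; congr (_ || _); rewrite orbC.
Qed.

Lemma rcombP t : rcomb t -> exists n, t = comb n.
Proof.
elim: t => [|tl _ tr IH] /=; first by exists 0.
by case/andP; case: tl => // _ /IH [n ->]; exists n.+1.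
Qed.

Lemma lcombP t : lcomb t -> exists n, t = mirror (comb n).
Proof. by rewrite -rcomb_mirror => /rcombP[n eq]; exists n; rewrite -eq mirrorK. Qed.

Lemma comb_spines n :
  [/\ rcomb (comb n), lcomb (comb n) = (n <= 1), caterpillar (comb n) = (0 < n),
      rspine (comb n) = (0 < n) & lspine (comb n) = (0 < n <= 2)].
Proof.
elim: n => [|n [h1 h2 h3 h4 h5]] //; rewrite /= -/(comb n) h1 h2 h3 h4 andbT.
have -> : leafb (comb n) = (n == 0) by case: (n).
by clear; case: n => [|[|n]]; split.
Qed.

Lemma cherry_eq t : ~~ leafb t -> rcomb t -> lcomb t -> t = comb 1.
Proof.
move=> nl /rcombP[n eq]; move: nl; rewrite eq; have [_ -> _ _ _] := comb_spines n.
by case: n eq => [|[|]].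
Qed.

(** If the right child of the root is a leaf, the total is 1 plus this sum over the left child.
    Combs with 1, 2, 3, 4, ... nodes give 5, 4, 3, 3, ...; a tree that is a comb of neither hand
    must satisfy all of the other three conditions. *)
Lemma spines_eq3 t : ~~ leafb t ->
  rcomb t + lcomb t + caterpillar t + rspine t + lspine t = 3 ->
  exists2 u, u = t \/ u = mirror t &
    (exists2 n, 3 <= n & u = comb n) \/ u = Node (comb 2) Leaf.
Proof.
have small m : lspine (comb m) -> m = 1 \/ m = 2.
  by have [_ _ _ _ ->] := comb_spines m; clear; lia.
have comb3 n : ~~ leafb (comb n) ->
  rcomb (comb n) + lcomb (comb n) + caterpillar (comb n) + rspine (comb n) + lspine (comb n) = 3
  -> 3 <= n.
  have [-> -> -> -> ->] := comb_spines n; case: n => // n _.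
  by clear; lia.
have [m1 m2 m3 m4 m5] := mirror_spines t.
move=> nl sum; case: (boolP (rcomb t)) => [/rcombP[n eq]|nr].
  by exists t; [left | left; exists n => //; apply: comb3; rewrite -eq].
case: (boolP (lcomb t)) => [/lcombP[n eq]|nlc].
  have eq' : mirror t = comb n by rewrite eq mirrorK.
  exists (mirror t); [by right | left; exists n => //; apply: comb3; rewrite -eq' ?m1 //].
  by rewrite m2 m3 m4 m5 rcomb_mirror -sum (addnC (lcomb t)) addnAC.
have [ct rt lt] : [/\ caterpillar t, rspine t & lspine t].
  by move: sum; rewrite (negPf nr) (negPf nlc); case: caterpillar; case: rspine; case: lspine.
(* [caterpillar] makes one child a leaf. The spine conditions bound the comb on the other side by
   length 2, and length 1 would make the whole tree a comb. *)
case: t nl ct rt lt nr nlc {sum m1 m2 m3 m4 m5} => [|P Q] //= _ ct /andP[rP rQ] /andP[lQ lP] nr nlc.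
case: Q lQ rQ ct lP nr nlc => [|Q1 Q2] lQ rQ ct lP nr nlc.
  exists (Node P Leaf); [by left | right]; have [m eq] := rcombP rP.
  move: lP nlc; rewrite eq; case: (boolP (leafb _)) => [|_] /=; first by case: m {eq}.
  by move/small => [] -> .
case: P rP rQ ct lP nr nlc => [|P1 P2] // rP rQ _ lP nr nlc.
have [m eq] := lcombP lQ; exists (mirror (Node Leaf (Node Q1 Q2))); [by right | right].
rewrite eq /= mirrorK; move: rQ nr; rewrite eq => /orP[|]; first by case: m {eq}.
have [_ _ _ -> _] := mirror_spines (comb m).
by rewrite rcomb_mirror => /small[] ->.
Qed.

(** [P] stands for being a tree of a given graph. Its two symmetries are reflection and exchanging
    the ends of the distinguished edge; composed, they swap the children of the root. *)
Lemma lonely_total_eq4 t (P : tree -> Prop) :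
  (forall u, P u -> P (mirror u)) ->
  (forall A B, P (Node A B) -> P (Node (mirror A) (mirror B))) ->
  P t -> lonely_total t = 4 ->
  [\/ exists2 k, 3 <= k & P (Node (comb k) Leaf), P (Node (Node (comb 2) Leaf) Leaf) |
      P (Node (comb 2) (comb 1))].
Proof.
move=> Pm Pf; case: t => [|L R] Pt; first by rewrite /lonely_total /fcount /lcount /rcount !big_bool.
have Ps A B : P (Node A B) -> P (Node B A).
  by move=> h; have := Pf _ _ (Pm _ h); rewrite !mirrorK.
rewrite lonely_total_node /=.
wlog : L R Pt / leafb R \/ ~~ leafb L /\ ~~ leafb R => [wl|].
  case/orP: (orbN (leafb R)) => [lR|nR]; first by apply: (wl L R) => //; left.
  case/orP: (orbN (leafb L)) => lL; last by apply: (wl L R) => //; right.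
  move=> h; apply: (wl R L); [exact: Ps | by left|].
  rewrite -{}h; case: L lL {Pt} => // _; case: R nR => //= R1 R2 _.
  by rewrite ?andbF ?andbT /=; clear; lia.
case=> [|[nL nR]].
  case: R Pt => // Pt _; case: (boolP (leafb L)) => [|nL]; first by case: L Pt.
  rewrite /= ?andbT => sum.
  have /(spines_eq3 nL) [u eu cu] :
    rcomb L + lcomb L + caterpillar L + rspine L + lspine L = 3.
    by move: sum; clear; lia.
  have Pu : P (Node u Leaf) by case: eu => ->; [|exact: (Pf _ Leaf)].
  case: cu => [[n n3 eq]|eq]; first by constructor 1; exists n; rewrite -?eq.
  by constructor 2; rewrite -eq.
(* When neither child is a leaf, three of the four remaining summands must hold, so one child is a
   comb of both hands, hence a cherry. *)
wlog [rR lR] : L R Pt nL nR / rcomb R /\ lcomb R => [wl|].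
  move=> sum.
  have : rcomb R && lcomb R \/ rcomb L && lcomb L.
    move: sum; rewrite (negPf nL) (negPf nR) /=.
    by case: (rcomb R); case: (lcomb R); case: (rcomb L); case: (lcomb L);
       rewrite /= ?add0n ?addn0; clear; try (by [left|right]); lia.
  case=> /andP[r1 l1]; first exact: (wl L R).
  apply: (wl R L) => //; first exact: Ps.
  by rewrite -{}sum; clear; lia.
have eR := cherry_eq nR rR lR; subst R => /=.
rewrite (negPf nL) /= ?andbT ?andbF /=; move=> sum.
have : rcomb L \/ lcomb L.
  by move: sum; case: (rcomb L); case: (lcomb L); clear; try (by [left|right]); lia.
(* The cherry satisfies both spine conditions, so the sum now depends on the comb [L] only: lengths
   1, 2 and at least 3 contribute 4, 3 and 2. *)
case=> [/rcombP[n eq]|/lcombP[n eq]]; constructor 3.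
  move: sum Pt nL; rewrite eq; have [-> -> _ -> ->] := comb_spines n.
  by case: n {eq} => [|[|[|n]]] //=; clear; lia.
move: sum Pt nL; rewrite eq rcomb_mirror.
have [-> -> _ -> ->] := mirror_spines (comb n); have [-> -> _ -> ->] := comb_spines n.
case: n {eq} => [|[|[|n]]] //=.
by move=> _ Pt _; exact: (Pf _ _ Pt).
Qed.

Lemma lonely_total_comb k : 3 <= k -> lonely_total (Node (comb k) Leaf) = 4.
Proof.
rewrite lonely_total_node /=; have [-> -> -> -> ->] := comb_spines k.
by case: k => [|[|[|k]]].
Qed.

Lemma lonely_total_fork : lonely_total (Node (comb 2) (comb 1)) = 4.
Proof. by rewrite lonely_total_node. Qed.

(** * Kotzig's theorem *)

Section Kotzig.
Variables (T : finType) (e : rel T).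
Hypothesis e_sym : symmetric e.
Hypothesis e_irr : irreflexive e.

(** A matching as a map rather than a set of edges, so that matchings of disjoint sets are glued by
    a case distinction. *)
Definition pmatch (S : {set T}) (m : T -> T) :=
  forall x, x \in S -> [/\ m x \in S, m (m x) = x & e x (m x)].

Lemma pmatchU (S S' : {set T}) (m m' : T -> T) : [disjoint S & S'] -> pmatch S m -> pmatch S' m' ->
  pmatch (S :|: S') (fun x => if x \in S then m x else m' x).
Proof.
move=> dS h h' x; rewrite !in_setU; case: (boolP (x \in S)) => [xS _|xS /= xS'].
  by have [h1 h2 h3] := h x xS; rewrite h1.
by have [h1 h2 h3] := h' x xS'; rewrite (disjointFl dS h1).
Qed.

Variables (Y : {set T}) (pi : T -> T).
Hypothesis piY : pmatch Y pi.
Hypothesis pi_unique : forall m, pmatch Y m -> {in Y, m =1 pi}.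

Definition col_set (kappa : T -> T) (C : seq T) := [set x in Y | kappa x \in C].

(* The colour classes play the role of contracted odd cycles: each is factor-critical, and
   exactly one of its vertices is matched outside the class. *)
Definition blossoms (kappa : T -> T) :=
  (forall x, x \in Y -> exists m, pmatch (col_set kappa [:: kappa x] :\ x) m) /\
  (forall x, x \in Y -> exists b, [/\ b \in Y, kappa b = kappa x, kappa (pi b) != kappa x &
     forall z, z \in Y -> kappa z = kappa x -> z != b -> kappa (pi z) = kappa x]).

Section Colouring.
Variable kappa : T -> T.

Notation ycol := (col_set kappa).

Hypothesis blossomsP : blossoms kappa.
Variables (beta u v : T -> T).
Definition colour i := i \in kappa @: Y.
Hypothesis betaP : forall i, colour i -> [/\ beta i \in Y, kappa (beta i) = i,
  kappa (pi (beta i)) != i &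
  forall z, z \in Y -> kappa z = i -> z != beta i -> kappa (pi z) = i].
Hypothesis uvP : forall i, colour i ->
  [/\ u i \in Y, kappa (u i) = i, v i \in Y, kappa (v i) != i & e (u i) (v i) /\ v i != pi (u i)].

Notation nx i := (kappa (v i)).
Notation pc i := (kappa (pi (beta i))).

Lemma colour_kappa x : x \in Y -> colour (kappa x).
Proof. by move=> xY; apply: imset_f. Qed.

Lemma colour_nx i : colour i -> colour (nx i).
Proof. by case/uvP => _ _ vY _ _; apply: colour_kappa. Qed.

Lemma colour_pc i : colour i -> colour (pc i).
Proof. by case/betaP => bY _ _ _; have [h _ _] := piY bY; apply: colour_kappa. Qed.

(** A matching edge that leaves a class joins the bases of two classes. *)
Lemma beta_pc i : colour i -> beta (pc i) = pi (beta i).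
Proof.
move=> ci; have [bY kb nb _] := betaP ci; have [h1 h2 _] := piY bY.
have [_ _ _ h] := betaP (colour_pc ci).
apply/eqP; rewrite eq_sym; apply: contraT => ne.
by move: (h _ h1 erefl ne); rewrite h2 kb => eqi; rewrite -eqi eqxx in nb.
Qed.

Lemma pcK i : colour i -> pc (pc i) = i.
Proof.
move=> ci; have [bY kb _ _] := betaP ci; have [_ h2 _] := piY bY.
by rewrite beta_pc // h2.
Qed.

(** [pi] leaves a class only from base to base, so a union of classes closed under [pc] is closed
    under [pi]. *)
Lemma pmatch_pi (C : pred T) : (forall i, colour i -> C i -> C (pc i)) ->
  pmatch [set x in Y | C (kappa x)] pi.
Proof.
move=> hC x; rewrite inE => /andP[xY xC]; have [h1 h2 h3] := piY xY; split=> //.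
rewrite inE h1 /=; have [_ _ _ h] := betaP (colour_kappa xY).
case: (eqVneq x (beta (kappa x))) => [eq|ne]; last by rewrite h.
by rewrite eq; apply: hC => //; exact: colour_kappa.
Qed.

(** Use the edge from [u i] to [v i], and in each of the two classes match what is left after
    deleting its end. *)
Lemma pair_pmatch i : colour i ->
  exists m, pmatch (ycol [:: i; nx i]) m /\ m (u i) = v i.
Proof.
move=> ci; have [uY ku vY kv [uv _]] := uvP ci.
have [m1 hm1] := blossomsP.1 _ uY; have [m2 hm2] := blossomsP.1 _ vY.
rewrite ku in hm1.
pose m x := if x == u i then v i else if x == v i then u i else
  if kappa x == i then m1 x else m2 x.
have uv_ne : u i != v i by apply: contra kv => /eqP <-; rewrite ku.
have mu : m (u i) = v i by rewrite /m eqxx.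
have mv : m (v i) = u i by rewrite /m eq_sym (negPf uv_ne) eqxx.
have mE1 x : x != u i -> kappa x = i -> m x = m1 x.
  rewrite /m => /negPf -> kx; rewrite kx eqxx.
  by case: eqP => // eq; rewrite -eq kx eqxx in kv.
have mE2 x : x != v i -> kappa x = nx i -> m x = m2 x.
  rewrite /m => /negPf -> kx; rewrite kx (negPf kv).
  by case: eqP => // eq; rewrite -kx eq ku eqxx in kv.
exists m; split=> // x; rewrite !inE => /andP[xY].
case: (eqVneq x (u i)) => [-> _|xu].
  by rewrite mu mv vY eqxx orbT.
case: (eqVneq x (v i)) => [-> _|xv].
  by rewrite mv mu uY ku eqxx e_sym.
case: (eqVneq (kappa x) i) => [kx _|kx /= /eqP kxn].
  have /hm1 : x \in ycol [:: i] :\ u i by rewrite !inE xu xY kx eqxx.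
  rewrite !inE => -[/and3P[nmu mY /eqP km] mm em].
  by rewrite mE1 // mY km eqxx mE1.
have /hm2 : x \in ycol [:: nx i] :\ v i by rewrite !inE xv xY kxn eqxx.
rewrite !inE => -[/and3P[nmv mY /eqP km] mm em].
by rewrite mE2 // mY km eqxx orbT mE2.
Qed.

Lemma seq_pmatch (Q : seq T) : (forall i, i \in Q -> colour i) ->
  uniq (Q ++ [seq nx i | i <- Q]) ->
  exists m, pmatch (ycol (Q ++ [seq nx i | i <- Q])) m /\ forall i, i \in Q -> m (u i) = v i.
Proof.
elim: Q => [|i Q IH] cQ uQ.
  by exists id; split=> // x; rewrite inE andbF.
have ci : colour i by apply: cQ; rewrite inE eqxx.
have p : perm_eq ((i :: Q) ++ [seq nx j | j <- i :: Q]) ([:: i; nx i] ++ (Q ++ [seq nx j | j <- Q])).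
  by apply/permP => a; rewrite /= !count_cat /=; clear; lia.
have := uQ; rewrite (perm_uniq p) cat_uniq => /and3P[_ /hasPn dis uQ'].
have [|m2 [hm2 hm2']] := IH _ uQ'; first by move=> j jQ; apply: cQ; rewrite inE jQ orbT.
have [m1 [hm1 hm1']] := pair_pmatch ci.
have dS : [disjoint ycol [:: i; nx i] & ycol (Q ++ [seq nx j | j <- Q])].
  rewrite -setI_eq0; apply/eqP/setP => x; rewrite !in_set.
  apply/negP => /andP[/andP[_ h1] /andP[_ h2]].
  by have := dis _ h2; rewrite /= h1.
exists (fun x => if x \in ycol [:: i; nx i] then m1 x else m2 x); split.
  have -> : ycol ((i :: Q) ++ [seq nx j | j <- i :: Q]) =
      ycol [:: i; nx i] :|: ycol (Q ++ [seq nx j | j <- Q]).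
    by apply/setP=> x; rewrite in_setU !in_set (perm_mem p) mem_cat -andb_orr.
  exact: pmatchU.
move=> j; rewrite inE => /orP[/eqP->|jQ].
  by have [uY ku _ _ _] := uvP ci; rewrite in_set uY ku inE eqxx.
have cj : colour j by apply: cQ; rewrite inE jQ orbT.
have [uY ku _ _ _] := uvP cj; rewrite (disjointFl dS) ?hm2' //.
by rewrite in_set uY ku mem_cat jQ.
Qed.

(** Pair off the classes of the cycle along their non-matching edges and keep [pi] elsewhere. The
    result differs from [pi] at [u i], against uniqueness. *)
Lemma no_alternating_cycle (Q : seq T) : Q != [::] -> (forall i, i \in Q -> colour i) ->
  uniq (Q ++ [seq nx i | i <- Q]) -> [seq nx i | i <- Q] =i [seq pc i | i <- Q] -> False.
Proof.
move=> Q0 cQ uQ eQ; have [m [hm hm']] := seq_pmatch cQ uQ.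
set C := Q ++ _ in hm uQ.
have cC i : i \in C -> colour i.
  by rewrite mem_cat => /orP[/cQ //|/mapP[j /cQ /colour_nx cj ->]].
have pcC i : i \in C -> pc i \in C.
  rewrite !mem_cat !eQ => /orP[iQ|/mapP[j jQ ->]]; first by rewrite map_f ?orbT.
  by rewrite pcK ?jQ // cQ.
have hpi : pmatch [set x in Y | kappa x \notin C] pi.
  apply: (pmatch_pi (C := fun i => i \notin C)) => i ci; apply: contra => /pcC.
  by rewrite pcK.
have dS : [disjoint ycol C & [set x in Y | kappa x \notin C]].
  rewrite -setI_eq0; apply/eqP/setP => x; rewrite !in_set.
  by case: (kappa x \in C); rewrite ?andbF.
have eY : Y = ycol C :|: [set x in Y | kappa x \notin C].
  by apply/setP=> x; rewrite in_setU !in_set -andb_orr orbN andbT.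
have := pmatchU dS hm hpi; rewrite -eY => /pi_unique.
case: Q Q0 cQ {uQ eQ cC pcC dS eY hpi hm} @C hm' => // i Q _ cQ C hm'.
have ci : colour i by apply: cQ; rewrite inE eqxx.
have [uY ku _ _ [_ ne]] := uvP ci.
move=> /(_ _ uY); rewrite in_set uY ku /C !inE eqxx /= hm' ?inE ?eqxx // => eq.
by rewrite eq eqxx in ne.
Qed.

(** The merged class stays factor-critical: [Q] is paired off along non-matching edges, the class
    [c] is matched without [x], and [pi] serves on [W]. *)
Lemma blossom_critical (U Q W : seq T) c x : uniq U -> (forall i, i \in U -> colour i) ->
  perm_eq U ((Q ++ [seq nx i | i <- Q]) ++ c :: W) -> (forall i, i \in W -> pc i \in W) ->
  x \in Y -> kappa x = c -> exists m, pmatch (ycol U :\ x) m.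
Proof.
move=> uU cU p pW xY kx; have := uU; rewrite (perm_uniq p) cat_uniq => /and3P[uQ /hasPn dis].
rewrite cons_uniq => /andP[cW _].
have [|m [hm _]] := seq_pmatch _ uQ.
  by move=> i iQ; apply: cU; rewrite (perm_mem p) !mem_cat iQ.
have [m' hm'] := blossomsP.1 _ xY; rewrite kx in hm'.
have hW : pmatch (ycol W) pi by apply: (pmatch_pi (C := mem W)) => i _; exact: pW.
have d1 : [disjoint ycol [:: c] :\ x & ycol W].
  rewrite -setI_eq0; apply/eqP/setP => y; rewrite !in_set.
  rewrite (mem_seq1 (kappa y)).
  by case: eqP => [->|]; rewrite ?andbF //= (negPf cW) !andbF.
have d2 : [disjoint ycol (Q ++ [seq nx i | i <- Q]) & (ycol [:: c] :\ x) :|: ycol W].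
  rewrite -setI_eq0; apply/eqP/setP => y; rewrite !in_set.
  rewrite (mem_seq1 (kappa y)).
  apply/negP => /andP[/andP[_ h] /orP[/and3P[_ _ /eqP h2]|/andP[_ h2]]].
    by have := dis c; rewrite inE eqxx => /(_ isT) /=; rewrite -h2 h.
  by have := dis (kappa y); rewrite inE h2 orbT => /(_ isT) /=; rewrite h.
have hmm := pmatchU d2 hm (pmatchU d1 hm' hW); eexists.
suff -> : ycol U :\ x = ycol (Q ++ [seq nx i | i <- Q]) :|: (ycol [:: c] :\ x :|: ycol W) by exact: hmm.
apply/setP=> y; rewrite in_setD1 !in_setU in_setD1 !in_set (perm_mem p) mem_cat in_cons mem_seq1.
case: (eqVneq y x) => [->|_] /=; last by case: (y \in Y).
rewrite kx xY /= (negPf cW) orbF; apply/esym/negbTE.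
by have := dis c; rewrite inE eqxx; apply.
Qed.

Definition merged (U : seq T) c x := if kappa x \in U then c else kappa x.

(* Leave each class by a non-matching edge, then leave the class reached by its matching edge,
   until the walk meets itself: it closes up either as an alternating cycle or as an odd one. *)
Lemma lasso i0 : colour i0 -> exists c rest,
  [/\ forall i, i \in c :: rest -> colour i,
      uniq ((c :: rest) ++ [seq pc i | i <- c :: rest]) &
      [seq nx i | i <- c :: rest] = rcons [seq pc i | i <- rest] (pc c) \/
      [seq nx i | i <- c :: rest] = rcons [seq pc i | i <- rest] c].
Proof.
have grow k c rest : #|T| <= size rest + k ->
  (forall i, i \in c :: rest -> colour i) ->
  uniq ((c :: rest) ++ [seq pc i | i <- c :: rest]) ->
  [seq nx i | i <- belast c rest] = [seq pc i | i <- rest] ->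
  exists c' rest',
  [/\ forall i, i \in c' :: rest' -> colour i,
      uniq ((c' :: rest') ++ [seq pc i | i <- c' :: rest']) &
      [seq nx i | i <- c' :: rest'] = rcons [seq pc i | i <- rest'] (pc c') \/
      [seq nx i | i <- c' :: rest'] = rcons [seq pc i | i <- rest'] c'].
  elim: k c rest => [|k IH] c rest sz cC uC chain.
    move: uC; rewrite cat_uniq => /and3P[/card_uniqP eqc _ _].
    have h : size (c :: rest) <= #|T| by rewrite -eqc max_card.
    by have := leq_trans h sz; rewrite /= addn0 ltnn.
  set l := last c rest.
  have cl : colour l by apply: cC; rewrite mem_last.
  (* The walk leaves its last class by a non-matching edge, arrives in [nx l], and goes on to [d] by
     the matching edge of that class. *)
  have cn := colour_nx cl; set d := pc (nx l).
  have cd : colour d by apply: colour_pc.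
  have dn : pc d = nx l by rewrite pcK.
  have full : [seq nx i | i <- c :: rest] = rcons [seq pc i | i <- rest] (pc d).
    by rewrite lastI map_rcons chain dn.
  have sub l1 c' l2 : c :: rest = l1 ++ c' :: l2 ->
     [/\ forall i, i \in c' :: l2 -> colour i,
      uniq ((c' :: l2) ++ [seq pc i | i <- c' :: l2]) &
      [seq nx i | i <- c' :: l2] = rcons [seq pc i | i <- l2] (pc d)].
    move=> eq; split.
    - by move=> i il2; apply: cC; rewrite eq mem_cat il2 orbT.
    - apply: subseq_uniq uC; rewrite eq map_cat.
      by apply: cat_subseq; apply: suffix_subseq.
    have eqr : rest = behead l1 ++ (if l1 is [::] then l2 else c' :: l2).
      by move: eq; case: (l1) => [|? ?] /= [].
    move: full; rewrite eq map_cat => full.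
    have := congr1 (drop (size l1)) full.
    rewrite drop_size_cat ?size_map // => ->.
    rewrite eqr; case: (l1) => [|a l1'] /=; first by rewrite drop0.
    by rewrite map_cat rcons_cat drop_cat size_map ltnNge leqnSn subSnn /= drop0.
  (* Meeting the walk at [d] closes an alternating cycle, meeting it at [pc d] an odd one. The walk
     before the meeting point is dropped. *)
  case: (boolP (d \in c :: rest)) => [dC|ndC].
    case/splitPr: dC sub => l1 l2 sub; have [h1 h2 h3] := sub l1 d l2 erefl.
    by exists d, l2; split=> //; left.
  case: (boolP (pc d \in c :: rest)) => [dC|npdC].
    case/splitPr: dC sub => l1 l2 sub; have [h1 h2 h3] := sub l1 (pc d) l2 erefl.
    by exists (pc d), l2; split=> //; right.
  have nd : d != pc d by have [_ _ h _] := betaP cd; rewrite eq_sym.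
  have mem_pc x : colour x -> (x \in [seq pc i | i <- c :: rest]) = (pc x \in c :: rest).
    move=> cx; apply/mapP/idP => [[y yC ->]|h]; first by rewrite pcK // cC.
    by exists (pc x); rewrite ?pcK.
  apply: (IH c (rcons rest d)).
  - by rewrite size_rcons; move: sz; clear; lia.
  - by move=> i; rewrite -rcons_cons mem_rcons inE => /orP[/eqP->|/cC].
  - have p : perm_eq ((c :: rcons rest d) ++ [seq pc i | i <- c :: rcons rest d])
      (d :: pc d :: ((c :: rest) ++ [seq pc i | i <- c :: rest])).
      apply/permP => a; rewrite /= !map_rcons -!cats1 !count_cat /= !count_cat /=.
      by clear; lia.
    rewrite (perm_uniq p) 2!cons_uniq uC andbT in_cons negb_or nd !mem_cat.
    by rewrite (mem_pc _ cd) (mem_pc _ (colour_pc cd)) pcK // (negPf ndC) (negPf npdC).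
  rewrite belast_rcons map_rcons -/(belast _ _).
  by rewrite full -map_rcons.
move=> ci; apply: (grow #|T| i0 [::]) => //.
  by move=> i; rewrite inE => /eqP ->.
rewrite /= andbT inE; have [_ _ h _] := betaP ci; by rewrite eq_sym.
Qed.

(** The classes of the odd cycle become one class. Its base is that of [c], the only class of the
    cycle whose partner class lies outside. *)
Lemma odd_cycle_merge c rest :
  (forall i, i \in c :: rest -> colour i) ->
  uniq ((c :: rest) ++ [seq pc i | i <- c :: rest]) ->
  [seq nx i | i <- c :: rest] = rcons [seq pc i | i <- rest] c ->
  exists kappa', blossoms kappa' /\ #|kappa' @: Y| < #|kappa @: Y|.
Proof.
move=> cC uC chain; set U := (c :: rest) ++ [seq pc i | i <- rest].
have uU : uniq U.
  by apply: subseq_uniq uC; rewrite map_cons; apply: cat_subseq => //; exact: subseq_cons.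
have cU i : i \in U -> colour i.
  rewrite mem_cat => /orP[/cC //|/mapP[j jr ->]]; apply: colour_pc.
  by apply: cC; rewrite inE jr orbT.
have cc : colour c by apply: cC; rewrite inE eqxx.
have cin : c \in U by rewrite mem_cat inE eqxx.
have pcU : pc c \notin U.
  move: uC; rewrite cat_uniq map_cons has_sym => /and3P[_ /hasPn h1 /andP[h2 _]].
  rewrite mem_cat negb_or h2 andbT; apply/negP => h3.
  by have := h1 _ h3; rewrite /= inE eqxx.
have pcU' i : i \in U -> i != c -> pc i \in U.
  rewrite !mem_cat !in_cons => /orP[/orP[/eqP->|ir]|/mapP[j jr ->]]; first by rewrite eqxx.
    by rewrite map_f ?orbT.
  by rewrite pcK ?jr ?orbT //; apply: cC; rewrite inE jr orbT.
exists (merged U c).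
have mU x : kappa x \in U -> merged U c x = c by rewrite /merged => ->.
have mN x : kappa x \notin U -> merged U c x = kappa x by rewrite /merged => /negPf ->.
have mEc x : (merged U c x == c) = (kappa x \in U).
  case: (boolP (kappa x \in U)) => [/mU->|h]; first by rewrite eqxx.
  by rewrite mN //; apply: contraNF h => /eqP->.
have mEn x i : i \notin U -> (merged U c x == i) = (kappa x == i).
  move=> iU; case: (boolP (kappa x \in U)) => [h|/mN-> //]; rewrite mU //.
  have -> : (c == i) = false by apply: contraNF iU => /eqP <-.
  by apply/esym; apply: contraNF iU => /eqP <-.
split; last first.
  apply: proper_card; apply/properP; split.
    apply/subsetP => i /imsetP[x xY ->]; rewrite /merged; case: ifP => _; first exact: cc.
    exact: colour_kappa.
  (* The cycle has a class besides [c], as [nx c] differs from [c]; the colour of that class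
     disappears. *)
  have [c1 [r eqr]] : exists c1 r, rest = c1 :: r.
    case: (rest) chain => [|c1 r] /=; last by exists c1, r.
    by case=> eq; have [_ _ _ + _] := uvP cc; rewrite eq eqxx.
  have c1in : c1 \in U by rewrite mem_cat !inE eqr inE eqxx ?orbT.
  exists c1; first exact: cU.
  apply/imsetP => -[x xY eq].
  have c1c : c1 = c.
    case: (boolP (kappa x \in U)) => [/mU h|h]; first by rewrite eq h.
    by have h' := h; rewrite -(mN x h) -eq c1in in h'.
  by move: uU; rewrite /U eqr c1c /= inE eqxx.
split=> x xY.
  case: (boolP (kappa x \in U)) => [xU|xU]; last first.
    have -> : col_set (merged U c) [:: merged U c x] = ycol [:: kappa x].
      by apply/setP=> y; rewrite !inE (mN x xU) mEn.
    exact: blossomsP.1.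
  have -> : col_set (merged U c) [:: merged U c x] = ycol U.
    by apply/setP=> y; rewrite [LHS]inE [RHS]inE (mU x xU) inE mEc.
  have closed W : (forall i, i \in W -> i \in c :: rest) ->
     forall i, i \in W ++ [seq pc j | j <- W] -> pc i \in W ++ [seq pc j | j <- W].
    move=> hW i; rewrite !mem_cat => /orP[iW|/mapP[j jW ->]]; first by rewrite map_f ?orbT.
    by rewrite pcK ?jW //; apply: cC; exact: hW.
  have split_chain r1 cj cs2 : rest = r1 ++ cj :: cs2 ->
    [seq nx i | i <- c :: r1] = rcons [seq pc i | i <- r1] (pc cj) /\
    [seq nx i | i <- cj :: cs2] = rcons [seq pc i | i <- cs2] c.
    have eqR : rcons [seq pc i | i <- r1 ++ cj :: cs2] c =
        rcons [seq pc i | i <- r1] (pc cj) ++ rcons [seq pc i | i <- cs2] c.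
      by rewrite map_cat rcons_cat cat_rcons.
    move=> eqr; move: chain; rewrite eqr -cat_cons map_cat eqR => /eqP.
    rewrite eqseq_cat; last by rewrite size_rcons !size_map.
    by case/andP => /eqP -> /eqP ->.
  (* If [x] lies in the class [c], then [pi] matches all other classes among themselves. Otherwise
     one of the two arcs between [c] and the class of [x] is paired off along non-matching edges,
     [c] included: the arc starting at [c] when [x] is in a class of [rest], the arc returning to
     [c] when it is in a partner class. The other arc keeps [pi]. *)
  move: (xU); rewrite mem_cat in_cons -orbA => /or3P[/eqP kx|xr|/mapP[cj jr kx]].
  - apply: (blossom_critical (Q := [::]) (W := rest ++ [seq pc i | i <- rest]) uU cU _ _ xY kx).
      by rewrite /U.
    by apply: closed => i ir; rewrite inE ir orbT.
  - case/splitPr eqr : {2}_ / xr (erefl rest) => [r1 cs2] _.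
    have [ch1 ch2] := split_chain _ _ _ eqr.
    apply: (blossom_critical (Q := c :: r1) (W := cs2 ++ [seq pc i | i <- cs2]) uU cU _ _ xY erefl).
      rewrite ch1 /U eqr; apply/permP => a; rewrite !map_cat -!cats1 /= !count_cat /= !count_cat /=.
      by clear; lia.
    by apply: closed => i ir; rewrite eqr inE mem_cat inE ir !orbT.
  case/splitPr eqr : {2}_ / jr (erefl rest) => [r1 cs2] _.
  have [ch1 ch2] := split_chain _ _ _ eqr.
  apply: (blossom_critical (Q := cj :: cs2) (W := r1 ++ [seq pc i | i <- r1]) uU cU _ _ xY kx).
    rewrite ch2 /U eqr; apply/permP => a; rewrite !map_cat -!cats1 /= !count_cat /= !count_cat /=.
    by clear; lia.
  by apply: closed => i ir; rewrite eqr inE mem_cat ir !orbT.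
case: (boolP (kappa x \in U)) => [xU|xU]; last first.
  have [b [bY kb nb hb]] := blossomsP.2 _ xY.
  exists b; rewrite (mN x xU) (mN b) kb //; split=> //; first by rewrite mEn.
  by move=> z zY /eqP; rewrite mEn // => /eqP kz zb; apply/eqP; rewrite mEn // hb.
have [bY kb nb _] := betaP cc.
exists (beta c); rewrite (mU x xU) (mU (beta c)) ?kb //; split=> //; first by rewrite mEc.
move=> z zY /eqP; rewrite mEc => zU zb; apply/eqP; rewrite mEc.
have cz := colour_kappa zY; have [_ _ _ hz] := betaP cz.
case: (eqVneq z (beta (kappa z))) => [eq|ne]; last by rewrite hz.
rewrite eq; apply: pcU' => //; apply: contraNneq zb => kz.
by rewrite eq kz.
Qed.

End Colouring.

(** Induction on the number of classes, starting from singletons. A class whose only exit is its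
    matching edge is one side of the bridge. If there is none, every class has a non-matching exit,
    and the walk yields a contradiction or a coarser partition. *)
Theorem kotzig : Y != set0 -> exists (S : {set T}) b, [/\ S \subset Y, b \in S,
  pi b \in Y :\: S & forall x y, x \in S -> y \in Y :\: S -> e x y -> x = b /\ y = pi b].
Proof.
case/set0Pn => x0 x0Y.
suff main k kappa : #|kappa @: Y| <= k -> blossoms kappa ->
    exists (S : {set T}) b, [/\ S \subset Y, b \in S,
  pi b \in Y :\: S & forall x y, x \in S -> y \in Y :\: S -> e x y -> x = b /\ y = pi b].
  apply: (main #|id @: Y| id) => //; split=> x xY.
    exists id => z; rewrite !inE; case: (eqVneq z x) => //=; by rewrite andbF.
  exists x; split=> //; last by move=> z _ -> ; rewrite eqxx.
  by have [_ _ h] := piY xY; rewrite eq_sym; exact: (edge_neq e_irr h).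
elim: k kappa => [|k IH] kappa sz bl.
  by move: sz; rewrite leqn0 cards_eq0 => /eqP k0; have := imset_f kappa x0Y; rewrite k0 inE.
have [beta betaP] : exists beta : T -> T, forall i, colour kappa i ->
    [/\ beta i \in Y, kappa (beta i) = i, kappa (pi (beta i)) != i &
     forall z, z \in Y -> kappa z = i -> z != beta i -> kappa (pi z) = i].
  suff h : forall i, exists b : T, colour kappa i ->
      [/\ b \in Y, kappa b = i, kappa (pi b) != i &
       forall z, z \in Y -> kappa z = i -> z != b -> kappa (pi z) = i].
    by have [f hf] := fin_all_exists h; exists f.
  move=> i; case: (boolP (i \in kappa @: Y)) => [/imsetP[x xY ->]|ni]; last by exists i; rewrite /colour (negPf ni).
  by have [b hb] := bl.2 _ xY; exists b.
pose leaf i := [forall x, forall y, [&& x \in Y, kappa x == i, y \in Y, kappa y != i & e x y]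
   ==> (y == pi x)].
case: (boolP [exists i, (i \in kappa @: Y) && leaf i]) => [/existsP[i /andP[ci li]]|nl].
  have [bY kb nb hb] := betaP i ci.
  exists [set x in Y | kappa x == i], (beta i); split.
  - by apply/subsetP => x; rewrite inE => /andP[].
  - by rewrite inE bY kb eqxx.
  - by have [h _ _] := piY bY; rewrite !inE h (negPf nb).
  move=> x y; rewrite !inE => /andP[xY /eqP kx] /andP[ny yY] xy.
  have ky : kappa y != i by move: ny; rewrite yY.
  move/forallP: li => /(_ x) /forallP /(_ y); rewrite xY kx eqxx yY ky xy => /eqP eqy.
  case: (eqVneq x (beta i)) => [<-|ne]; first by rewrite eqy.
  by rewrite eqy (hb x) ?eqxx in ky.
have [uv uvP] : exists uv : T -> T * T, forall i, colour kappa i ->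
  [/\ (uv i).1 \in Y, kappa (uv i).1 = i, (uv i).2 \in Y, kappa (uv i).2 != i &
   e (uv i).1 (uv i).2 /\ (uv i).2 != pi (uv i).1].
  suff h : forall i, exists p : T * T, colour kappa i ->
      [/\ p.1 \in Y, kappa p.1 = i, p.2 \in Y, kappa p.2 != i & e p.1 p.2 /\ p.2 != pi p.1].
    by have [f hf] := fin_all_exists h; exists f.
  move=> i; case: (boolP (i \in kappa @: Y)) => [ci|ni]; last by exists (i, i); rewrite /colour (negPf ni).
  move: nl; rewrite negb_exists => /forallP /(_ i); rewrite ci /=.
  rewrite negb_forall => /existsP[x]; rewrite negb_forall => /existsP[y].
  by rewrite negb_imply => /andP[/and5P[h1 /eqP h2 h3 h4 h5] h6]; exists (x, y).
have [|c [rest [cC uC [chain|chain]]]] := lasso betaP (u := fun i => (uv i).1)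
   (v := fun i => (uv i).2) uvP (i0 := kappa x0); first exact: imset_f.
  case: (@no_alternating_cycle kappa bl beta (fun i => (uv i).1) (fun i => (uv i).2) betaP uvP
    (c :: rest)) => //.
    move: uC; rewrite !cat_uniq chain => /and3P[-> h1 h2] /=.
    have p : perm_eq (rcons [seq kappa (pi (beta i)) | i <- rest] (kappa (pi (beta c))))
      [seq kappa (pi (beta i)) | i <- c :: rest] by rewrite perm_rcons.
    by rewrite (perm_uniq p) h2 andbT (eq_has_r (perm_mem p)).
  by rewrite chain => j; rewrite mem_rcons.
have [kappa' [bl' sz']] := @odd_cycle_merge kappa bl beta _ _ betaP uvP c rest cC uC chain.
by apply: (IH kappa') => //; rewrite -ltnS; apply: leq_trans sz' sz.
Qed.

End Kotzig.

(** * Decomposition of 3-connected cubic graphs *)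

Section BlobExistence.
Variables (T : finType) (e : rel T).
Hypothesis e_sym : symmetric e.
Hypothesis e_irr : irreflexive e.
Implicit Types (x y z : T) (f : {set T}) (X Y Z S : {set T}).

Notation star := (star e).
Notation cut := (cut e).
Notation inner := (inner e).

Lemma card_star x : #|star x| = #|[set y | e x y]|.
Proof.
have -> : star x = [set [set x; y] | y in [set y | e x y]].
  apply/setP=> f; apply/(starP e_sym e_irr)/imsetP => -[y].
    by move=> xy ->; exists y; rewrite ?inE.
  by rewrite inE => xy ->; exists y.
apply: card_in_imset => y z; rewrite !inE => xy xz eq.
have : y \in [set x; z] by rewrite -eq !inE eqxx orbT.
by rewrite !inE => /orP[/eqP yx|/eqP //]; rewrite yx e_irr in xy.
Qed.

Hypothesis cub : cubic e.
Hypothesis conn3 : three_connected e.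

Lemma card_star3 x : #|star x| = 3.
Proof. by rewrite card_star cub. Qed.

(** Two vertices share at most one edge, so each keeps two edges in the cut. These are the sets too
    small for a separation argument. *)
Lemma card_cut_small S : S != set0 -> #|S| <= 2 -> 3 <= #|cut S|.
Proof.
move=> S0; rewrite leq_eqVlt ltnS => /orP[|S1]; last first.
  have /cards1P[x ->] : #|S| == 1 by rewrite eqn_leq S1 card_gt0.
  by rewrite cut1 // card_star3.
case/cards2P=> x [y [nxy ->]].
have dxy : [disjoint [set x] & [set y]] by rewrite disjoints1 inE.
have -> : cut [set x; y] = (star x :\ [set x; y]) :|: (star y :\ [set x; y]).
  apply/setP=> f; rewrite in_cutU // !cut1 // in_setU !in_setD1.
  case: (boolP (f \in edge_set e)) => [fE|nf]; last by rewrite !inE (negPf nf) !andbF.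
  rewrite !inE fE /=; case: (eqVneq f [set x; y]) => [->|ne] /=; first by rewrite !inE !eqxx orbT.
  case: (boolP (x \in f)) => xf //; case: (boolP (y \in f)) => yf //=.
  by rewrite (edge_eq2 e_irr fE xf yf nxy) eqxx in ne.
have c2 z : 2 <= #|star z :\ [set x; y]|.
  have := cardsD1 [set x; y] (star z); have := leq_b1 ([set x; y] \in star z).
  by rewrite card_star3 -[3 in LHS]/(1 + 2) => b1 eq; rewrite -(leq_add2l 1) eq leq_add2r.
rewrite cardsU (_ : _ :&: _ = set0) ?cards0 ?subn0; last first.
  apply/setP=> f; rewrite !in_setI !in_setD1 in_set0.
  apply/negP => /andP[/andP[ne fx] /andP[_ fy]].
  case/starP: (fx) => // z _ eqf; move: fx fy; rewrite !inE => /andP[fE xf] /andP[_ yf].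
  by rewrite (edge_eq2 e_irr fE xf yf nxy) eqxx in ne.
by have := c2 x; have := c2 y; clear; lia.
Qed.

(** The ends in [S] of at most two cut edges would form a separating set of at most two vertices,
    unless they exhaust [S]. *)
Lemma card_cut_ge3 S : S != set0 -> S != setT -> 3 <= #|cut S|.
Proof.
move=> S0 ST; rewrite leqNgt; apply/negP => c3.
pose X := [set x in S | [exists y, (y \notin S) && e x y]].
have cX : #|X| <= #|cut S|.
  case/set0Pn: S0 => s0 s0S.
  apply: leq_trans (leq_imset_card (fun f => odflt s0 [pick x in f :&: S]) _).
  apply: subset_leq_card; apply/subsetP => x; rewrite inE => /andP[xS /existsP[y /andP[yS xy]]].
  apply/imsetP; exists [set x; y]; first by rewrite set2_cut // xy xS (negPf yS).
  case: pickP => [z|/(_ x)]; rewrite !inE ?xS ?eqxx //.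
  by case/andP=> /orP[]/eqP-> //; rewrite (negPf yS).
have X2 : #|X| < 3 by apply: leq_ltn_trans cX c3.
case: (boolP (S \subset X)) => [SX|/subsetPn[s sS sX]].
  have h3 : 2 < #|cut S| by apply: card_cut_small S0 _; rewrite -ltnS (leq_ltn_trans (subset_leq_card SX) X2).
  by have := leq_trans c3 h3; rewrite ltnn.
have [t tS] : exists t, t \notin S.
  by apply/existsP; rewrite -negb_forall; apply: contra ST => /forallP h; apply/eqP/setP=> x; rewrite h inE.
have tX : t \notin X by rewrite inE (negPf tS).
have := conn3.2 X X2 s t sX tX; set R := (fun a b => _) => con.
have cl : closed R (mem S).
  apply: intro_closed => [|x y /and3P[xy xX yX] xS].
    by apply: sym_connect_sym => x y; rewrite /R e_sym; congr (_ && _); rewrite andbC.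
  apply: contraNT xX => yS; rewrite inE xS; apply/existsP; exists y; by rewrite yS.
by have := closed_connect cl con; rewrite sS (negPf tS).
Qed.

(** A second matching of [Z], completed by [pi], would be a second matching of [Y]. *)
Lemma pmatch_sub (Y Z : {set T}) pi : pmatch e Y pi ->
  (forall m, pmatch e Y m -> {in Y, m =1 pi}) -> Z \subset Y ->
  (forall x, x \in Z -> pi x \in Z) ->
  pmatch e Z pi /\ (forall m, pmatch e Z m -> {in Z, m =1 pi}).
Proof.
move=> piY uniq_pi /subsetP ZY clZ; split.
  by move=> x xZ; have [_ h2 h3] := piY x (ZY x xZ); split=> //; exact: clZ.
move=> m mZ.
have comp : pmatch e (Y :\: Z) pi.
  move=> x; rewrite in_setD => /andP[xZ xY]; have [h1 h2 h3] := piY x xY; split=> //.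
  by rewrite in_setD h1 andbT; apply: contra xZ => /clZ; rewrite h2.
have dZ : [disjoint Z & Y :\: Z] by rewrite -setI_eq0; apply/eqP/setP=> x; rewrite !inE; case: (x \in Z).
have := pmatchU dZ mZ comp; rewrite (_ : Z :|: Y :\: Z = Y) => [h|]; last first.
  apply/setP=> x; rewrite in_setU in_setD; case: (boolP (x \in Z)) => //= /ZY ->; by [].
by move=> x xZ; have := uniq_pi _ h x (ZY x xZ); rewrite xZ.
Qed.

Lemma cut_piece X Z a f l r p q g : cut X = [set f; l; r] -> a \in f -> a \in X ->
  star a = [set f; p; q] -> Z \subset X :\ a ->
  (forall x y, x \in Z -> y \in (X :\ a) :\: Z -> e x y -> [set x; y] = g) ->
  {subset cut Z <= [:: g; p; q; l; r]}.
Proof.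
move=> cX af aX sa /subsetP ZY only E EZ.
have wlg x y : E = [set x; y] -> e x y -> x \in Z -> y \notin Z -> E \in [:: g; p; q; l; r].
  move=> eqE xy xZ yZ; have := ZY x xZ; rewrite !inE => /andP[xa xX].
  case: (eqVneq y a) => [ya|nya].
    have : E \in star a by rewrite eqE set2_star // xy ya eqxx orbT.
    rewrite sa !inE -orbA => /or3P[/eqP Ef|->|->]; rewrite ?orbT //.
    have : f \in cut X by rewrite cX !inE eqxx.
    by rewrite -Ef eqE set2_cut // xy xX ya aX.
  case: (boolP (y \in X)) => yX; first by rewrite eqE only ?inE ?eqxx // nya yX yZ.
  have : E \in cut X by rewrite eqE set2_cut // xy xX (negPf yX).
  rewrite cX !inE -orbA => /or3P[/eqP Ef|->|->]; rewrite ?orbT //.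
  by move: af; rewrite -Ef eqE !inE !(eq_sym a) (negPf xa) (negPf nya).
case/edge_ex: (cut_edge EZ) => // x [y [xy _ eqE]]; move: EZ; rewrite eqE set2_cut // xy /=.
case: (boolP (x \in Z)) => xZ; case: (boolP (y \in Z)) => yZ // _; rewrite -eqE.
  exact: wlg eqE xy xZ yZ.
by apply: (wlg y x) => //; [rewrite setUC | rewrite e_sym].
Qed.

Lemma card_count (U : finType) (A : {set U}) (s : seq U) : uniq s -> {subset A <= s} ->
  #|A| = count (mem A) s.
Proof.
move=> us sA; rewrite -size_filter -(card_uniqP (filter_uniq _ us)).
apply: eq_card => x; rewrite mem_filter /=; case: (boolP (x \in A)) => [/sA ->|] //.
Qed.

(** The two sides [S] and [R] of the bridge [g] share no other cut edge, and all their cut edges are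
    among [g], [p], [q], [l], [r]. Each cut has at least three edges, so each side receives exactly
    two of [p], [q], [l], [r]. *)
Lemma blob_exists n X f l r a pi : #|X| <= n -> cut X = [set f; l; r] -> uniq [:: f; l; r] ->
  a \in X -> a \in f -> pmatch e (X :\ a) pi ->
  (forall m, pmatch e (X :\ a) m -> {in X :\ a, m =1 pi}) ->
  exists t, blob e t X f l r.
Proof.
elim: n X f l r a pi => [|n IH] X f l r a pi sz cX uX aX af piY unY.
  by move: sz; rewrite leqn0 cards_eq0 => /eqP X0; rewrite X0 inE in aX.
have fX : f \in cut X by rewrite cX !inE eqxx.
have fa : f \in star a by rewrite inE (cut_edge fX) af.
case: (eqVneq (X :\ a) set0) => [Y0|Y0].
  exists Leaf; exists a; have eX : X = [set a] by rewrite -(setD1K aX) Y0 setU0.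
  by split=> //; rewrite -cut1 // -eX.
have [S [b [SY bS pbR only]]] := kotzig e_sym e_irr piY unY Y0.
set Y := X :\ a in Y0 SY pbR only piY unY; set R := Y :\: S in pbR only.
set g := [set b; pi b].
have bY := subsetP SY b bS; have [pibY pib bpb] := piY b bY.
have [p [q [npq eqpq]]] : exists p q, p != q /\ star a :\ f = [set p; q].
  have /eqP := cardsD1 f (star a); rewrite fa card_star3 eq_sym eqSS => /cards2P[p [q [npq ->]]].
  by exists p, q.
have sa : star a = [set f; p; q] by rewrite -setUA -eqpq setD1K.
have RY : R \subset Y by exact: subsetDl.
have dSR : [disjoint S & R].
  by rewrite -setI_eq0; apply/eqP/setP=> x; rewrite !inE; case: (x \in S).
have eYSR : Y = S :|: R.
  apply/setP=> x; rewrite in_setU [x \in R]in_setD.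
  by case: (boolP (x \in S)) => //= /(subsetP SY) ->.
have aY : a \notin Y by rewrite !inE eqxx.
have eX : X = a |: (S :|: R) by rewrite -eYSR setD1K.
have gS : g \in cut S.
  by rewrite set2_cut // bpb bS; have := disjointFl dSR pbR => ->.
have gR : g \in cut R.
  by rewrite set2_cut // bpb pbR; have := disjointFr dSR bS => ->.
have onlyg x y : x \in S -> y \in R -> e x y -> [set x; y] = g.
  by move=> xS yR xy; have [-> ->] := only x y xS yR xy.
have sS := cut_piece cX af aX sa SY onlyg.
have sR : {subset cut R <= [:: g; p; q; l; r]}.
  apply: (cut_piece cX af aX sa RY) => x y xR; rewrite !inE => /andP[nyR yY] xy.
  have yS : y \in S.
    by move: nyR; rewrite yY andbT negbK.
  by rewrite setUC; apply: onlyg => //; rewrite e_sym.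
have SRg E : E \in cut S -> E \in cut R -> E = g.
  move=> ES ER; case/edge_ex: (cut_edge ES) => // x [y [xy _ eqE]].
  move: ES ER; rewrite eqE !set2_cut // xy /=.
  have dx := disjoint_and x dSR; have dy := disjoint_and y dSR.
  case: (boolP (x \in S)) => xS; case: (boolP (y \in S)) => yS // _.
    by rewrite (disjointFr dSR xS) => yR; exact: onlyg.
  by rewrite (disjointFr dSR yS) addbF => xR; rewrite setUC; apply: onlyg => //; rewrite e_sym.
have [y0 y0X] : exists y, y \notin X.
  case/edge_ex: (cut_edge fX) => // x [y [xy _ eqf]].
  move: fX; rewrite eqf set2_cut // xy /=.
  by case: (boolP (x \in X)) => [_|nx _]; [exists y | exists x].
(* If one side received both [p] and [q], adding [a] to it would leave a cut contained in [f] and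
   [g]. *)
have no2 Z : Z \subset Y -> cut Z = [set g; p; q] -> False.
  move=> ZY cZ; have daZ : [disjoint [set a] & Z].
    by rewrite disjoints1; apply: contra aY => /(subsetP ZY).
  have : 3 <= #|cut (a |: Z)|.
    apply: card_cut_ge3; first by apply/set0Pn; exists a; rewrite !inE eqxx.
    apply: contra y0X => /eqP eT; have : y0 \in a |: Z by rewrite eT inE.
    by rewrite !inE => /orP[/eqP-> //|/(subsetP ZY)]; rewrite !inE => /andP[].
  suff sub : cut (a |: Z) \subset [set f; g].
    by move=> h; have := leq_trans h (subset_leq_card sub); rewrite cards2; case: (_ != _).
  apply/subsetP => E; rewrite in_cutU // cut1 // sa cZ !inE.
  by do 4!case: (E == _).
pose A := cut S :\ g; pose B := cut R :\ g.
have g0 (Z : {set T}) z : z \in Z -> Z \subset Y -> 2 <= #|cut Z :\ g|.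
  move=> zZ ZY; have : 3 <= #|cut Z|.
    apply: card_cut_ge3; first by apply/set0Pn; exists z.
    apply: contra aY => /eqP eT; by apply: (subsetP ZY); rewrite eT inE.
  rewrite (cardsD1 g); case: (g \in cut Z) => //; exact: ltnW.
have A2 := g0 S b bS SY; have B2 := g0 R _ pbR RY; rewrite -/A in A2; rewrite -/B in B2.
pose D := [:: p; q; l; r].
have sA : {subset A <= D}.
  by move=> E; rewrite in_setD1 => /andP[ng /sS]; rewrite in_cons (negPf ng).
have sB : {subset B <= D}.
  by move=> E; rewrite in_setD1 => /andP[ng /sR]; rewrite in_cons (negPf ng).
have dAB : A :&: B = set0.
  apply/setP=> E; rewrite in_setI !in_setD1 in_set0; apply/negP => /andP[/andP[ng h1] /andP[_ h2]].
  by rewrite (SRg _ h1 h2) eqxx in ng.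
have cAB : #|A :|: B| = #|A| + #|B| by rewrite cardsU dAB cards0 subn0.
have sAB : #|A :|: B| <= #|D|.
  by apply/subset_leq_card/subsetP => E; rewrite in_setU => /orP[/sA|/sB].
(* At least four distinct edges occur among the four entries of [D], which also proves these entries
   distinct. *)
have uD : uniq D.
  apply/card_uniqP/eqP; rewrite eqn_leq card_size /=.
  by apply: leq_trans sAB; rewrite cAB (leq_add A2 B2).
have cD : #|D| = 4 by rewrite (card_uniqP uD).
have A22 : #|A| = 2 by move: A2 B2 sAB; rewrite cAB cD; clear; lia.
have eB E : E \in D -> (E \in B) = (E \notin A).
  have /subset_cardP h : #|A :|: B| = #|D|.
    by move: A2 B2 sAB; rewrite cAB cD; clear; lia.
  have {}h : A :|: B =i D by apply: h; apply/subsetP => F; rewrite in_setU => /orP[/sA|/sB].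
  rewrite -h in_setU; have := congr1 (fun Q : {set {set T}} => E \in Q) dAB; rewrite in_setI in_set0.
  by case: (E \in A); case: (E \in B).
have bits := card_count uD sA; rewrite A22 /= addn0 in bits.
have inA E : (E \in cut S) = [|| E == g, (E == p) && (p \in A), (E == q) && (q \in A),
     (E == l) && (l \in A) | (E == r) && (r \in A)].
  case: (eqVneq E g) => [->|ng] /=; first by rewrite gS.
  have -> : (E \in cut S) = (E \in A) by rewrite in_setD1 ng.
  apply/idP/idP => [h|]; last by case/or4P => /andP[/eqP->].
  by have := sA E h; rewrite /D !in_cons in_nil orbF => /or4P[] /eqP <-; rewrite eqxx h ?orbT.
have inB E : (E \in cut R) = [|| E == g, (E == p) && (p \notin A), (E == q) && (q \notin A),
     (E == l) && (l \notin A) | (E == r) && (r \notin A)].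
  case: (eqVneq E g) => [->|ng] /=; first by rewrite gR.
  have -> : (E \in cut R) = (E \in B) by rewrite in_setD1 ng.
  apply/idP/idP => [h|]; last by case/or4P => /andP[/eqP->]; rewrite eB // !inE eqxx ?orbT.
  have ED := sB E h; move: h; rewrite eB // => h.
  by move: ED; rewrite /D !in_cons in_nil orbF => /or4P[] /eqP <-; rewrite eqxx h ?orbT.
have gY x : x \in g -> x \in Y.
  by case/set2P => ->.
have gX : g \in inner X.
  by rewrite set2_inner // bpb; have := bY; have := pibY; rewrite !inE => /andP[_ ->] /andP[_ ->].
have ng E : E \in [set f; l; r] -> E != g.
  by rewrite -cX; apply: contraTneq => ->; rewrite (inner_cut gX).
have ngs E : E \in star a -> E != g.
  by apply: contraTneq => ->; rewrite inE negb_and; apply/orP; right; apply: contra aY; apply: gY.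
have nf E : E \in [set p; q] -> f != E.
  by rewrite -eqpq in_setD1 eq_sym => /andP[].
have u6 : uniq [:: f; l; r; g; p; q].
  have := uD; rewrite /= !inE !negb_or => /and4P[/and3P[_ pl pr] /andP[ql qr] lr _].
  have := uX; rewrite /= !inE negb_or => /andP[/andP[-> ->] _].
  have [fg lg rg] : [/\ f != g, l != g & r != g] by split; apply: ng; rewrite !inE eqxx ?orbT.
  have [pg qg] : p != g /\ q != g by split; apply: ngs; rewrite sa !inE eqxx ?orbT.
  have [fp fq] : f != p /\ f != q by split; apply: nf; rewrite !inE eqxx ?orbT.
  rewrite (eq_sym l p) (eq_sym l q) (eq_sym r p) (eq_sym r q) (eq_sym g p) (eq_sym g q).
  by rewrite pl pr ql qr lr npq fg lg rg pg qg fp fq.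
have szS : #|S| <= n /\ #|R| <= n.
  have szY : #|Y| <= n by rewrite -ltnS; apply: leq_trans sz; rewrite (cardsD1 a X) aX.
  by split; [apply: leq_trans (subset_leq_card SY) szY | apply: leq_trans (subset_leq_card RY) szY].
have IHS l' r' : cut S = [set g; l'; r'] -> uniq [:: g; l'; r'] -> exists t, blob e t S g l' r'.
  move=> cS u3; have [||h1 h2] := pmatch_sub piY unY (Z := S :\ b).
  - exact: subset_trans (subsetDl _ _) SY.
  - move=> x; rewrite !in_setD1 => /andP[xb xS]; have xY := subsetP SY x xS.
    have [pxY pp xpx] := piY x xY; apply/andP; split.
      apply: contraNneq xb => eq; move: pbR; rewrite -eq pp.
      by rewrite (disjointFr dSR xS).
    apply: contraNT xb => pxS; have pR : pi x \in R.
      by have : pi x \in S :|: R; [rewrite -eYSR | rewrite in_setU (negPf pxS)].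
    by rewrite (only _ _ xS pR xpx).1.
  apply: (IH S g l' r' b pi szS.1 cS u3 bS _ h1 h2).
  by rewrite !inE eqxx.
have IHR l' r' : cut R = [set g; l'; r'] -> uniq [:: g; l'; r'] -> exists t, blob e t R g l' r'.
  move=> cR u3; have [||h1 h2] := pmatch_sub piY unY (Z := R :\ pi b).
  - exact: subset_trans (subsetDl _ _) RY.
  - move=> x; rewrite !in_setD1 => /andP[xb xR]; have xY := subsetP RY x xR.
    have [pxY pp xpx] := piY x xY; apply/andP; split.
      apply: contraNneq xb => eq; have [_ ppb _] := piY b bY; rewrite -ppb -eq pp in bS.
      by have := disjointFr dSR bS; rewrite xR.
    apply: contraNT xb => pxS; have pS : pi x \in S.
      by have : pi x \in S :|: R; [rewrite -eYSR | rewrite in_setU (negPf pxS) orbF].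
    by rewrite (only (pi x) x pS xR _).2 // e_sym.
  apply: (IH R g l' r' (pi b) pi szS.2 cR u3 pbR _ h1 h2).
  by rewrite !inE eqxx orbT.
have comb ZL ZR p' q' : Y = ZL :|: ZR -> [disjoint ZL & ZR] ->
    (forall l' r', cut ZL = [set g; l'; r'] -> uniq [:: g; l'; r'] -> exists t, blob e t ZL g l' r') ->
    (forall l' r', cut ZR = [set g; l'; r'] -> uniq [:: g; l'; r'] -> exists t, blob e t ZR g l' r') ->
    star a = [set f; p'; q'] -> uniq [:: f; l; r; g; p'; q'] ->
    cut ZL = [set g; l; p'] -> cut ZR = [set g; q'; r] -> exists t, blob e t X f l r.
  move=> eYZ dZ hL hR sa' u' cL cR; have u6' := uniq6_neq u'.
  have [tl bL] : exists t, blob e t ZL g l p' by apply: hL; rewrite //= !inE !u6'.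
  have [tr bR] : exists t, blob e t ZR g q' r by apply: hR; rewrite //= !inE !u6'.
  exists (Node tl tr); exists a, ZL, ZR, g, p', q'; split; split=> //; rewrite -eYZ //.
  by rewrite setD1K.
have u6' : uniq [:: f; l; r; g; q; p].
  rewrite -(@eq_uniq _ [:: f; l; r; g; p; q]) // => E; rewrite !inE.
  by rewrite (orbC (E == p)).
have sa' : star a = [set f; q; p] by rewrite sa set3_rot.
have eYRS : Y = R :|: S by rewrite setUC.
have dRS : [disjoint R & S] by rewrite disjoint_sym.
(* Of the six ways to give two of [p], [q], [l], [r] to [S], the two that keep [p] and [q] together
   are excluded by [no2]. In the other four, the side with [l] is the left child, and the one of [p]
   and [q] on that side becomes its third edge. *)
case pA: (p \in A) bits; case qA: (q \in A); case lA: (l \in A); case rA: (r \in A) => //= _.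
- case: (no2 S SY); apply/setP=> E; rewrite inA pA qA lA rA !inE !andbT !andbF !orbF.
  by rewrite orbA.
- apply: (comb S R p q) => //; apply/setP=> E; rewrite ?inA ?inB pA qA lA rA !inE !andbT !andbF ?orbF /=;
    by case: (E == g); case: (E == p); case: (E == q); case: (E == l); case: (E == r).
- apply: (comb R S q p) => //; apply/setP=> E; rewrite ?inA ?inB pA qA lA rA !inE !andbT !andbF ?orbF /=;
    by case: (E == g); case: (E == p); case: (E == q); case: (E == l); case: (E == r).
- apply: (comb S R q p) => //; apply/setP=> E; rewrite ?inA ?inB pA qA lA rA !inE !andbT !andbF ?orbF /=;
    by case: (E == g); case: (E == p); case: (E == q); case: (E == l); case: (E == r).
- apply: (comb R S p q) => //; apply/setP=> E; rewrite ?inA ?inB pA qA lA rA !inE !andbT !andbF ?orbF /=;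
    by case: (E == g); case: (E == p); case: (E == q); case: (E == l); case: (E == r).
case: (no2 R RY); apply/setP=> E; rewrite inB pA qA lA rA !inE !andbT !andbF !orbF.
by rewrite orbA.
Qed.

End BlobExistence.

(** * From a lonely edge to a closed blob *)

Section ClosedBlobs.
Variables (T : finType) (e : rel T).
Hypothesis e_sym : symmetric e.
Hypothesis e_irr : irreflexive e.
Implicit Types (M : {set {set T}}) (f : {set T}).

Lemma perfect_matchingP M : reflect
  (M \subset edge_set e /\ forall x : T, exists2 f, f \in M & x \in f /\
     forall f', f' \in M -> x \in f' -> f' = f)
  (perfect_matching e M).
Proof.
apply: (iffP andP) => -[sM h]; split=> //.
  move=> x; have /cards1P[f eqf] := forallP h x.
  have : f \in [set f] by rewrite inE.
  rewrite -eqf inE => /andP[fM xf]; exists f => //; split=> // f' f'M xf'.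
  by apply/set1P; rewrite -eqf inE f'M.
apply/forallP => x; have [f fM [xf hf]] := h x; apply/cards1P; exists f.
by apply/setP=> f'; rewrite !inE; apply/andP/eqP => [[/hf h' /h']|->].
Qed.

Lemma partner_exists M : perfect_matching e M -> exists pi : T -> T,
  forall x y, ([set x; y] \in M) = (y == pi x).
Proof.
case/perfect_matchingP => /subsetP sM hM.
suff h : forall x, exists y, forall z, ([set x; z] \in M) = (z == y) by exact: fin_all_exists h.
move=> x; have [f fM [xf hf]] := hM x.
have : f \in star e x by rewrite inE sM.
case/starP => // y xy eqf; exists y => z; apply/idP/eqP => [h|->]; last by rewrite -eqf.
have := hf _ h; rewrite !inE eqxx => /(_ isT) eq.
have : z \in f by rewrite -eq !inE eqxx orbT.
rewrite eqf !inE => /orP[/eqP zx|/eqP //].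
by have := sM _ h; rewrite set2_edge // zx e_irr.
Qed.

(** A matching of the graph without the two ends [u] and [v] of [f] extends by [f] to a perfect
    matching, so loneliness gives the uniqueness that Kotzig's theorem needs. *)
Lemma closed_blob_exists f : cubic e -> three_connected e -> lonely e f ->
  exists t, closed_blob e t.
Proof.
move=> cub conn3 /andP[fE /cards1P[M eqM]].
have : M \in [set M] by rewrite inE.
rewrite -eqM inE => /andP[pM fM].
have [pi piP] := partner_exists pM; have [/subsetP sM hM] := perfect_matchingP _ pM.
case/edge_ex: (fE) => // u [v [uv nuv eqf]].
have piE x : [set x; pi x] \in M by rewrite piP.
have exp x : e x (pi x) by rewrite -set2_edge // sM.
have pp x : pi (pi x) = x by apply/esym/eqP; rewrite -piP setUC piE.
have piu : pi u = v by apply/esym/eqP; rewrite -piP -eqf.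
have piv : pi v = u by rewrite -piu pp.
pose X := ~: [set v].
have cX : cut e X = star e v by rewrite cutC // cut1.
have fv : f \in star e v by rewrite inE fE eqf !inE eqxx orbT.
have [l [r [nlr eqlr]]] : exists l r, l != r /\ star e v :\ f = [set l; r].
  have /eqP := cardsD1 f (star e v); rewrite fv card_star3 // eq_sym eqSS => /cards2P[l [r [nlr ->]]].
  by exists l, r.
have sv : star e v = [set f; l; r] by rewrite -setUA -eqlr setD1K.
have uX : uniq [:: f; l; r].
  have nf E : E \in [set l; r] -> f != E by rewrite -eqlr in_setD1 eq_sym => /andP[].
  by rewrite /= !inE negb_or nlr !nf // !inE eqxx ?orbT.
have uX' : u \in X by rewrite !inE.
have Yin x : (x \in X :\ u) = (x != u) && (x != v) by rewrite !inE.
have piY : pmatch e (X :\ u) pi.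
  move=> x; rewrite !Yin => /andP[xu xv]; split=> //.
  apply/andP; split; first by apply: contraNneq xv => eq; rewrite -(pp x) eq piu.
  by apply: contraNneq xu => eq; rewrite -(pp x) eq piv.
have unY m : pmatch e (X :\ u) m -> {in X :\ u, m =1 pi}.
  move=> hm; pose M' := f |: [set [set x; m x] | x in X :\ u].
  have eM : M' = M.
    apply/set1P; rewrite -eqM inE setU11 andbT; apply/perfect_matchingP; split.
      apply/subsetP => E /setU1P[->|/imsetP[x xY ->]] //.
      by rewrite set2_edge //; case: (hm x xY).
    have nofY x E : x \notin X :\ u -> E \in M' -> x \in E -> E = f.
      move=> xY /setU1P[//|/imsetP[y yY ->]] /set2P[xy|xy]; first by rewrite xy yY in xY.
      by have [h _ _] := hm y yY; rewrite -xy (negPf xY) in h.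
    have nf x : x \in X :\ u -> x \notin f by rewrite Yin eqf !inE negb_or.
    move=> x; case: (boolP (x \in X :\ u)) => [xY|xY].
      exists [set x; m x]; first by apply/setU1P; right; exact: imset_f.
      split=> [|E /setU1P[->|/imsetP[y yY ->]]]; first by rewrite !inE eqxx.
        by rewrite (negPf (nf x xY)).
      case/set2P=> -> //; have [_ h _] := hm y yY.
      by rewrite h setUC.
    exists f; first exact: setU11.
    split; last by move=> E; exact: nofY.
    by move: xY; rewrite Yin eqf !inE negb_and !negbK.
  move=> x xY; apply/eqP; rewrite -piP -eM; apply/setU1P; right; exact: imset_f.
have cXs : cut e X = [set f; l; r] by rewrite cX.
have uf : u \in f by rewrite eqf !inE eqxx.
have [t bt] := blob_exists e_sym e_irr cub conn3 (leqnn #|X|) cXs uX uX' uf piY unY.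
by exists t, v, f, l, r.
Qed.

Lemma closed_blob_mirror t : closed_blob e t -> closed_blob e (mirror t).
Proof. by case=> v [f [l [r b]]]; exists v, f, r, l; exact: blob_mirror. Qed.

Lemma star_closed t v f l r : blob e t (~: [set v]) f l r -> star e v = [set f; l; r].
Proof. by move=> b; have [<- _ _] := blob_cut e_sym e_irr b; rewrite cutC // cut1. Qed.

(* Either end of the distinguished edge may serve as the vertex left out of the blob. *)
Lemma closed_blob_flip tl tr : closed_blob e (Node tl tr) ->
  closed_blob e (Node (mirror tl) (mirror tr)).
Proof.
case=> v [f [l [r b]]]; have sv := star_closed b; case: b.
move=> a [XL [XR [g [p [q [[eX aX dLR] [sa u bL bR]]]]]]].
have va : v != a.
  have : a \in ~: [set v] by rewrite eX !inE eqxx.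
  by rewrite !inE eq_sym.
have vLR : v \notin XL :|: XR.
  have : v \notin ~: [set v] by rewrite !inE eqxx.
  by rewrite eX in_setU1 negb_or => /andP[].
exists a, f, p, q, v, XL, XR, g, l, r; split; split=> //.
- apply/setP=> x; have := congr1 (fun A : {set T} => x \in A) eX.
  move: vLR aX; rewrite !inE !negb_or; case: (eqVneq x a) => [->|xa].
    by rewrite !(eq_sym a) (negPf va) /= => _ /andP[/negPf -> /negPf ->].
  by case: (eqVneq x v) => [->|xv] //= _ _ <-.
- rewrite -(@eq_uniq _ [:: f; l; r; g; p; q]) // => E; rewrite !inE.
  by do 6!case: (E == _).
- exact: blob_mirror.
exact: blob_mirror.
Qed.

End ClosedBlobs.

(** * Connectivity of closed blobs *)

Section Connectivity.
Variables (T : finType) (e : rel T).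
Hypothesis e_sym : symmetric e.
Hypothesis e_irr : irreflexive e.
Implicit Types (x y z : T) (f E : {set T}) (A B X Y Z S W : {set T}).

Notation star := (star e).
Notation cut := (cut e).
Notation inner := (inner e).

Lemma card_uniq3 (U : finType) (x y z : U) : uniq [:: x; y; z] -> #|[set x; y; z]| = 3.
Proof.
move=> u; rewrite -[RHS]/(size [:: x; y; z]) -(card_uniqP u).
by apply: eq_card => w; rewrite !inE orbA.
Qed.

Lemma blob_card_star t X f l r x : blob e t X f l r -> x \in X -> #|star x| = 3.
Proof.
elim: t X f l r => [|tl IHl tr IHr] X f l r /=.
  by case=> y [-> sy u]; rewrite inE => /eqP ->; rewrite sy card_uniq3.
case=> a [XL [XR [g [p [q [[-> aX dLR] [sa u bL bR]]]]]]].
rewrite !inE => /or3P[/eqP->|/(IHl _ _ _ _ bL) //|/(IHr _ _ _ _ bR) //].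
rewrite sa card_uniq3 //; have u6 := uniq6_neq u; by rewrite /= !inE !u6.
Qed.

Lemma closed_blob_cubic t : closed_blob e t -> cubic e.
Proof.
case=> v [f [l [r b]]] x; rewrite -card_star //.
case: (boolP (x \in ~: [set v])) => [|]; first exact: blob_card_star b.
rewrite !inE negbK => /eqP ->; rewrite (star_closed e_sym e_irr b) card_uniq3 //.
by have [_ h _] := blob_cut e_sym e_irr b.
Qed.

Section Colouring.
Variable S : {set T}.

(* For an edge of the cut of X, tells whether its end in X lies in S. *)
Definition side X E := [exists x, [&& x \in X, x \in E & x \in S]].

Lemma side_edge X x y : x \in X -> y \notin X -> side X [set x; y] = (x \in S).
Proof.
move=> xX yX; apply/existsP/idP => [[z /and3P[zX]]|xS]; last first.
  by exists x; rewrite xX xS !inE eqxx.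
by rewrite !inE => /orP[/eqP->|/eqP zy] // _; rewrite -zy zX in yX.
Qed.

Lemma cut_ends X E : E \in cut X -> exists x y, [/\ e x y, x \in X, y \notin X & E = [set x; y]].
Proof.
move=> EX; case/edge_ex: (cut_edge EX) => // x [y [xy _ eqE]].
move: EX; rewrite eqE set2_cut // xy /=; case: (boolP (x \in X)) => xX.
  by move=> yX; exists x, y; split.
by move=> yX; exists y, x; rewrite e_sym setUC; split; rewrite // -addFb.
Qed.

Lemma side_meet A B E : [disjoint A & B] -> E \in cut A -> E \in cut B ->
  (E \in cut S) = side A E (+) side B E.
Proof.
move=> dAB EA EB; have [x [y [xy xA yA eqE]]] := cut_ends EA.
have yB : y \in B.
  by move: EB; rewrite eqE set2_cut // xy (disjointFr dAB xA).
have xB : x \notin B by rewrite (disjointFr dAB xA).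
by rewrite eqE set2_cut // xy side_edge // setUC side_edge.
Qed.

Lemma sideU A B E : E \in cut A -> E \notin cut B -> [disjoint A & B] ->
  side (A :|: B) E = side A E.
Proof.
move=> EA EB dAB; have [x [y [xy xA yA eqE]]] := cut_ends EA.
have xB : x \notin B by rewrite (disjointFr dAB xA).
have yB : y \notin B by move: EB; rewrite eqE set2_cut // xy (negPf xB).
by rewrite eqE !side_edge // ?inE ?xA ?negb_or ?yA.
Qed.

Lemma side1 a E : E \in star a -> side [set a] E = (a \in S).
Proof.
case/starP => // y ay ->; rewrite side_edge ?inE //.
by rewrite eq_sym (edge_neq e_irr ay).
Qed.

Lemma side_mono X E (b : bool) : E \in cut X -> (forall x, x \in X -> (x \in S) = b) -> side X E = b.
Proof.
by move=> EX hX; have [x [y [xy xX yX ->]]] := cut_ends EX; rewrite side_edge // hX.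
Qed.

Definition ncut X := \sum_(E in inner X) (E \in cut S : nat).

Lemma ncut_mono X b : (forall x, x \in X -> (x \in S) = b) -> ncut X = 0.
Proof.
move=> hX; apply: big1 => E EX; case/edge_ex: (inner_edge EX) => // x [y [xy _ eqE]].
by move: EX; rewrite eqE set2_inner // set2_cut // => /and3P[_ /hX -> /hX ->]; rewrite addbb andbF.
Qed.

(** Think of the outside of [X] as contracted to one vertex, lying in [S] exactly when [m] holds: a
    set [S] that splits [X] still cuts three edges. Both values of [m] are needed, because what
    surrounds a child may itself be split by [S]. *)
Lemma blob_ncut t X f l r : blob e t X f l r ->
  (exists b, forall x, x \in X -> (x \in S) = b) \/
  (forall m : bool, 3 <= ncut X + (side X f (+) m) + (side X l (+) m) + (side X r (+) m)).
Proof.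
elim: t X f l r => [|tl IHl tr IHr] X f l r /=.
  by case=> x [-> _ _]; left; exists (x \in S) => y; rewrite inE => /eqP ->.
case=> a [XL [XR [g [p [q [[-> aX dLR] [sa u bL bR]]]]]]].
have [cL _ _] := blob_cut e_sym e_irr bL; have [cR _ _] := blob_cut e_sym e_irr bR.
have [[m1 m2 m3 m4] _] := node_meet e_sym e_irr aX dLR sa u cL cR.
have [cX cLR _ _] := node_cut e_sym e_irr aX dLR sa u cL cR.
have da : [disjoint [set a] & XL :|: XR] by rewrite disjoints1.
have u6 := uniq6_neq u; have c1 := cut1 e_sym e_irr a.
have pq : p \notin [set q] by rewrite inE u6.
have eN : ncut (a |: (XL :|: XR)) = (side XL p (+) (a \in S)) + (side XR q (+) (a \in S))
    + (side XL g (+) side XR g) + ncut XL + ncut XR.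
  rewrite {1}/ncut sum_innerU // inner1 // big_set0 add0n sum_innerU // m1 m2.
  rewrite big_set1 big_setU1 //= big_set1 -/(ncut XL) -/(ncut XR).
  have [gL pL gR qR] : [/\ g \in cut XL, p \in cut XL, g \in cut XR & q \in cut XR].
    by rewrite cL cR !inE !eqxx !orbT.
  have [pa qa] : p \in star a /\ q \in star a by rewrite sa !inE !eqxx !orbT.
  rewrite (@side_meet XL XR g) //.
  have daL : [disjoint XL & [set a]].
    by rewrite disjoint_sym disjoints1; apply: contra aX => h; rewrite inE h.
  have daR : [disjoint XR & [set a]].
    by rewrite disjoint_sym disjoints1; apply: contra aX => h; rewrite inE h orbT.
  rewrite (@side_meet XL [set a] p) ?c1 //.
  rewrite (@side_meet XR [set a] q) ?c1 //.
  by rewrite !side1 //; clear; lia.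
have sf : side (a |: (XL :|: XR)) f = (a \in S).
  by rewrite sideU ?side1 ?c1 ?sa ?cLR ?inE ?eqxx ?u6.
have sl : side (a |: (XL :|: XR)) l = side XL l.
  rewrite setUC sideU ?c1 ?sa ?cLR ?inE ?eqxx ?u6 //; last by rewrite disjoint_sym.
  by rewrite sideU // ?cL ?cR ?inE ?eqxx ?u6.
have sr : side (a |: (XL :|: XR)) r = side XR r.
  rewrite setUC sideU ?c1 ?sa ?cLR ?inE ?eqxx ?u6 ?orbT //; last by rewrite disjoint_sym.
  by rewrite setUC sideU // ?cL ?cR ?inE ?eqxx ?u6 ?orbT // disjoint_sym.
have monoL b : (forall x, x \in XL -> (x \in S) = b) ->
   [/\ ncut XL = 0, side XL g = b, side XL l = b & side XL p = b].
  by move=> h; split; [exact: ncut_mono h | | | ]; apply: side_mono h; rewrite cL !inE eqxx ?orbT.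
have monoR b : (forall x, x \in XR -> (x \in S) = b) ->
   [/\ ncut XR = 0, side XR g = b, side XR q = b & side XR r = b].
  by move=> h; split; [exact: ncut_mono h | | | ]; apply: side_mono h; rewrite cR !inE eqxx ?orbT.
case: (IHl _ _ _ _ bL) => [[b hb]|hL]; case: (IHr _ _ _ _ bR) => [[c hc]|hR].
- case: (boolP ((b == c) && (b == (a \in S)))) => [/andP[/eqP bc /eqP ba]|ne].
    left; exists b => x; rewrite !inE => /or3P[/eqP->|/hb|/hc] //; by rewrite bc.
  right=> m; rewrite eN sf sl sr; case: (monoL b hb) => -> -> -> ->; case: (monoR c hc) => -> -> -> ->.
  by move: ne; case: (a \in S); case: b {hb}; case: c {hc}; case: m.
- right=> m; rewrite eN sf sl sr; case: (monoL b hb) => -> -> -> ->.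
  have := hR true; have := hR false.
  case: (side XR g); case: (side XR q); case: (side XR r); case: (a \in S); case: b {hb}; case: m;
    rewrite /= ?addn0; clear; lia.
- right=> m; rewrite eN sf sl sr; case: (monoR c hc) => -> -> -> ->.
  have := hL true; have := hL false.
  case: (side XL g); case: (side XL l); case: (side XL p); case: (a \in S); case: c {hc}; case: m;
    rewrite /= ?addn0; clear; lia.
right=> m; rewrite eN sf sl sr.
have := hL m; have := hR m; have := hL (a \in S); have := hR (a \in S).
have := hL (~~ m); have := hR (~~ m).
case: (side XL g); case: (side XR g); case: (side XL l); case: (side XL p); case: (side XR q);
  case: (side XR r); case: (a \in S); case: m; rewrite /= ?addn0; clear; lia.
Qed.

(** Here the outside really is the one vertex [v]. If [S] does not split the blob, it isolates [v],
    and the three edges at [v] are cut. *)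
Lemma closed_cut_ge3 t : closed_blob e t -> S != set0 -> S != setT -> 3 <= #|cut S|.
Proof.
case=> v [f [l [r b]]] S0 ST; have sv := star_closed e_sym e_irr b.
have [cX uX _] := blob_cut e_sym e_irr b.
set X := ~: [set v] in b cX *.
have dX : [disjoint X & [set v]] by rewrite -setI_eq0 setIC setICr.
have -> : #|cut S| = ncut X + (side X f (+) (v \in S)) + (side X l (+) (v \in S))
   + (side X r (+) (v \in S)).
  have -> : #|cut S| = \sum_(E in inner (X :|: [set v])) (E \in cut S : nat).
    rewrite setUC setUCr -sum1_card big_mkcond [RHS]big_mkcond; apply: eq_bigr => E _.
    rewrite !inE subsetT andbT; case: (E \in edge_set e) => //=; by case: ifP.
  have sE E : E \in cut X -> (E \in cut S : nat) = (side X E (+) (v \in S)).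
    move=> EX; have Ev : E \in star v by rewrite sv -cX.
    by rewrite (side_meet dX) ?cut1 // side1.
  rewrite sum_innerU // [inner [set v]]inner1 // big_set0 addn0 cut1 // sv cX setIid -!addnA.
  congr (_ + _); move: uX; rewrite /= !inE negb_or => /andP[/andP[fl fr] /andP[lr _]].
  rewrite -setUA big_setU1 /=; last by rewrite !inE negb_or fl.
  rewrite big_setU1 /=; last by rewrite inE.
  rewrite big_set1.
  by rewrite !sE ?cX ?inE ?eqxx ?orbT.
case: (blob_ncut b) => [[c hc]|]; last exact.
rewrite !(@side_mono X _ c) ?cX ?inE ?eqxx ?orbT //.
have vS : (v \in S) = ~~ c.
  apply/idP/idP => [vS|nc].
    apply: contra ST => cT; apply/eqP/setP=> x; rewrite inE.
    by case: (eqVneq x v) => [->|xv] //; rewrite hc ?cT // !inE xv.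
  apply: contraT => vS; case/set0Pn: S0 => x xS; case: (eqVneq x v) => [eq|xv].
    by rewrite -eq xS in vS.
  by rewrite (hc x) ?(negPf nc) ?inE // in xS; rewrite !inE.
by rewrite vS; case: (c); rewrite -!addnA; exact: leq_addl.
Qed.

End Colouring.
End Connectivity.

(** * From edge cuts to vertex connectivity *)

Section ThreeConnected.
Variables (T : finType) (e : rel T).
Hypothesis e_sym : symmetric e.
Hypothesis e_irr : irreflexive e.
Implicit Types (x y z : T) (f E : {set T}) (A B X Y Z S W : {set T}).

Notation star := (star e).
Notation cut := (cut e).

(** In a cubic graph each vertex of a separator sends at most one edge to one of the two sides, so a
    separator of at most two vertices can be traded for a cut of at most two edges. *)
Lemma cubic_cut3_connected : cubic e -> 3 < #|T| ->
  (forall S, S != set0 -> S != setT -> 3 <= #|cut S|) -> three_connected e.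
Proof.
move=> cub T4 cut3.
have ar1 m n : 1 < m -> m + n <= 3 -> n <= 1 by clear; lia.
have ar2 m n : 1 < m -> m + n <= 2 -> n = 0 by clear; lia.
have ar3 m n k : 3 <= m + n + k -> m <= 1 -> n <= 1 -> k <= 1 -> 0 < k /\ (m = 0 \/ n = 0 -> False).
  by clear; lia.
split=> // X X2 x y xX yX.
set R := (fun a b => _); apply: contraT => nxy.
pose S0 := [set z | connect R x z].
have xS0 : x \in S0 by rewrite inE connect0.
have yS0 : y \notin S0 by rewrite inE.
have S0X z : z \in S0 -> z \notin X.
  rewrite inE => /connectP[p]; case/lastP: p => [|p w]; first by move=> _ ->.
  by rewrite rcons_path last_rcons => /andP[_ /and3P[_ _ wX]] ->.
have step z w : z \in S0 -> e z w -> w \notin X -> w \in S0.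
  move=> zS zw wX; have zX := S0X z zS; move: zS; rewrite !inE => zS.
  by apply: connect_trans zS (connect1 _); rewrite /R zw zX wX.
pose W := ~: (S0 :|: X).
have noSW z w : z \in S0 -> w \in W -> ~~ e z w.
  move=> zS; rewrite !inE negb_or => /andP[wS wX]; apply: contra wS => zw.
  by have := step z w zS zw wX; rewrite inE.
have eX : X = set0 \/ exists z1 z2, X = [set z1; z2].
  move: X2; rewrite ltnS leq_eqVlt => /orP[/cards2P[z1 [z2 [_ ->]]]|].
    by right; exists z1, z2.
  rewrite ltnS leq_eqVlt => /orP[/cards1P[z ->]|].
    by right; exists z, z; rewrite setUid.
  by rewrite ltnS leqn0 cards_eq0 => /eqP ->; left.
(* each vertex of X is put on the side of the cut to which it sends more edges *)
pose A := [set z in X | #|star z :&: cut W| <= 1].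
pose F z := if z \in A then star z :&: cut W else star z :&: cut S0.
have bigE : cut (S0 :|: A) \subset \bigcup_(z in X) F z :|: [set E in cut A | E \subset X].
  apply/subsetP => E EC; case/edge_ex: (cut_edge EC) => // u0 [w0 [uw0 _ eqE0]].
  have [u [w [uw uS wS eqE]]] := cut_ends e_sym e_irr EC.
  have wW : w \notin S0 by apply: contra wS => h; rewrite inE h.
  have wA : w \notin A by apply: contra wS => h; rewrite inE h orbT.
  case: (boolP (u \in S0)) => uS0.
    have wX : w \in X by apply: contraNT wW => wX; exact: step uS0 uw wX.
    rewrite inE; apply/orP; left; apply/bigcupP; exists w => //; rewrite /F (negPf wA) eqE in_setI.
    by rewrite set2_star // uw eqxx orbT set2_cut // uw uS0 (negPf wW).
  have uA : u \in A by move: uS; rewrite inE (negPf uS0).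
  have uX : u \in X by move: uA; rewrite inE => /andP[].
  case: (boolP (w \in X)) => wX.
    rewrite in_setU; apply/orP; right; rewrite inE eqE set2_cut // uw uA (negPf wA) /=.
    by rewrite subUset !sub1set uX wX.
  have wWW : w \in W by rewrite !inE negb_or wX -/S0; move: wW; rewrite inE => ->.
  rewrite inE; apply/orP; left; apply/bigcupP; exists u => //; rewrite /F uA eqE in_setI.
  have uW : u \notin W by rewrite !inE uX orbT.
  by rewrite set2_star // uw eqxx set2_cut // uw wWW (negPf uW).
have star3 z : #|star z| = 3 by rewrite card_star // cub.
have disj z E : z \in X -> E \in star z -> E \in cut W -> E \notin cut S0 /\ ~~ (E \subset X).
  move=> zX Ez EW; have [w zw eqE] := starP e_sym e_irr _ _ Ez.
  have zS : z \notin S0 by apply/negP => /S0X; rewrite zX.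
  have zW : z \notin W by rewrite in_setC in_setU zX orbT.
  move: EW; rewrite eqE !set2_cut // zw (negPf zW) (negPf zS) /= in_setC in_setU negb_or.
  by case/andP=> -> wX; rewrite subUset !sub1set (negPf wX) andbF.
have disj0 z E : z \in X -> E \in star z -> E \in cut S0 -> ~~ (E \subset X).
  move=> zX Ez ES; have [w zw eqE] := starP e_sym e_irr _ _ Ez.
  have zS : z \notin S0 by apply/negP => /S0X; rewrite zX.
  move: ES; rewrite eqE !set2_cut // zw (negPf zS) /= => wS.
  by rewrite subUset !sub1set (negPf (S0X _ wS)) andbF.
have dd z : z \in X -> (star z :&: cut W) :&: (star z :&: cut S0) = set0.
  move=> zX; apply/setP=> E; rewrite !in_setI in_set0.
  apply/negP => /andP[/andP[Ez EW] /andP[_ ES]].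
  by have [h _] := disj z E zX Ez EW; rewrite ES in h.
have deg z : z \in X -> #|star z :&: cut W| + #|star z :&: cut S0| <= 3.
  move=> zX; rewrite -(star3 z) -cardsUI dd // cards0 addn0.
  by apply: subset_leq_card; rewrite subUset !subsetIl.
have deg2 z E0 : z \in X -> E0 \in star z -> E0 \subset X ->
    #|star z :&: cut W| + #|star z :&: cut S0| <= 2.
  move=> zX E0z E0X; have c2 : #|star z :\ E0| = 2.
    by have := cardsD1 E0 (star z); rewrite E0z star3 => -[].
  rewrite -c2 -cardsUI dd // cards0 addn0.
  apply/subset_leq_card/subsetP => E; rewrite in_setU !in_setI in_setD1.
  case/orP=> /andP[Ez h]; rewrite Ez andbT; apply/eqP => eq.
    by have [_] := disj z E zX Ez h; rewrite eq E0X.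
  by have := disj0 z E zX Ez h; rewrite eq E0X.
have F1 z : z \in X -> #|F z| <= 1.
  move=> zX; rewrite /F; case: ifP => [|]; rewrite inE zX //=.
  by move=> /negbT; rewrite -ltnNge => h; exact: ar1 h (deg z zX).
have F0 z E0 : z \in X -> E0 \in star z -> E0 \subset X -> z \notin A -> #|F z| = 0.
  move=> zX h1 h2 zA; rewrite /F (negPf zA); move: zA; rewrite inE zX /= -ltnNge => h.
  exact: ar2 h (deg2 z E0 zX h1 h2).
have c3 : 3 <= #|cut (S0 :|: A)|.
  apply: cut3; first by apply/set0Pn; exists x; rewrite in_setU xS0.
  apply: contra yS0 => /eqP eT; have : y \in S0 :|: A by rewrite eT inE.
  by rewrite in_setU [y \in A]inE (negPf yX) orbF.
have := leq_trans c3 (subset_leq_card bigE); case: eX => [X0|[z1 [z2 eX]]].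
  rewrite X0 big_set0 set0U (_ : [set _ in _ | _] = set0) ?cards0 //.
  apply/setP=> E; rewrite !inE subset0; apply/negP => /andP[/andP[_ /andP[h _]] /eqP E0].
  by rewrite E0 set0I eqxx in h.
have z1X : z1 \in X by rewrite eX !inE eqxx.
have z2X : z2 \in X by rewrite eX !inE eqxx orbT.
have bU : \bigcup_(z in X) F z \subset F z1 :|: F z2.
  by apply/bigcupsP => z; rewrite {1}eX => /set2P[] ->; rewrite ?subsetUl ?subsetUr.
have c12 : #|\bigcup_(z in X) F z| <= #|F z1| + #|F z2|.
  by apply: leq_trans (subset_leq_card bU) _; rewrite cardsU leq_subr.
set P := [set E in _ | _].
have cU : #|\bigcup_(z in X) F z :|: P| <= #|F z1| + #|F z2| + #|P|.
  by apply: leq_trans (leq_add c12 (leqnn _)); rewrite cardsU leq_subr.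
move=> h3; have h4 := leq_trans h3 cU.
have PE E : E \in P -> [/\ E = [set z1; z2], e z1 z2 & (z1 \in A) (+) (z2 \in A)].
  rewrite inE => /andP[EA EX]; case/edge_ex: (cut_edge EA) => // u [w [uw nuw eqE]].
  move: EX EA; rewrite eqE subUset !sub1set eX set2_cut // uw => /andP[].
  case/set2P=> eu; case/set2P=> ew; rewrite eu ew ?eqxx // in uw nuw * => h; split=> //.
  - by rewrite setUC.
  - by rewrite e_sym.
  by rewrite addbC.
have P1 : #|P| <= 1.
  rewrite -(cards1 [set z1; z2]); apply/subset_leq_card/subsetP => E' /PE[-> _ _].
  by rewrite inE.
(* The count can reach 3 only if the two vertices of [X] are joined by an edge of the cut. Then the
   one outside [A] sends two edges to [W], hence none to [S0], and the count drops below 3. *)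
have [/card_gt0P[E EP] no0] := ar3 _ _ _ h4 (F1 z1 z1X) (F1 z2 z2X) P1.
have [eqE z12 zA] := PE E EP.
have EX : E \subset X by move: EP; rewrite inE => /andP[].
have E1 : E \in star z1 by rewrite eqE set2_star // z12 eqxx.
have E2 : E \in star z2 by rewrite eqE set2_star // z12 eqxx orbT.
case: no0; move: zA; case: (boolP (z1 \in A)) => z1A; case: (boolP (z2 \in A)) => z2A // _.
  by right; exact: F0 E2 EX z2A.
by left; exact: F0 E1 EX z1A.
Qed.

Lemma closed_three_connected t : closed_blob e t -> three_connected e.
Proof.
move=> c; have cub := closed_blob_cubic e_sym e_irr c.
apply: cubic_cut3_connected => // [|S]; last exact: closed_cut_ge3 c.
case: c => v [f [l [r b]]]; have sv := star_closed e_sym e_irr b.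
have [_ uX _] := blob_cut e_sym e_irr b.
have sub : v |: [set y | e v y] \subset predT by exact: subset_predT.
have := subset_leq_card sub; rewrite cardsU1 inE e_irr /= cub.
by [].
Qed.

End ThreeConnected.

(** * Uniqueness *)

Section NodeAdjacency.
Variables (T : finType) (e : rel T).
Hypothesis e_sym : symmetric e.
Hypothesis e_irr : irreflexive e.

Lemma meet_adj (A B g : {set T}) x y : [disjoint A & B] -> cut e A :&: cut e B = [set g] ->
  x \in A -> y \in B -> e x y = (x \in g) && (y \in g).
Proof.
move=> dAB m xA yB; have xB := disjointFr dAB xA; have yA := disjointFl dAB yB.
have gE : g \in edge_set e.
  by have : g \in [set g] by [rewrite inE]; rewrite -m inE => /andP[/cut_edge].
apply/idP/andP => [xy|[xg yg]].
  have : [set x; y] \in [set g] by rewrite -m inE !set2_cut // xy xA yB xB yA.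
  by rewrite inE => /eqP <-; rewrite !inE !eqxx orbT.
have xy : x != y by apply: contraFneq yA => <-.
by rewrite -(set2_edge e_sym e_irr) -(edge_eq2 e_irr gE xg yg xy).
Qed.

(** Adjacency between the parts of a node is reduced to membership in [g], [p], [q], which is the
    information that the isomorphism of the children must carry. *)
Lemma node_adj t t' a XL XR f l r g p q :
  a \notin XL :|: XR -> [disjoint XL & XR] ->
  star e a = [set f; p; q] -> uniq [:: f; l; r; g; p; q] ->
  blob e t XL g l p -> blob e t' XR g q r ->
  [/\ forall x y, x \in XL -> y \in XR -> e x y = (x \in g) && (y \in g),
      forall y, y \in XL -> e a y = (y \in p) &
      forall y, y \in XR -> e a y = (y \in q)] /\
  [/\ a \in f /\ (a \notin l /\ a \notin r), forall x, x \in XL -> x \notin f /\ x \notin r &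
      forall x, x \in XR -> x \notin f /\ x \notin l].
Proof.
move=> aX dLR sa u bL bR.
have [cL _ _] := blob_cut e_sym e_irr bL; have [cR _ _] := blob_cut e_sym e_irr bR.
have [[m1 m2 m3 m4] _] := node_meet e_sym e_irr aX dLR sa u cL cR.
have daL : [disjoint [set a] & XL] by rewrite disjoints1; apply: contra aX => h; rewrite inE h.
have daR : [disjoint [set a] & XR] by rewrite disjoints1; apply: contra aX => h; rewrite inE h orbT.
have aa : a \in [set a] by rewrite inE.
have [fa pa qa] : [/\ f \in star e a, p \in star e a & q \in star e a].
  by rewrite sa !inE !eqxx !orbT.
have [af ap aq] : [/\ a \in f, a \in p & a \in q].
  by move: fa pa qa; rewrite !inE => /andP[_ ->] /andP[_ ->] /andP[_ ->].
have u6 := uniq6_neq u; have c1 := cut1 e_sym e_irr a.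
have dLa : [disjoint XL & [set a]] by rewrite disjoint_sym.
have dRa : [disjoint XR & [set a]] by rewrite disjoint_sym.
have dRL : [disjoint XR & XL] by rewrite disjoint_sym.
split; split.
- by move=> x y; apply: meet_adj.
- by move=> y yL; rewrite (meet_adj daL m4 aa yL) ap.
- by move=> y yR; rewrite (meet_adj daR m3 aa yR) aq.
- split=> //; split.
    by apply: (mem_cut_out e_sym e_irr (Y := XL) (X := [set a])); rewrite ?c1 ?sa ?cL ?inE ?eqxx ?u6 ?orbT.
  by apply: (mem_cut_out e_sym e_irr (Y := XR) (X := [set a])); rewrite ?c1 ?sa ?cR ?inE ?eqxx ?u6 ?orbT.
- move=> x xL; split.
    by apply: (mem_cut_out e_sym e_irr (Y := [set a]) (X := XL)) => //; rewrite ?c1 ?sa ?cL ?inE ?eqxx ?u6 ?orbT.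
  by apply: (mem_cut_out e_sym e_irr (Y := XR) (X := XL)) => //; rewrite ?c1 ?sa ?cL ?cR ?inE ?eqxx ?u6 ?orbT.
move=> x xR; split.
  by apply: (mem_cut_out e_sym e_irr (Y := [set a]) (X := XR)) => //; rewrite ?c1 ?sa ?cR ?inE ?eqxx ?u6 ?orbT.
by apply: (mem_cut_out e_sym e_irr (Y := XL) (X := XR)) => //; rewrite ?c1 ?sa ?cL ?cR ?inE ?eqxx ?u6 ?orbT.
Qed.

End NodeAdjacency.

Section Isomorphism.
Variables (T1 T2 : finType) (e1 : rel T1) (e2 : rel T2).
Hypothesis e1_sym : symmetric e1.
Hypothesis e1_irr : irreflexive e1.
Hypothesis e2_sym : symmetric e2.
Hypothesis e2_irr : irreflexive e2.

(** The induction must also preserve which vertices meet [f], [l] and [r], because these memberships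
    decide the adjacencies between the pieces one level up. *)
Lemma blob_iso t (X1 f1 l1 r1 : {set T1}) (X2 f2 l2 r2 : {set T2}) :
  blob e1 t X1 f1 l1 r1 -> blob e2 t X2 f2 l2 r2 ->
  exists h : T1 -> T2,
  [/\ forall x, x \in X1 -> h x \in X2, {in X1 &, injective h},
      forall y, y \in X2 -> exists2 x, x \in X1 & h x = y &
      {in X1 &, forall x y, e1 x y = e2 (h x) (h y)}] /\
  forall x, x \in X1 -> [/\ (x \in f1) = (h x \in f2), (x \in l1) = (h x \in l2) &
     (x \in r1) = (h x \in r2)].
Proof.
elim: t X1 f1 l1 r1 X2 f2 l2 r2 => [|tl IHl tr IHr] X1 f1 l1 r1 X2 f2 l2 r2 /=.
  case=> x1 [-> s1 _] [x2 [-> s2 _]]; exists (fun _ => x2); split.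
    split=> [x _|x y|y|x y]; rewrite !inE //.
    - by move=> /eqP-> /eqP->.
    - by move=> /eqP->; exists x1; rewrite ?inE.
    by move=> /eqP-> /eqP->; rewrite e1_irr e2_irr.
  have i1 E : E \in [set f1; l1; r1] -> x1 \in E by rewrite -s1 inE => /andP[].
  have i2 E : E \in [set f2; l2; r2] -> x2 \in E by rewrite -s2 inE => /andP[].
  by move=> x; rewrite inE => /eqP->; split; rewrite i1 ?i2 // !inE eqxx ?orbT.
case=> a1 [L1 [R1 [g1 [p1 [q1 [[eX1 aX1 d1] [sa1 u1 bL1 bR1]]]]]]].
case=> a2 [L2 [R2 [g2 [p2 [q2 [[eX2 aX2 d2] [sa2 u2 bL2 bR2]]]]]]].
have [hL [[mL iL sL aL] cL]] := IHl _ _ _ _ _ _ _ _ bL1 bL2.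
have [hR [[mR iR sR aR] cR]] := IHr _ _ _ _ _ _ _ _ bR1 bR2.
have [[LR1 aL1 aR1] [[af1 [al1 ar1]] oL1 oR1]] := node_adj e1_sym e1_irr aX1 d1 sa1 u1 bL1 bR1.
have [[LR2 aL2 aR2] [[af2 [al2 ar2]] oL2 oR2]] := node_adj e2_sym e2_irr aX2 d2 sa2 u2 bL2 bR2.
move: aX1 aX2; rewrite !inE !negb_or => /andP[na1L na1R] /andP[na2L na2R].
pose h x := if x == a1 then a2 else if x \in L1 then hL x else hR x.
have ha : h a1 = a2 by rewrite /h eqxx.
have hLE x : x \in L1 -> h x = hL x.
  by move=> xL; rewrite /h xL; case: eqP => // eq; rewrite -eq xL in na1L.
have hRE x : x \in R1 -> h x = hR x.
  move=> xR; rewrite /h (disjointFl d1 xR); case: eqP => // eq; by rewrite -eq xR in na1R.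
have hX x : x \in X1 -> [\/ h x = a2 /\ x = a1, h x = hL x /\ x \in L1 | h x = hR x /\ x \in R1].
  rewrite eX1 !inE => /or3P[/eqP->|xL|xR]; [constructor 1|constructor 2|constructor 3] => //.
    by rewrite hLE.
  by rewrite hRE.
have naL x : x \in L2 -> x <> a2 by move=> xL eq; rewrite -eq xL in na2L.
have naR x : x \in R2 -> x <> a2 by move=> xL eq; rewrite -eq xL in na2R.
have nLR x y : x \in L2 -> y \in R2 -> x <> y.
  by move=> xL yR eq; have := disjointFr d2 xL; rewrite eq yR.
exists h; split; first split.
- by move=> x /hX[[-> _]|[-> /mL xL]|[-> /mR xR]]; rewrite eX2 !inE ?eqxx ?xL ?xR ?orbT.
- move=> x y /hX[[-> ->]|[-> xL]|[-> xR]] /hX[[-> ->]|[-> yL]|[-> yR]] => eq //.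
  + by case: (naL (hL y)) => //; exact: mL.
  + by case: (naR (hR y)) => //; exact: mR.
  + by case: (naL (hL x)) => //; exact: mL.
  + exact: iL.
  + by case: (nLR (hL x) (hR y)); [exact: mL | exact: mR |].
  + by case: (naR (hR x)) => //; exact: mR.
  + by case: (nLR (hL y) (hR x)); [exact: mL | exact: mR |].
  exact: iR.
- move=> y; rewrite eX2 !inE => /or3P[/eqP->|yL|yR].
  + by exists a1; rewrite // eX1 !inE eqxx.
  + by have [x xL <-] := sL y yL; exists x; rewrite ?hLE // eX1 !inE xL orbT.
  by have [x xR <-] := sR y yR; exists x; rewrite ?hRE // eX1 !inE xR !orbT.
- move=> x y /hX[[-> ->]|[-> xL]|[-> xR]] /hX[[-> ->]|[-> yL]|[-> yR]].
  + by rewrite e1_irr e2_irr.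
  + by rewrite aL1 // aL2 ?mL //; have [_ _ ->] := cL y yL.
  + by rewrite aR1 // aR2 ?mR //; have [_ -> _] := cR y yR.
  + by rewrite e1_sym e2_sym aL1 // aL2 ?mL //; have [_ _ ->] := cL x xL.
  + exact: aL.
  + by rewrite LR1 // LR2 ?mL ?mR //; have [-> _ _] := cL x xL; have [-> _ _] := cR y yR.
  + by rewrite e1_sym e2_sym aR1 // aR2 ?mR //; have [_ -> _] := cR x xR.
  + rewrite e1_sym e2_sym LR1 // LR2 ?mL ?mR //.
    by have [-> _ _] := cL y yL; have [-> _ _] := cR x xR.
  exact: aR.
move=> x /hX[[-> ->]|[-> xL]|[-> xR]].
- by rewrite af1 af2 (negPf al1) (negPf al2) (negPf ar1) (negPf ar2).
- have [/negPf-> /negPf->] := oL1 x xL; have [/negPf-> /negPf->] := oL2 _ (mL x xL).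
  by have [_ -> _] := cL x xL.
have [/negPf-> /negPf->] := oR1 x xR; have [/negPf-> /negPf->] := oR2 _ (mR x xR).
by have [_ _ ->] := cR x xR.
Qed.

Lemma closed_blob_iso t : closed_blob e1 t -> closed_blob e2 t ->
  exists h : T1 -> T2, bijective h /\ forall x y, e1 x y = e2 (h x) (h y).
Proof.
case=> v1 [f1 [l1 [r1 b1]]] [v2 [f2 [l2 [r2 b2]]]].
have [h [[hm hi hs ha] hc]] := blob_iso b1 b2.
have s1 := star_closed e1_sym e1_irr b1; have s2 := star_closed e2_sym e2_irr b2.
pose H x := if x == v1 then v2 else h x.
have Hv : H v1 = v2 by rewrite /H eqxx.
have Hn x : x != v1 -> H x = h x by rewrite /H => /negPf ->.
have hv x : x != v1 -> h x != v2.
  by move=> xv; have := hm x; rewrite !inE => /(_ xv).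
have vadj1 x : e1 v1 x = (x != v1) && [|| x \in f1, x \in l1 | x \in r1].
  apply/idP/andP => [vx|[xv]].
    have : [set v1; x] \in star e1 v1 by rewrite set2_star // vx eqxx.
    rewrite s1 !inE (eq_sym x v1) (edge_neq e1_irr vx) -orbA.
    by case/or3P=> /eqP <-; rewrite !inE eqxx ?orbT.
  have i1 E : E \in [set f1; l1; r1] -> x \in E -> e1 v1 x.
    rewrite -s1 inE => /andP[EE vE] xE; rewrite -(set2_edge e1_sym e1_irr).
    by rewrite -(edge_eq2 e1_irr EE vE xE) // eq_sym.
  by case/or3P; apply: i1; rewrite !inE eqxx ?orbT.
have vadj2 x : e2 v2 x = (x != v2) && [|| x \in f2, x \in l2 | x \in r2].
  apply/idP/andP => [vx|[xv]].
    have : [set v2; x] \in star e2 v2 by rewrite set2_star // vx eqxx.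
    rewrite s2 !inE (eq_sym x v2) (edge_neq e2_irr vx) -orbA.
    by case/or3P=> /eqP <-; rewrite !inE eqxx ?orbT.
  have i2 E : E \in [set f2; l2; r2] -> x \in E -> e2 v2 x.
    rewrite -s2 inE => /andP[EE vE] xE; rewrite -(set2_edge e2_sym e2_irr).
    by rewrite -(edge_eq2 e2_irr EE vE xE) // eq_sym.
  by case/or3P; apply: i2; rewrite !inE eqxx ?orbT.
have vH x : x != v1 -> e1 v1 x = e2 v2 (h x).
  move=> xv; rewrite vadj1 vadj2 xv hv //=.
  by have [|-> -> ->] := hc x; rewrite ?inE.
exists H; split; last first.
  move=> x y; case: (eqVneq x v1) => [->|xv]; case: (eqVneq y v1) => [->|yv].
  - by rewrite e1_irr e2_irr.
  - by rewrite Hv Hn // vH.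
  - by rewrite Hv Hn // e1_sym e2_sym vH.
  by rewrite !Hn // ha // !inE.
have Hi : injective H.
  move=> x y; case: (eqVneq x v1) => [->|xv]; case: (eqVneq y v1) => [->|yv] //.
  - by rewrite Hv Hn // => eq; have := hv y yv; rewrite -eq eqxx.
  - by rewrite Hv Hn // => eq; have := hv x xv; rewrite eq eqxx.
  by rewrite !Hn // => /hi; apply; rewrite !inE.
have Hs : forall y, exists x, H x = y.
  move=> y; case: (eqVneq y v2) => [->|yv]; first by exists v1.
  have [|x xX <-] := hs y; first by rewrite !inE.
  by exists x; rewrite Hn //; move: xX; rewrite !inE.
have [k Hk] := fin_all_exists Hs; exists k => // x; exact: Hi.
Qed.

End Isomorphism.

(** * Extended prisms *)

(* A tree together with the vertices and the internal edges of a blob of that shape, in a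
   graph whose vertices are natural numbers. *)
Inductive ltree := LLeaf of nat | LNode of nat & nat * nat & nat * nat & nat * nat & ltree & ltree.

Fixpoint ltree_shape lt := match lt with
  | LLeaf _ => Leaf
  | LNode _ _ _ _ tl tr => Node (ltree_shape tl) (ltree_shape tr)
  end.

Fixpoint lverts lt := match lt with
  | LLeaf d => [:: d]
  | LNode a _ _ _ tl tr => a :: (lverts tl ++ lverts tr)
  end.

Definition inc a (E : nat * nat) := (a == E.1) || (a == E.2).
Definition eqe (E F : nat * nat) := eqp E.1 E.2 F.1 F.2.

Fixpoint distinct (s : seq (nat * nat)) :=
  if s is E :: s' then all (fun F => ~~ eqe E F) s' && distinct s' else true.

Section LabelledBlobs.
Variables (n : nat) (adj : nat -> nat -> bool).

Definition star_at a (s : seq (nat * nat)) :=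
  all (fun j => adj a j == has (eqe (a, j)) s) (iota 0 n) &&
  all (fun E => [&& inc a E, E.1 < n & E.2 < n]) s.

(** A Boolean counterpart of [blob], so that decompositions of concrete graphs can be checked by
    evaluation. Disjointness of the pieces is left to [uniq (lverts lt)]. *)
Fixpoint lblob lt f l r := match lt with
  | LLeaf d => star_at d [:: f; l; r] && distinct [:: f; l; r]
  | LNode a g p q tl tr =>
      [&& star_at a [:: f; p; q], distinct [:: f; l; r; g; p; q], lblob tl g l p & lblob tr g q r]
  end.

Variables (T : finType) (e : rel T) (phi : T -> nat).
Hypothesis e_irr : irreflexive e.
Hypothesis e_sym : symmetric e.
Hypothesis phi_inj : injective phi.
Hypothesis phi_lt : forall x, phi x < n.
Hypothesis phi_onto : forall i, i < n -> exists x, phi x = i.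
Hypothesis phi_adj : forall x y, e x y = adj (phi x) (phi y).

Definition label_edge E := [set x | inc (phi x) E].
Definition label_set (s : seq nat) := [set x | phi x \in s].
Definition in_range (E : nat * nat) := (E.1 < n) && (E.2 < n).

Lemma label_edge2 x y E : eqe (phi x, phi y) E -> label_edge E = [set x; y].
Proof.
case: E => i j; rewrite /eqe /eqp /= => h; apply/setP => z; rewrite !inE /inc /=.
rewrite -!(inj_eq phi_inj).
by case/orP: h => /andP[/eqP <- /eqP <-] //; rewrite orbC.
Qed.

Lemma label_edge_inj E F : in_range E -> in_range F -> label_edge E = label_edge F -> eqe E F.
Proof.
move=> /andP[E1 E2] /andP[F1 F2] eq.
have [x1 p1] := phi_onto E1; have [x2 p2] := phi_onto E2.
have [y1 q1] := phi_onto F1; have [y2 q2] := phi_onto F2.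
have mem z : inc (phi z) E = inc (phi z) F.
  by have := congr1 (fun A : {set T} => z \in A) eq; rewrite !inE.
have := mem x1; have := mem x2; have := mem y1; have := mem y2.
rewrite /inc /eqe /eqp p1 p2 q1 q2 !eqxx /= ?orbT; clear; lia.
Qed.

Lemma distinct_uniq s : all in_range s -> distinct s -> uniq [seq label_edge E | E <- s].
Proof.
elim: s => //= E s IH /andP[Er sr] /andP[/allP nE ds]; rewrite IH // andbT.
apply/mapP => -[F Fs eq]; have := nE F Fs; rewrite label_edge_inj //.
exact: (allP sr).
Qed.

Lemma star_at_range a s : star_at a s -> all in_range s.
Proof. by case/andP=> _ /allP h; apply/allP => E /h /and3P[_ h1 h2]; rewrite /in_range h1. Qed.

Lemma star_atP x f p q : star_at (phi x) [:: f; p; q] ->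
  star e x = [set label_edge f; label_edge p; label_edge q].
Proof.
set s := [:: f; p; q] => /andP[/allP st /allP rg].
have st' y : adj (phi x) (phi y) = has (eqe (phi x, phi y)) s.
  by apply/eqP/st; rewrite mem_iota phi_lt.
suff -> : star e x = [set:: [seq label_edge E | E <- s]].
  by apply/setP=> E; rewrite !inE orbA.
apply/setP=> A; rewrite [RHS]inE; apply/idP/mapP => [|[E Es ->]].
  case/starP => // y xy ->; move: xy; rewrite phi_adj st' => /hasP[E Es eE].
  by exists E => //; rewrite (label_edge2 eE).
have /and3P[xE E1 E2] := rg E Es.
have [y eE] : exists y, eqe (phi x, phi y) E.
  case: (E) xE E1 E2 => i j /orP[/eqP /= <-|/eqP /= <-] h1 h2.
    by have [y <-] := phi_onto h2; exists y; rewrite /eqe /eqp /= !eqxx.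
  by have [y <-] := phi_onto h1; exists y; rewrite /eqe /eqp /= !eqxx orbT.
rewrite (label_edge2 eE) set2_star // eqxx phi_adj st' andbT.
by apply/hasP; exists E.
Qed.

Lemma lblob_range lt f l r : lblob lt f l r -> all in_range [:: f; l; r].
Proof.
elim: lt f l r => [d|a g p q tl IHl tr IHr] f l r /=; first by case/andP=> /star_at_range.
case/and4P=> /star_at_range + _ /IHl + /IHr /=; rewrite !andbT.
by move=> /and3P[-> _ _] /and3P[_ -> _] /and3P[_ _ ->].
Qed.

Lemma lblob_blob lt f l r : lblob lt f l r -> uniq (lverts lt) -> all (fun i => i < n) (lverts lt) ->
  blob e (ltree_shape lt) (label_set (lverts lt)) (label_edge f) (label_edge l) (label_edge r).
Proof.
elim: lt f l r => [d|a g p q tl IHl tr IHr] f l r.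
  move=> /= /andP[st ds] _; rewrite andbT => /phi_onto[x px]; exists x; split.
  - by apply/setP=> y; rewrite !inE -px (inj_eq phi_inj).
  - by apply: star_atP; rewrite px.
  exact: (distinct_uniq (star_at_range st) ds).
move=> lb; have := lblob_range lb; case/and4P: lb => st ds bL bR rg.
rewrite [lverts _]/= cons_uniq cat_uniq [all _ _]/= all_cat mem_cat negb_or.
move=> /and4P[/andP[aL aR] uL /hasPn dLR uR] /and3P[an nL nR].
have [x px] := phi_onto an.
exists x, (label_set (lverts tl)), (label_set (lverts tr)), (label_edge g), (label_edge p), (label_edge q).
split; split.
- by apply/setP=> y; rewrite !inE mem_cat -px (inj_eq phi_inj).
- by rewrite !inE px negb_or aL.
- rewrite -setI_eq0; apply/eqP/setP=> y; rewrite !inE; apply/negP => /andP[yL yR].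
  by have := dLR _ yR; rewrite /= yL.
- by apply: star_atP; rewrite px.
- suff: uniq [seq label_edge E | E <- [:: f; l; r; g; p; q]] by [].
  apply: distinct_uniq ds; have := star_at_range st; have := lblob_range bL.
  by move: rg => /= /and4P[-> -> -> _] /and4P[-> _ _ _] /and4P[_ -> -> _].
- exact: IHl.
exact: IHr.
Qed.

Lemma lblob_closed v lt f l r : lblob lt f l r -> uniq (v :: lverts lt) ->
  v < n -> (forall i, (i < n) = (i \in v :: lverts lt)) ->
  closed_blob e (ltree_shape lt).
Proof.
move=> lb /= /andP[vlt ult] vn all_in; have [x px] := phi_onto vn.
exists x, (label_edge f), (label_edge l), (label_edge r).
have -> : ~: [set x] = label_set (lverts lt).
  apply/setP=> y; rewrite !inE; have := phi_lt y; rewrite all_in inE -px (inj_eq phi_inj).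
  by case: eqP => [->|] //=; rewrite px (negPf vlt).
apply: lblob_blob => //; apply/allP => i ilt.
by rewrite all_in inE ilt orbT.
Qed.

End LabelledBlobs.

(** * The pattern (3,1) *)

Section IsoPrism.
Variables (T : finType) (e : rel T).
Hypothesis e_sym : symmetric e.
Hypothesis e_irr : irreflexive e.

Lemma iso_closed g v lt f l r : iso_to e g -> lblob (pn g) (padj g) lt f l r ->
  uniq (v :: lverts lt) -> v < pn g -> (forall i, (i < pn g) = (i \in v :: lverts lt)) ->
  closed_blob e (ltree_shape lt).
Proof.
case=> F [[G FK GK] adjF] lb u vn all_in.
apply: (lblob_closed (phi := fun x => F x : nat) e_irr e_sym _ _ _ _ lb u vn all_in).
- by move=> x y /val_inj /(can_inj FK).
- by move=> x; apply: ltn_ord.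
- by move=> i lti; exists (G (Ordinal lti)); rewrite GK.
exact: adjF.
Qed.

Lemma iota_cover n (s : seq nat) : perm_eq s (iota 0 n) -> forall i, (i < n) = (i \in s).
Proof. by move=> p i; rewrite (perm_mem p) mem_iota. Qed.

Lemma prism31_closed : iso_to e (ext_prism [:: 3; 1]) ->
  closed_blob e (Node (Node (comb 2) Leaf) Leaf) /\ closed_blob e (Node (comb 2) (comb 1)).
Proof.
move=> iso; split.
  (* Removing the ends 2 and 1 of the lonely edge leaves the bridge between 0 and 3. *)
  pose lt := LNode 1 (0, 3) (1, 4) (0, 1)
    (LNode 3 (4, 7) (3, 6) (3, 4)
      (LNode 7 (5, 9) (5, 7) (7, 8) (LLeaf 5)
         (LNode 9 (6, 8) (8, 9) (6, 9) (LLeaf 8) (LLeaf 6))) (LLeaf 4)) (LLeaf 0).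
  by apply: (iso_closed (v := 2) (lt := lt) (f := (1, 2)) (l := (2, 5)) (r := (0, 2)) iso) => //;
     apply: iota_cover.
(* Another lonely edge: removing its ends 4 and 3 leaves the bridge between 2 and 5. *)
pose lt := LNode 3 (2, 5) (3, 6) (0, 3)
  (LNode 5 (7, 8) (5, 7) (5, 9) (LLeaf 7)
     (LNode 8 (6, 9) (8, 9) (6, 8) (LLeaf 9) (LLeaf 6)))
  (LNode 2 (0, 1) (0, 2) (1, 2) (LLeaf 0) (LLeaf 1)).
by apply: (iso_closed (v := 4) (lt := lt) (f := (3, 4)) (l := (4, 7)) (r := (1, 4)) iso) => //;
   apply: iota_cover.
Qed.

End IsoPrism.

(** * The ladders of pattern (3,...,3) *)

Lemma ext3_adj g a b : let n := pn g in let x := ptv g in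
  padj (ext g 3) a b =
  [|| padj g a b && ~~ (eqp a b (x 3) (x 1) || eqp a b (x 3) (x 2)),
      eqp a b n (x 1), eqp a b n.+1 (x 2), eqp a b n n.+1, eqp a b n (x 3) | eqp a b n.+1 (x 3)].
Proof.
move=> n x; rewrite /= -/n -/x !addn0 !addn1 orbF.
have sw i j : eqp a b i j = eqp a b j i by rewrite /eqp orbC.
rewrite (sw n.+1 n) (sw (x 3) n) (sw (x 3) n.+1).
by case: (padj g a b && _) => //=; case: (eqp a b n (x 1)) => //=; case: (eqp a b n.+1 (x 2)) => //=;
   case: (eqp a b n n.+1); case: (eqp a b n (x 3)); case: (eqp a b n.+1 (x 3)).
Qed.

(* [rung j] and [(rung j).+1] are the ends of the j-th rung of the ladder obtained from the
   prism by removing the vertices 2 and 5, which are the tips of its two end triangles. *)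
Definition rung j := if j < 2 then 3 * j else 2 * j + 2.

Lemma rungP j : j = 0 /\ rung j = 0 \/ j = 1 /\ rung j = 3 \/ 2 <= j /\ rung j = 2 * j + 2.
Proof. by rewrite /rung; case: j => [|[|j]]; [left | right; left | right; right]. Qed.

Lemma rung_lt i j : i < j -> (rung i).+1 < rung j.
Proof. by have := rungP i; have := rungP j; clear; lia. Qed.

Lemma rung_neq j : [/\ rung j <> 5, (rung j).+1 <> 5, rung j <> 2 & (rung j).+1 <> 2].
Proof. by have := rungP j; split; move: H; clear; lia. Qed.

(** Replaces every equality of labels that linear arithmetic settles from the context, so that few
    comparisons remain. *)
Ltac decide_eqs := rewrite /eqp; repeat match goal with
  |- context [@eq_op _ ?a ?b] =>
    let H := fresh in
    first [ have H : (a == b) = true by (apply/eqP; clear -b a; lia)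
          | have H : (a == b) = true by (apply/eqP; lia)
          | have H : (a == b) = false by (apply/eqP; lia) ];
    rewrite ?H ?andbF ?andbT ?orbF ?orbT /=; clear H end.

(** Neighbours of the two ends of a rung along the rails. Before rung 0 comes the tip 2, after the
    last rung [k.+1] the tip 5; primes denote the second rail. *)
Definition below j := if j is i.+1 then rung i else 2.
Definition below' j := if j is i.+1 then (rung i).+1 else 2.
Definition above k j := if j == k.+1 then 5 else rung j.+1.
Definition above' k j := if j == k.+1 then 5 else (rung j.+1).+1.

(** An extension of index 3 keeps the tip 5 and inserts a rung between it and the former last rung.
    The clause on labels out of range says that the two new labels carry no edge before the
    extension. *)
Lemma ladder_adj k : let g := ext_prism (nseq k 3) in
  [/\ pn g = 2 * k + 6, ptv g 1 = rung k.+1, ptv g 2 = (rung k.+1).+1 & ptv g 3 = 5] /\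
  [/\ forall b, padj g 2 b = [|| b == 0, b == 1 | b == 5],
      forall b, padj g 5 b = [|| b == rung k.+1, b == (rung k.+1).+1 | b == 2],
      forall j b, j <= k.+1 ->
        padj g (rung j) b = [|| b == below j, b == above k j | b == (rung j).+1],
      forall j b, j <= k.+1 ->
        padj g (rung j).+1 b = [|| b == below' j, b == above' k j | b == rung j] &
      forall a b, pn g <= a -> padj g a b = false].
Proof.
elim: k => [|k].
  split=> //; split=> /=.
  - by case=> [|[|[|[|[|[|b]]]]]].
  - by case=> [|[|[|[|[|[|b]]]]]].
  - by case=> [|[|j]] [|[|[|[|[|[|b]]]]]].
  - by case=> [|[|j]] [|[|[|[|[|[|b]]]]]].
  by case=> [|[|[|[|[|[|a]]]]]].
have -> : ext_prism (nseq k.+1 3) = ext (ext_prism (nseq k 3)) 3.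
  by rewrite /ext_prism -foldl_rcons -cats1 -(nseqD k 1) addn1.
set g := ext_prism (nseq k 3) => -[[en e1 e2 e3] [a2 a5 ar ar' aout]].
have adj a b : padj (ext g 3) a b =
  [|| padj g a b && ~~ (eqp a b 5 (rung k.+1) || eqp a b 5 (rung k.+1).+1),
      eqp a b (2 * k + 6) (rung k.+1), eqp a b (2 * k + 6).+1 (rung k.+1).+1,
      eqp a b (2 * k + 6) (2 * k + 6).+1, eqp a b (2 * k + 6) 5 | eqp a b (2 * k + 6).+1 5].
  by rewrite ext3_adj /= en e1 e2 e3.
have rk : rung k.+2 = 2 * k + 6 by rewrite /rung /=; clear; lia.
have [R5 R5' R2 R2'] := rung_neq k.+1.
have Rn : (rung k.+1).+1 < 2 * k + 6 by rewrite -rk; apply: rung_lt.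
have n6 : 6 <= 2 * k + 6 by rewrite leq_addl.
have R0 : 3 <= rung k.+1 by have := rungP k.+1; clear; lia.
split.
  split; rewrite [LHS]/= ?en ?rk //; clear; lia.
split.
- move=> b; rewrite adj a2; move: R5 R5' R2 R2' Rn R0 n6; clear.
  by move: (rung k.+1) (2 * k + 6) => R n *; decide_eqs.
- move=> b; rewrite adj a5 rk; move: R5 R5' R2 R2' Rn R0 n6; clear.
  move: (rung k.+1) (2 * k + 6) => R n *; decide_eqs.
  case: (eqVneq b R) => [->|] /=; first by decide_eqs.
  case: (eqVneq b R.+1) => [->|] /=; first by decide_eqs.
  by move=> _ _; case: (b == 2); case: (b == n); case: (b == n.+1).
(* Three kinds of rung: the new one, the former last one, which exchanges its neighbour 5 for the
   new rung, and the untouched ones. *)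
- move=> j b; rewrite leq_eqVlt => /orP[/eqP->|jk].
    rewrite adj aout; last by rewrite en rk.
    rewrite /below /above eqxx rk; move: R5 R5' R2 R2' Rn R0 n6; clear.
    move: (rung k.+1) (2 * k + 6) => R n *; decide_eqs.
    by do 4?case: (b == _).
  rewrite adj ar //; have -> : above k.+1 j = rung j.+1.
    by rewrite /above; case: eqP => // eq; rewrite eq ltnn in jk.
  move: jk; rewrite ltnS leq_eqVlt => /orP[/eqP->|jk].
    have [B5 B5' B2 B2'] := rung_neq k; have BR := rung_lt (ltnSn k).
    rewrite /below /above eqxx rk; move: R5 R5' R2 R2' Rn R0 n6 B5 B5' B2 B2' BR; clear.
    move: (rung k.+1) (rung k) (2 * k + 6) => R B n *; decide_eqs.
    case: (eqVneq b 5) => [->|_]; first by decide_eqs.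
    by rewrite andbT /=; do 4?case: (b == _).
  have -> : above k j = rung j.+1.
    by rewrite /above; case: eqP => // eq; rewrite eq ltnn in jk.
  have [j5 j5' j2 j2'] := rung_neq j; have jR := rung_lt jk.
  move: R5 R5' R2 R2' Rn R0 n6 j5 j5' j2 j2' jR; clear.
  by move: (rung k.+1) (rung j) (2 * k + 6) (below j) (rung j.+1) => R J n B A *; decide_eqs.
- move=> j b; rewrite leq_eqVlt => /orP[/eqP->|jk].
    rewrite adj aout; last by rewrite en rk leqW.
    rewrite /below' /above' eqxx rk; move: R5 R5' R2 R2' Rn R0 n6; clear.
    move: (rung k.+1) (2 * k + 6) => R n *; decide_eqs.
    by do 4?case: (b == _).
  rewrite adj ar' //; have -> : above' k.+1 j = (rung j.+1).+1.
    by rewrite /above'; case: eqP => // eq; rewrite eq ltnn in jk.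
  move: jk; rewrite ltnS leq_eqVlt => /orP[/eqP->|jk].
    have [B5 B5' B2 B2'] := rung_neq k; have BR := rung_lt (ltnSn k).
    rewrite /below' /above' eqxx rk; move: R5 R5' R2 R2' Rn R0 n6 B5 B5' B2 B2' BR; clear.
    move: (rung k.+1) (rung k) (2 * k + 6) => R B n *; decide_eqs.
    case: (eqVneq b 5) => [->|_]; first by decide_eqs.
    by rewrite andbT /=; do 4?case: (b == _).
  have -> : above' k j = (rung j.+1).+1.
    by rewrite /above'; case: eqP => // eq; rewrite eq ltnn in jk.
  have [j5 j5' j2 j2'] := rung_neq j; have jR := rung_lt jk.
  move: R5 R5' R2 R2' Rn R0 n6 j5 j5' j2 j2' jR; clear.
  by move: (rung k.+1) (rung j) (2 * k + 6) (below' j) (rung j.+1) => R J n B A *; decide_eqs.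
move=> a b; rewrite [pn _]/= en => na.
rewrite adj aout; last by rewrite en; move: na; clear; lia.
by move: na R5 R5' R2 R2' Rn R0 n6; clear; move: (rung k.+1) (2 * k + 6) => R n *; decide_eqs.
Qed.

Definition rail j := (below j, rung j).
Definition rail' j := (below' j, (rung j).+1).

(** The part of the ladder below rung [i], tip 2 included. Removing one end of the top rung of this
    part leaves the other end as a leaf and makes the opposite rail the bridge, so the distinguished
    rail alternates; [b] records which one it is. *)
Fixpoint lladder (b : bool) i := match i with
  | 0 => LLeaf 2
  | j.+1 =>
    if b then LNode (rung j) (rail' j) (rung j, (rung j).+1) (rail j) (LLeaf (rung j).+1)
                    (lladder false j)
    else LNode (rung j).+1 (rail j) (rung j, (rung j).+1) (rail' j) (LLeaf (rung j))
               (lladder true j)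
  end.

Lemma shape_lladder b i : ltree_shape (lladder b i) = comb i.
Proof. by elim: i b => //= i IH [] /=; rewrite IH. Qed.

Lemma mem_lladder b i x : (x \in lverts (lladder b i.+1)) = (x < rung i.+1) && (x != 5).
Proof.
elim: i b => [|i IH] b; first by case: b; case: x => [|[|[|[|x]]]].
have -> : (x \in lverts (lladder b i.+2)) =
    [|| x == rung i.+1, x == (rung i.+1).+1 | x \in lverts (lladder (~~ b) i.+1)].
  by case: b; rewrite [lladder _ _]/= [lverts _]/= !in_cons // orbCA.
rewrite IH; have := rungP i.+1; have := rungP i.+2; clear.
move: (rung i.+1) (rung i.+2) => R R'; lia.
Qed.

Lemma uniq_lladder b i : uniq (lverts (lladder b i)).
Proof.
elim: i b => // i IH b.
have : uniq (rung i :: (rung i).+1 :: lverts (lladder (~~ b) i)).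
  rewrite !cons_uniq IH andbT in_cons negb_or; case: i {IH} => [|i]; first by case: b.
  by rewrite !mem_lladder ltnn ltnNge leqnSn andbT; apply/eqP; clear; lia.
case: b => // h; rewrite [lladder _ _]/= [lverts _]/=.
move: h; rewrite !cons_uniq !in_cons !negb_or (eq_sym (rung i)).
by case/andP=> /andP[-> ->] /andP[-> ->].
Qed.

(** The edge [(2, 5)] is the third cut edge at every stage, since the tip 2 stays inside and 5
    outside. *)
Lemma lblob_lladder k b i : i <= k.+1 ->
  lblob (2 * k + 6) (padj (ext_prism (nseq k 3))) (lladder b i)
    (if b then rail i else rail' i) (if b then rail' i else rail i) (2, 5).
Proof.
have [_ [a2 a5 ar ar' _]] := ladder_adj k; move: (padj _) a2 a5 ar ar' => adj a2 a5 ar ar'.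
have n6 : 5 < 2 * k + 6 by rewrite leq_addl.
have rn j : j <= k.+1 -> (rung j).+1 < 2 * k + 6.
  by have := rungP j; clear; lia.
move: (2 * k + 6) n6 rn => n n6 rn.
elim: i b => [|i IH] b ik.
  have st s : perm_eq s [:: rail 0; rail' 0; (2, 5)] -> star_at n adj 2 s.
    move=> p; apply/andP; split; last first.
      rewrite (perm_all _ p) /rail /rail' /inc /rung /=.
      by move: n6; clear; lia.
    apply/allP => j _; rewrite a2 (perm_has _ p) /rail /rail' /eqe /eqp /rung /=.
    by rewrite !orbF.
  by case: b; rewrite /= st.
have {}ik : i <= k by [].
have hab : above k i = rung i.+1.
  by rewrite /above; case: eqP => // eq; rewrite eq ltnn in ik.
have hab' : above' k i = (rung i.+1).+1.
  by rewrite /above'; case: eqP => // eq; rewrite eq ltnn in ik.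
have B2 : (below i <= below' i) && (below' i < rung i.+1).
  case: (i) => [|j] //; rewrite /below /below' leqnSn.
  by have := rung_lt (ltnSn j); have := rung_lt (ltnSn j.+1); clear; lia.
have BJ : [/\ below i <> rung i, below i <> (rung i).+1, below' i <> rung i & below' i <> (rung i).+1].
  case: (i) => [|j] /=; first by [].
  by have h := rung_lt (ltnSn j); split; move: h; clear; lia.
have JR := rung_lt (ltnSn i); have Rn := rn i.+1 ik.
have [J5 J5' J2 J2'] := rung_neq i; have [R5 R5' R2 R2'] := rung_neq i.+1.
have IHt := IH true (leqW ik); have IHf := IH false (leqW ik).
have stJ s : perm_eq s [:: rail i.+1; (rung i, (rung i).+1); rail i] -> star_at n adj (rung i) s.
  move=> p; apply/andP; split.
    apply/allP => j _; rewrite ar ?leqW // (perm_has _ p) /rail /eqe /eqp hab /=.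
    case: BJ; move: B2 JR Rn; clear.
    move: (below i) (below' i) (rung i) (rung i.+1) => B B' J R *; decide_eqs.
    by do 4?case: (j == _).
  rewrite (perm_all _ p) /rail /inc /=; move: B2 JR Rn; clear; lia.
have stJ' s : perm_eq s [:: rail' i.+1; (rung i, (rung i).+1); rail' i] -> star_at n adj (rung i).+1 s.
  move=> p; apply/andP; split.
    apply/allP => j _; rewrite ar' ?leqW // (perm_has _ p) /rail' /eqe /eqp hab' /=.
    case: BJ; move: B2 JR Rn; clear.
    move: (below i) (below' i) (rung i) (rung i.+1) => B B' J R *; decide_eqs.
    by do 4?case: (j == _).
  rewrite (perm_all _ p) /rail' /inc /=; move: B2 JR Rn; clear; lia.
case: b; rewrite /=.
  rewrite stJ // stJ' ?IHf ?andbT; last first.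
    by apply/permP => a /=; clear; lia.
  rewrite /rail /rail' /eqe /= ;
  case: BJ; move: B2 JR Rn J5 J5' J2 J2' R5 R5' R2 R2'; clear.
  by move: (below i) (below' i) (rung i) (rung i.+1) => B B' J R *; decide_eqs.
rewrite stJ' // stJ ?IHt ?andbT; last first.
  by apply/permP => a /=; clear; lia.
rewrite /rail /rail' /eqe /=.
case: BJ; move: B2 JR Rn J5 J5' J2 J2' R5 R5' R2 R2'; clear.
by move: (below i) (below' i) (rung i) (rung i.+1) => B B' J R *; decide_eqs.
Qed.

(** * The two implications *)

Section Main.
Variables (T : finType) (e : rel T).
Hypothesis e_sym : symmetric e.
Hypothesis e_irr : irreflexive e.

Lemma ladder_closed k : 0 < k -> iso_to e (ext_prism (nseq k 3)) ->
  closed_blob e (Node (comb k.+1) Leaf).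
Proof.
move=> k0 iso; set R := rung k.+1.
(* The lonely edge joins the tip 5 to the end [R.+1] of the last rung. Without these two vertices,
   [R] hangs on the rest by the bridge [rail k.+1]. *)
pose lt := LNode 5 (rail k.+1) (2, 5) (5, R) (lladder true k.+1) (LLeaf R).
have -> : Node (comb k.+1) Leaf = ltree_shape lt by rewrite [ltree_shape _]/= -/(lladder true k.+1) -/(ltree_shape (lladder true k.+1)) shape_lladder.
have [[en _ _ _] [a2 a5 ar ar' _]] := ladder_adj k.
have lb := @lblob_lladder k true k.+1 (leqnn _); rewrite -en in lb.
have [R5 R5' R2 R2'] := rung_neq k.+1.
have eqv : lverts lt = 5 :: (lverts (lladder true k.+1) ++ [:: R]) by [].
have mems := mem_lladder true k; have us := uniq_lladder true k.+1.
have Rn : (rung k.+1).+2 = 2 * k + 6 by rewrite /rung; case: k k0 {iso R lt lb en a2 a5 ar ar' R5 R5' R2 R2' eqv mems us} => //= j; clear; lia.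
have R3 : 6 <= rung k.+1 by have := rungP k.+1; move: k0; clear; lia.
have B1 := rung_lt (ltnSn k); have [B5 B5' B2 B2'] := rung_neq k.
apply: (iso_closed e_sym e_irr (v := R.+1) (lt := lt) (f := (5, R.+1)) (l := rail' k.+1)
  (r := (R, R.+1)) iso).
- have [s5 sR] : star_at (2 * k + 6) (padj (ext_prism (nseq k 3))) 5 [:: (5, R.+1); (2, 5); (5, R)] /\
     star_at (2 * k + 6) (padj (ext_prism (nseq k 3))) R [:: rail k.+1; (5, R); (R, R.+1)].
    rewrite -Rn -/R; split; apply/andP; split.
    - apply/allP => j _; rewrite a5 /eqe /= -/R; move: R5 R5' R2 R2' R3; rewrite -/R.
      by clear; move: R => R *; decide_eqs; do 4?case: (j == _).
    - by rewrite /inc /=; move: R3; rewrite -/R; clear; lia.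
    - apply/allP => j _; rewrite (ar k.+1) // /eqe /rail /above eqxx /= -/R.
      move: R5 R5' R2 R2' R3 B1 B5 B2; rewrite -/R.
      by clear; move: R (rung k) => R B *; decide_eqs; do 4?case: (j == _).
    by rewrite /inc /rail /=; move: B1 R3; rewrite -/R; clear; lia.
  have [d1 d2] : distinct [:: (5, R.+1); rail' k.+1; (R, R.+1); rail k.+1; (2, 5); (5, R)] /\
      distinct [:: rail k.+1; (5, R); (R, R.+1)].
    rewrite /= /eqe /rail /rail' /=; move: R5 R5' R2 R2' R3 B1 B5 B5' B2 B2'; rewrite -/R.
    by clear; move: R (rung k) => R B *; split; decide_eqs.
  rewrite en in lb *; apply/and4P; split; [exact: s5 | exact: d1 | exact: lb |].
  by apply/andP; split; [exact: sR | exact: d2].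
- rewrite eqv; move: (lverts (lladder true k.+1)) mems us => s mems us.
  have p : perm_eq [:: R.+1, 5 & s ++ [:: R]] [:: R, R.+1, 5 & s].
    by apply/permP => a; rewrite /= count_cat /=; clear; lia.
  rewrite (perm_uniq p) 3!cons_uniq us !in_cons !mems eqxx andbF !negb_or.
  by rewrite -/R; move: R5 R5'; rewrite -/R; clear; lia.
- by rewrite en -/R -Rn.
move=> i; rewrite en -Rn eqv; move: (lverts (lladder true k.+1)) mems {us eqv} => s mems.
rewrite !in_cons mem_cat mems inE -/R.
by move: R3 R5; rewrite -/R; clear; lia.
Qed.

Lemma closed_in_U4 t : closed_blob e t -> lonely_total t = 4 -> in_U4 e.
Proof.
move=> c t4; have [v [f [l [r b]]]] := c.
have [num lf] := num_lonely_closed e_sym e_irr b.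
split; [exact: closed_blob_cubic c | exact: closed_three_connected c | exists f | by rewrite num].
(* The distinguished edge is lonely for every tree: [v] cannot use three edges, so the [ztr] term
   drops out and 1 remains. *)
rewrite lf; case: (countE top_weight t) => -> _ _; by rewrite muln0 addn0.
Qed.

End Main.

Lemma eqpC a b c d : eqp b a c d = eqp a b c d.
Proof. by rewrite /eqp orbC (andbC (b == d)) (andbC (b == c)). Qed.

Lemma padj_sym pat a b : padj (ext_prism pat) b a = padj (ext_prism pat) a b.
Proof.
rewrite /ext_prism; have : forall a b, padj prism b a = padj prism a b.
  by move=> x y /=; rewrite !(eqpC x y).
elim: pat prism => [|s pat IH] g hg; first exact: hg.
apply: IH => x y; rewrite /= hg.
by rewrite !(eqpC x y).
Qed.

Lemma ladder_irr k a : padj (ext_prism (nseq k 3)) a a = false.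
Proof.
elim: k => [|k IH]; first by move: a => [|[|[|[|[|[|a]]]]]].
have [[en e1 e2 e3] _] := ladder_adj k.
have -> : ext_prism (nseq k.+1 3) = ext (ext_prism (nseq k 3)) 3.
  by rewrite /ext_prism -foldl_rcons -cats1 -(nseqD k 1) addn1.
have := rung_lt (ltnSn k.+1); have rk : rung k.+2 = 2 * k + 6 by rewrite /rung /=; clear; lia.
rewrite ext3_adj IH en e1 e2 e3 rk /eqp /=.
move: (rung k.+1) => R; clear; lia.
Qed.

(** The labels of [g] form a graph on an ordinal type which is isomorphic to [g] by the identity and
    hence has the same tree [t]. *)
Lemma closed_blob_iso_to (T : finType) (e : rel T) g t :
  symmetric e -> irreflexive e -> closed_blob e t ->
  (forall a b, padj g b a = padj g a b) -> (forall a, a < pn g -> padj g a a = false) ->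
  (forall (T' : finType) (e' : rel T'), symmetric e' -> irreflexive e' ->
     iso_to e' g -> closed_blob e' t) ->
  iso_to e g.
Proof.
move=> e_sym e_irr c gs gi gc; pose e' (i j : 'I_(pn g)) := padj g i j.
have e's : symmetric e' by move=> i j; apply: gs.
have e'i : irreflexive e' by move=> i; apply: gi.
apply: (closed_blob_iso e_sym e_irr e's e'i c); apply: gc => //.
by exists id; split=> //; exists id.
Qed.

Theorem mainTheorem11 (T : finType) (e : rel T)
    (e_sym : symmetric e) (e_irr : irreflexive e) :
  in_U4 e <->
  (iso_to e (ext_prism [:: 3; 1]) \/
   exists k : nat, 2 <= k /\ iso_to e (ext_prism (nseq k 3))).
Proof.
split; last first.
  case=> [/(prism31_closed e_sym e_irr)[_ c]|[k [k2 /(ladder_closed e_sym e_irr (ltnW k2)) c]]].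
    exact: closed_in_U4 c lonely_total_fork.
  by apply: closed_in_U4 c _ => //; exact: lonely_total_comb.
case=> cub conn3 [f lf] num.
have [t ct] := closed_blob_exists e_sym e_irr cub conn3 lf.
have t4 : lonely_total t = 4.
  by have [v [f' [l [r b]]]] := ct; have [<- _] := num_lonely_closed e_sym e_irr b.
have prism31_irr a : a < pn (ext_prism [:: 3; 1]) -> padj (ext_prism [:: 3; 1]) a a = false.
  by do 10?[case: a => [|a] //].
have [] := lonely_total_eq4 _ _ ct t4.
- exact: closed_blob_mirror.
- exact: closed_blob_flip.
(* The prism already contributes one node to the comb, hence the shift by one between nodes and
   extensions. *)
- case=> k k3 c; right; exists k.-1; split; first by case: k k3 {c} => // k; rewrite ltnS.
  case: k k3 c => // k k2 c; apply: (closed_blob_iso_to e_sym e_irr c).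
  - exact: padj_sym.
  - by move=> a _; exact: ladder_irr.
  by move=> T' e' s i; apply: ladder_closed => //; exact: ltnW.
- move=> c; left; apply: (closed_blob_iso_to e_sym e_irr c) => //; first exact: padj_sym.
  by move=> T' e' s i /(prism31_closed s i)[].
move=> c; left; apply: (closed_blob_iso_to e_sym e_irr c) => //; first exact: padj_sym.
by move=> T' e' s i /(prism31_closed s i)[].
Qed.
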